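(* Let $\{m^0_\delta\}_{0<\delta<1/2}$ be a family of initial data in $H^1(\omega,\mathbb{S}^2)$ and suppose that the following assumptions hold. (A1) Each $m_\delta^0$ satisfies $m_\delta^0(x_1,x_2)=m_{\pm\infty}$ for $x_1=\pm1$ and every $x_2\in\mathbb{T}$, and $\sup_{0<\delta<1/2}\delta|\log\delta|\,\tilde E_\delta(m_\delta^0)<+\infty$. (A2) $\varepsilon=\varepsilon(\delta)>0$ satisfies $\varepsilon\to0$ and $\frac1{\delta|\log\delta|}=o(|\log\varepsilon|)$ as $\delta\to0$; moreover $\alpha=\nu\varepsilon$ and $\beta=\lambda\varepsilon$, where $\nu>0$ is fixed and $\lambda=\lambda(\delta)>0$ satisfies $\lambda(\delta)=o\left(\sqrt{\delta|\log\delta|}\right)$ as $\delta\to0$. (A3) $v_\delta\in L^\infty([0,+\infty)\times\omega,\mathbb{R}^2)$ satisfies $\|v_\delta\|^2_{L^\infty([0,+\infty)\times\omega)}\le\alpha\beta$. Let $\{m_\delta\}_{0<\delta<1/2}$ be any family of global weak solutions to $$\partial_t m_\delta+\alpha\, m_\delta\times\partial_t m_\delta+\beta\, m_\delta\times\nabla\tilde E_\delta(m_\delta)+(v_\delta\cdot\nabla)m_\delta=m_\delta\times(v_\delta\cdot\nabla)m_\delta\quad\text{on }[0,+\infty)\times\omega$$ satisfying $m_\delta(0,\cdot)=m_\delta^0$ in $\omega$, $m_\delta(t,x_1,x_2)=m_\delta^0(x_1,x_2)$ for $x_1=\pm1$, $x_2\in\mathbb{T}$, $t\ge0$, and, for all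 $t\ge0$, $$\tilde E_\delta(m_\delta(t))+\frac{\alpha}{2\beta}\int_0^t\|\partial_t m_\delta(s)\|_{L^2(\omega)}^2\,ds\le\tilde E_\delta(m_\delta^0)\exp\left(\frac{4}{\alpha\beta}\int_0^t\|v_\delta(s)\|_{L^\infty(\omega)}^2\,ds\right).$$ Assume moreover that the initial data are well-prepared: $$\limsup_{\delta\to0}\ \delta|\log\delta|\,\tilde E_\delta(m_\delta^0)\le\frac\pi2(1-m_{1,\infty})^2 .$$ Let $\delta_n\to0$ and $x_1^*\in[-1,1]$ be such that $m^0_{\delta_n}\to m^*$ in $L^2(\omega)$, where $m^*$ is the straight wall $$m^*(x_1,x_2)=\begin{cases}m_{-\infty}&\text{for }x_1<x_1^*,\\ m_{+\infty}&\text{for }x_1>x_1^*.\end{cases}$$ Then $m_{\delta_n}(t)\to m^*$ in $L^2(\omega)$ for all $t\ge0$.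
   Context: $\omega=(-1,1)\times\mathbb{T}$ with $\mathbb{T}=\mathbb{R}/\mathbb{Z}$ (periodic in $x_2$), with boundary $\partial\omega=\{|x_1|=1\}$. A number $m_{1,\infty}\in[0,1)$ is fixed and $m_{\pm\infty}=\left(m_{1,\infty},\pm\sqrt{1-m_{1,\infty}^2},0\right)$. For $f\in H^{-1}(\omega)$, $(-\Delta)^{-1}f\in H^1_0(\omega)$ denotes the solution $g$ of $-\Delta g=f$ in $\omega$, $g=0$ on $\partial\omega$. It is a compact self-adjoint operator on $L^2(\omega)$, and by functional calculus $|\nabla|^{-2s}:=[(-\Delta)^{-1}]^s$ for $s=1/2$ and $s=1/4$, i.e. $|\nabla|^{-1}$ and $|\nabla|^{-1/2}$. For $m=(m',m_3):\omega\to\mathbb{S}^2$, $m'=(m_1,m_2)$, and $\varepsilon=\varepsilon(\delta)$, $$\tilde E_\delta(m)=\int_\omega\left(|\nabla m|^2+\frac1{\varepsilon^2}m_3^2\right)dx+\frac1{2\delta}\int_\omega\left||\nabla|^{-1/2}\nabla\cdot m'\right|^2dx,$$ $$\nabla\tilde E_\delta(m)=-2\Delta m+\left(\frac1\delta\mathcal{P}(m'),\frac{2m_3}{\varepsilon^2}\right),\qquad \mathcal{P}(m')=-\nabla|\nabla|^{-1}\nabla\cdot m'.$$ $\times$ is the cross product in $\mathbb{R}^3$ and $(v\cdot\nabla)m=v_1\partial_1m+v_2\partial_2m$. Global weak solution: a map $m\in L^\infty_{\mathrm{loc}}([0,+\infty),H^1(\omega,\mathbb{S}^2))\cap\dot H^1_{\mathrm{loc}}([0,+\infty),L^2(\omega))$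 (the latter meaning $\partial_tm\in L^2_{\mathrm{loc}}([0,+\infty),L^2(\omega))$) that solves the equation in $\mathcal{D}'((0,+\infty)\times\omega)$, where $m\times\Delta m$ is understood in $H^{-1}(\omega)$ via $\langle m\times\Delta m,\phi\rangle=-\sum_{j=1}^2\int_\omega(m\times\partial_jm)\cdot\partial_j\phi\,dx$ for $\phi\in H^1_0(\omega)$. Boundary values are in the sense of traces. *)

(* Defs.v *)
From HB Require Import structures.
From mathcomp Require Import all_boot all_order all_algebra.
From mathcomp Require Import all_classical all_reals all_analysis.

Set Implicit Arguments.
Unset Strict Implicit.
Unset Printing Implicit Defensive.

Import Order.TTheory GRing.Theory Num.Theory.
Import numFieldNormedType.Exports.

Local Open Scope classical_set_scope.
Local Open Scope ring_scope.

(* Functions on omega = (-1,1) x (R/Z) are represented by functions on R * R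
   of which only the values on the fundamental cell ]-1,1[ x [0,1[ matter; the
   periodicity in the second variable is carried by the test functions. *)

Section Wall.
Context {R : realType}.

Local Notation leb := (@lebesgue_measure R).
Local Notation leb2 := (leb \x leb)%E.
Local Notation leb3 := (leb2 \x leb)%E.

Definition omega : set (R * R) := `]-1, 1[%classic `*` `[0, 1[%classic.

(* Space-time points are written (x, t). *)
Definition cylinder : set ((R * R) * R) := omega `*` `[0, +oo[%classic.

Definition dot n (u w : 'rV[R]_n) : R := \sum_i u 0 i * w 0 i.

Definition enorm n (u : 'rV[R]_n) : R := Num.sqrt (dot u u).

(* The indices live in Z/3Z. *)
Definition cross (u w : 'rV[R]_3) : 'rV[R]_3 :=
  \row_i (u 0 (i + 1) * w 0 (i + 2) - u 0 (i + 2) * w 0 (i + 1)).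

Definition mcomp n (m : R * R -> 'rV[R]_n) (i : 'I_n) : R * R -> R :=
  fun x => m x 0 i.

(* Differentiability is required in every direction, which in finite dimension
   amounts to the usual class C^k. *)
Fixpoint Ck (V W : normedModType R) (k : nat) (f : V -> W) : Prop :=
  continuous f /\
  if k is k'.+1 then
    forall v, (forall x, derivable f x v) /\ Ck k' (fun x => 'D_v f x)
  else True.

Definition smooth (V W : normedModType R) (f : V -> W) : Prop :=
  forall k, Ck k f.

Definition dir (j : 'I_2) : R * R := ((j == 0)%:R, (j == 1)%:R).

Definition partial (W : normedModType R) (j : 'I_2) (f : R * R -> W) :
  R * R -> W := fun x => 'D_(dir j) f x.

Definition smooth_closure (W : normedModType R) (phi : R * R -> W) : Prop :=
  smooth phi /\ forall x1 x2, phi (x1, x2 + 1) = phi (x1, x2).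

Definition test (W : normedModType R) (phi : R * R -> W) : Prop :=
  smooth_closure phi /\
  exists2 c : R, c < 1 & forall x, c < `|x.1| -> phi x = 0.

Definition test_time (phi : (R * R) * R -> 'rV[R]_3) : Prop :=
  [/\ smooth phi,
      forall x1 x2 t, phi ((x1, x2 + 1), t) = phi ((x1, x2), t),
      exists a b : R, 0 < a /\
        forall x t, ~~ (a <= t <= b) -> phi (x, t) = 0
    & exists2 c : R, c < 1 & forall x t, c < `|x.1| -> phi (x, t) = 0].

Definition L2norm (f : R * R -> R) : \bar R :=
  'N[leb2]_2[EFin \o (f \_ omega)]%E.

Definition L2 (f : R * R -> R) : Prop := (f \_ omega) \in Lfun leb2 2%:E.

Definition inner (f g : R * R -> R) : R := \int[leb2]_(x in omega) (f x * g x).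

Definition L2cvg (u : nat -> R * R -> R) (f : R * R -> R) : Prop :=
  L2norm (u n \- f) @[n --> \oo] --> 0%E.

Definition vL2norm n (m : R * R -> 'rV[R]_n) : \bar R :=
  L2norm (fun x => enorm (m x)).

Definition is_wderiv (j : 'I_2) (f g : R * R -> R) : Prop :=
  L2 g /\ forall phi : R * R -> R^o, test phi ->
    inner f (partial j phi) = - inner g phi.

(* Weak derivatives, fractional powers and time derivatives are unique up to
   null sets; a representative is selected by choice (the default 0 is only
   reached when none exists, e.g. for the weak derivative of f outside H^1). *)
Definition wderiv (j : 'I_2) (f : R * R -> R) : R * R -> R :=
  xget (fun=> 0) [set g | is_wderiv j f g].

Definition wderivv n (j : 'I_2) (m : R * R -> 'rV[R]_n) : R * R -> 'rV[R]_n :=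
  fun x => \row_i wderiv j (mcomp m i) x.

Definition H1 (f : R * R -> R) : Prop :=
  L2 f /\ forall j, exists g, is_wderiv j f g.

Definition H1cvg (phi : nat -> R * R -> R^o) (f : R * R -> R) : Prop :=
  L2cvg phi f /\ forall j, L2cvg (fun n => partial j (phi n)) (wderiv j f).

Definition H10 (f : R * R -> R) : Prop :=
  H1 f /\ exists phi : nat -> R * R -> R^o,
    (forall n, test (phi n)) /\ H1cvg phi f.

Definition L2norm1 (g : R -> R) : \bar R :=
  'N[leb]_2[EFin \o (g \_ `[0%R, 1%R[%classic)]%E.

(* g : R/Z -> R (seen on [0,1[) is the trace of f on the circle x1 = s,
   for s = -1 or s = 1. *)
Definition is_trace (f : R * R -> R) (s : R) (g : R -> R) : Prop :=
  [/\ H1 f,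
      (g \_ `[0, 1[%classic) \in Lfun leb 2%:E
    & exists phi : nat -> R * R -> R^o,
      [/\ forall n, smooth_closure (phi n),
          H1cvg phi f
        & L2norm1 (fun x2 => phi n (s, x2) - g x2) @[n --> \oo] --> 0%E]].

Definition H1S2 (m : R * R -> 'rV[R]_3) : Prop :=
  (forall i, H1 (mcomp m i)) /\
  {ae leb2, forall x, omega x -> dot (m x) (m x) = 1}.

Definition H1normsq (m : R * R -> 'rV[R]_3) : \bar R :=
  \int[leb2]_(x in omega)
    (dot (m x) (m x) +
     \sum_j dot (wderivv j m x) (wderivv j m x))%:E.

(* g = (- Delta)^-1 f *)
Definition is_inv_lap (f g : R * R -> R) : Prop :=
  H10 g /\ forall phi : R * R -> R^o, test phi ->
    \sum_j inner (wderiv j g) (partial j phi) = inner f phi.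

Definition eigenbasis (e : nat -> R * R -> R) (mu : nat -> R) : Prop :=
  [/\ forall k, L2 (e k),
      forall k l, inner (e k) (e l) = (k == l)%:R,
      forall f, L2 f ->
        L2cvg (fun n x => \sum_(k < n) inner f (e k) * e k x) f
    & forall k, is_inv_lap (e k) (fun x => mu k * e k x)].

(* Functional calculus of the compact self-adjoint operator (- Delta)^-1:
   g is the L^2 sum of the series mu_k^s <f, e_k> e_k. *)
Definition is_inv_lap_pow (s : R) (f g : R * R -> R) : Prop :=
  L2 g /\ exists e mu, eigenbasis e mu /\
    L2cvg (fun n x => \sum_(k < n) mu k `^ s * inner f (e k) * e k x) g.

(* |nabla|^(-2s) *)
Definition inv_lap_pow (s : R) (f : R * R -> R) : R * R -> R :=
  xget (fun=> 0) [set g | is_inv_lap_pow s f g].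

Definition divp (m : R * R -> 'rV[R]_3) : R * R -> R :=
  fun x => wderiv 0 (mcomp m 0) x + wderiv 1 (mcomp m 1) x.

Definition calP (m : R * R -> 'rV[R]_3) (j : 'I_2) : R * R -> R :=
  fun x => - wderiv j (inv_lap_pow 2^-1 (divp m)) x.

Definition energy (delta eps : R) (m : R * R -> 'rV[R]_3) : \bar R :=
  (\int[leb2]_(x in omega)
     (\sum_j dot (wderivv j m x) (wderivv j m x) +
      (eps ^+ 2)^-1 * m x 0 2 ^+ 2)%:E +
   (2 * delta)^-1%:E *
   \int[leb2]_(x in omega) (inv_lap_pow 4^-1 (divp m) x ^+ 2)%:E)%E.

Definition vinner n (f g : R * R -> 'rV[R]_n) : R :=
  \int[leb2]_(x in omega) dot (f x) (g x).

(* <m x Delta m, phi> *)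
Definition cross_lap (m phi : R * R -> 'rV[R]_3) : R :=
  - \sum_j vinner (fun x => cross (m x) (wderivv j m x)) (partial j phi).

(* The part (P(m') / delta, 2 m_3 / eps^2) of nabla E(m). *)
Definition gradE0 (delta eps : R) (m : R * R -> 'rV[R]_3) :
  R * R -> 'rV[R]_3 :=
  fun x => \row_i [:: delta^-1 * calP m 0 x; delta^-1 * calP m 1 x;
                      2 * m x 0 2 / eps ^+ 2]`_i.

(* <m x nabla E(m), phi> *)
Definition cross_gradE (delta eps : R) (m phi : R * R -> 'rV[R]_3) : R :=
  - 2 * cross_lap m phi +
  vinner (fun x => cross (m x) (gradE0 delta eps m x)) phi.

(* (v . nabla) m *)
Definition transport (v : R * R -> 'rV[R]_2) (m : R * R -> 'rV[R]_3) :
  R * R -> 'rV[R]_3 :=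
  fun x => \sum_j v x 0 j *: wderivv j m x.

Definition joint_measurable n (f : R -> R * R -> 'rV[R]_n) : Prop :=
  forall i, measurable_fun cylinder (fun z : (R * R) * R => f z.2 z.1 0 i).

Definition Linf_loc_H1S2 (m : R -> R * R -> 'rV[R]_3) : Prop :=
  joint_measurable m /\
  forall T : R, exists C : R,
    {ae leb, forall t, 0 <= t <= T -> H1S2 (m t) /\ (H1normsq (m t) <= C%:E)%E}.

Definition is_tderiv (m w : R -> R * R -> 'rV[R]_3) : Prop :=
  [/\ joint_measurable w,
      forall T : R, (\int[leb]_(t in `[0%R, T]) vL2norm (w t) ^+ 2 < +oo)%E
    & forall phi, test_time phi ->
        \int[leb]_(t in `]0, +oo[)
          vinner (m t) (fun x => 'D_((0, 1) : (R * R) * R) phi (x, t)) =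
        - \int[leb]_(t in `]0, +oo[) vinner (w t) (fun x => phi (x, t))].

Definition tderiv (m : R -> R * R -> 'rV[R]_3) : R -> R * R -> 'rV[R]_3 :=
  xget (fun _ _ => 0) [set w | is_tderiv m w].

(* Since d_t m belongs to L^2_loc([0,+oo[, L^2), m has a representative that is
   continuous from [0,+oo[ to L^2; m t denotes the value of that one. *)
Definition L2_continuous (m : R -> R * R -> 'rV[R]_3) : Prop :=
  forall t0, 0 <= t0 ->
    vL2norm (m t \- m t0) @[t --> within `[0, +oo[%classic (nbhs t0)] --> 0%E.

Definition LLG (delta eps alpha beta : R) (v : R -> R * R -> 'rV[R]_2)
    (m : R -> R * R -> 'rV[R]_3) : Prop :=
  forall phi, test_time phi ->
    \int[leb]_(t in `]0, +oo[)
      (vinner (fun x => tderiv m t x + alpha *: cross (m t x) (tderiv m t x))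
              (fun x => phi (x, t)) +
       beta * cross_gradE delta eps (m t) (fun x => phi (x, t)) +
       vinner (transport (v t) (m t)) (fun x => phi (x, t))) =
    \int[leb]_(t in `]0, +oo[)
      vinner (fun x => cross (m t x) (transport (v t) (m t) x))
             (fun x => phi (x, t)).

Definition weak_solution (delta eps alpha beta : R)
    (v : R -> R * R -> 'rV[R]_2) (m : R -> R * R -> 'rV[R]_3) : Prop :=
  [/\ Linf_loc_H1S2 m, exists w, is_tderiv m w, L2_continuous m
    & LLG delta eps alpha beta v m].

(* The L^oo norm on [0,+oo[ x omega of the Euclidean norm of v. *)
Definition Linf_norm_time (v : R -> R * R -> 'rV[R]_2) : \bar R :=
  'N[leb3]_+oo[EFin \o
    ((fun z : (R * R) * R => enorm (v z.2 z.1)) \_ cylinder)]%E.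

Definition Linf_norm (v : R * R -> 'rV[R]_2) : \bar R :=
  'N[leb2]_+oo[EFin \o ((fun x => enorm (v x))%R \_ omega)]%E.

Definition energy_inequality (delta eps alpha beta : R)
    (v : R -> R * R -> 'rV[R]_2) (m0 : R * R -> 'rV[R]_3)
    (m : R -> R * R -> 'rV[R]_3) : Prop :=
  forall t, 0 <= t ->
    (energy delta eps (m t) +
       (alpha / (2 * beta))%:E *
       \int[leb]_(s in `[0%R, t]) vL2norm (tderiv m s) ^+ 2
     <= energy delta eps m0 *
        expeR ((4 / (alpha * beta))%:E *
               \int[leb]_(s in `[0%R, t]) Linf_norm (v s) ^+ 2))%E.

(* m_{+oo} for s = 1 and m_{-oo} for s = -1 *)
Definition m_infty (a s : R) : 'rV[R]_3 :=
  \row_i [:: a; s * Num.sqrt (1 - a ^+ 2); 0]`_i.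

Definition straight_wall (a xs : R) : R * R -> 'rV[R]_3 :=
  fun x => if x.1 < xs then m_infty a (-1) else m_infty a 1.

End Wall.

(* Main.v *)
Require Import Defs.
From HB Require Import structures.
From mathcomp Require Import all_boot all_order all_algebra.
From mathcomp Require Import all_classical all_reals all_analysis.
From mathcomp Require Import measurable_realfun ess_sup_inf.
From mathcomp Require Import ring lra.

(** Why the wall does not move.

    All maps take values in the unit sphere, so for every [t] the squared
    distance of [m t] to the wall [m*] is [4 - 2 * \int m t . m*], where 4 is
    twice the area of [omega]. The distance at time [t] therefore exceeds
    the distance at time 0, which tends to 0 by assumption, by
    [2 * \int (m 0 - m t) . m*] only: it suffices that [m t - m 0] tends to 0
    weakly, and no compactness is needed. Moreover [m*] depends on [x.1] only
    and its components are step functions, which are close in [L^1] to smooth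
    cutoffs [chi] vanishing near the boundary ([step_approx]). What has to be
    shown is that, for a fixed cutoff [chi] and a fixed component [i], the
    amplitude [\int chi(x.1) * m t x i] varies by o(1) between the times 0
    and [t].

    This variation is read off from the equation, tested with
    [psi(s) chi(x.1) e_i], where [psi] is a smooth plateau that rises from 0
    to 1 just after time 0 and falls back just after time [t]; since [m] is
    continuous in time with values in [L^2], the pairing of [psi'] with the
    amplitude tends to the wanted difference as the edges become steep
    ([plateau_pairing], [amplitude_drift]). All other terms of the equation are
    small. With [x = delta * |ln delta|], the energy inequality and
    [|v|^2 <= alpha * beta] bound the energy up to time [t + 1] by [C / x]
    ([energy_growth]), and [alpha = nu * eps], [beta = lambda * eps] lead to the
    following ([slice_estimate], [time_estimate], [flux_le]).

    - The damping, exchange and transport terms are bounded by [eps] times a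
      power of [1 / x].
    - In the nonlocal term [beta / delta * P(m')] the gradient is moved onto
      [chi * m_a]: if [g] is [|nabla|^-1] of the divergence of [m'], then the
      square norm of [g] is at most 4 times that of the divergence, because
      the eigenvalues of the inverse Laplacian lie in [[0, 4]]
      ([H10_poincare], [eigenvalue_itv], [inv_lap_half_L2]). As [1 / delta] is
      at most [4 / x^2], this is again [eps] times a power of [1 / x].
    - The anisotropy term [2 * beta * m_3 / eps^2] is the only one in which
      [eps] is lost: the energy controls the square norm of [m_3] by
      [eps^2 * C / x], which leaves [lambda / sqrt x] up to a constant.

    The first assumption on the rates says that [eps <= exp (- 1 / x)], which
    beats every power of [x], and the second that [lambda / sqrt x] tends to 0
    ([flux_small]).

    A recurring technical point is that the slices of the integrands in time
    need not be measurable. The integral of a nonnegative function is a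
    supremum over simple functions below it, hence it is monotone for arbitrary
    functions, and an integral remains controlled as soon as its integrand is
    close to an integrable function ([Rintegral_close]). *)

Import Order.TTheory GRing.Theory Num.Theory.
Import numFieldNormedType.Exports.

Set Implicit Arguments.
Unset Strict Implicit.
Unset Printing Implicit Defensive.

Local Open Scope classical_set_scope.
Local Open Scope ring_scope.

(** * Calculus of functions of class C^k *)

Section Ck_calculus.
Context {R : realType}.
Implicit Types (V W : normedModType R).

Lemma Ck_continuous V W k (f : V -> W) : Ck k f -> continuous f.
Proof. by case: k => [|k] []. Qed.

Lemma CkW V W k (f : V -> W) : Ck k.+1 f -> Ck k f.
Proof.
elim: k f => [|k IH] f [cf df]; split=> // v; split; first by have [] := df v.
by apply: IH; have [] := df v.
Qed.

Lemma derivable_line_cvg V W (f : V -> W) x v : derivable f x v ->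
  f (h *: v + x) @[h --> (0 : R)^'] --> f x.
Proof.
move=> df; have : {for 0, continuous (fun h : R => f (h *: v + x))}.
  exact/differentiable_continuous/derivable1_diffP/(derivable1P _ _ _).1.
by move=> /continuous_withinNx; rewrite scale0r add0r.
Qed.

(** The product rule for a scalar function times a vector-valued one, on an
    arbitrary normed domain. *)
Lemma is_derive_scale V W (s : V -> R^o) (f : V -> W) x v ds df : is_derive x v s ds ->
  is_derive x v f df ->
  is_derive x v (fun y => (s y : R) *: f y) (s x *: df + ds *: f x).
Proof.
move=> [ds1 <-] [df1 <-].
have H : (fun h : R => h^-1 *: (((fun y => (s y : R) *: f y) \o shift x) (h *: v)
    - s x *: f x)) @ 0^' --> s x *: 'D_v f x + 'D_v s x *: f x.
  rewrite [X in X @ _](_ : _ = fun h : R =>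
      (s (h *: v + x) : R) *: (h^-1 *: (f (h *: v + x) - f x)) +
      (h^-1 *: (s (h *: v + x) - s x) : R) *: f x); last first.
    apply/funext => h /=.
    have -> : (s (h *: v + x) : R) *: f (h *: v + x) - s x *: f x =
      (s (h *: v + x) : R) *: (f (h *: v + x) - f x) +
      (s (h *: v + x) - s x : R) *: f x.
      by rewrite scalerBr scalerBl addrA subrK.
    by rewrite scalerDr !scalerA mulrC.
  apply: cvgD.
    by apply: cvgZ; [exact: (derivable_line_cvg ds1)|exact: df1].
  apply: cvgZr_tmp; exact: ds1.
apply: DeriveDef; last exact: cvg_lim H.
by apply/cvg_ex; eexists; exact: H.
Qed.

Lemma Ck_cst V W k (c : W) : Ck k (fun _ : V => c).
Proof.
elim: k c => [|k IH] c; split => //; try exact: cst_continuous.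
move=> v; split; first by move=> x; exact: derivable_cst.
have -> : (fun x : V => 'D_v (fun=> c) x) = (fun=> 0).
  by apply/funext => x; rewrite derive_cst.
exact: IH.
Qed.

Lemma Ck_add V W k (f g : V -> W) : Ck k f -> Ck k g -> Ck k (fun x => f x + g x).
Proof.
elim: k f g => [|k IH] f g [cf df] [cg dg].
  by split => // x; apply: cvgD; [exact: cf|exact: cg].
split; first by move=> x; apply: cvgD; [exact: cf|exact: cg].
move=> v; have [df1 df2] := df v; have [dg1 dg2] := dg v; split.
  by move=> x; exact: derivableD.
rewrite (_ : (fun x => _) = fun x => 'D_v f x + 'D_v g x); first exact: IH.
by apply/funext => x; rewrite -deriveD.
Qed.

Lemma Ck_scale V W k (s : V -> R^o) (f : V -> W) : Ck k s -> Ck k f -> Ck k (fun x => (s x : R) *: f x).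
Proof.
elim: k s f => [|k IH] s f Hs Hf.
  split => // x; apply: cvgZ; first exact: (Ck_continuous Hs).
  exact: (Ck_continuous Hf).
split; first by move=> x; apply: cvgZ; [exact: (Ck_continuous Hs)|exact: (Ck_continuous Hf)].
move=> v; have [ds1 ds2] := Hs.2 v; have [df1 df2] := Hf.2 v.
have D x := is_derive_scale (derivableP (ds1 x)) (derivableP (df1 x)).
split; first by move=> x; case: (D x).
rewrite (_ : (fun x => _) =
   fun x => (s x : R) *: 'D_v f x + ('D_v s x : R) *: f x); last first.
  by apply/funext => x; case: (D x).
by apply: Ck_add; apply: IH => //; exact: CkW.
Qed.

Lemma Ck_inv V k (s : V -> R^o) : (forall x, s x != 0) -> Ck k s -> Ck k (fun x => (s x)^-1 : R^o).
Proof.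
move=> s0; elim: k s s0 => [|k IH] s s0 Hs.
  by split => // x; apply: cvgV => //; exact: (Ck_continuous Hs).
split; first by move=> x; apply: cvgV => //; exact: (Ck_continuous Hs).
move=> v; have [ds1 ds2] := Hs.2 v; split.
  by move=> x; exact: derivableV.
rewrite (_ : (fun x => _) =
   fun x => (- ((s x)^-1 * (s x)^-1) : R) *: 'D_v s x); last first.
  by apply/funext => x; rewrite deriveV// expr2 invfM.
have Hi := IH _ s0 (CkW Hs).
apply: (@Ck_scale _ R^o _ (fun x => - ((s x)^-1 * (s x)^-1) : R^o)) => //.
rewrite (_ : (fun x => _) = fun x => (-1 : R) *: ((s x)^-1 *: ((s x)^-1 : R^o))).
  by apply: (@Ck_scale _ R^o _ (fun=> -1 : R^o)); [exact: Ck_cst|exact: Ck_scale].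
by apply/funext => x; rewrite scaleN1r.
Qed.

(** Every test function below is a one-variable function of an affine form, so this
    special case of the chain rule is enough; [l] is the linear part of [s]. *)
Lemma Ck_comp_affine V W k (psi : R^o -> W) (s : V -> R^o) (l : V -> R) :
  continuous s -> (forall (h : R) v x, s (h *: v + x) = h * l v + s x) ->
  Ck k psi -> Ck k (fun x => psi (s x)).
Proof.
move=> cs sl; elim: k psi => [|k IH] psi Hpsi.
  split => // x; apply: continuous_comp; first exact: cs.
  exact: (Ck_continuous Hpsi).
split.
  move=> x; apply: continuous_comp; first exact: cs.
  exact: (Ck_continuous Hpsi).
move=> v; have [d1 d2] := Hpsi.2 (l v).
have E x : (fun h : R => h^-1 *: (((fun y => psi (s y)) \o shift x) (h *: v) - psi (s x))) =
   (fun h : R => h^-1 *: ((psi \o shift (s x)) (h *: (l v : R^o)) - psi (s x))).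
  by apply/funext => h /=; rewrite sl.
split; first by move=> x; rewrite /derivable E; exact: d1.
rewrite (_ : (fun x => _) = fun x => 'D_(l v) psi (s x)); first exact: (IH (fun y => 'D_(l v) psi y) d2).
by apply/funext => x; rewrite /derive E.
Qed.

Lemma derive_comp_affine V W (psi : R^o -> W) (s : V -> R^o) (l : V -> R) x v :
  (forall (h : R) v x, s (h *: v + x) = h * l v + s x) ->
  'D_v (fun x => psi (s x)) x = 'D_(l v) psi (s x).
Proof.
move=> sl; have E : (fun h : R => h^-1 *: (((fun y => psi (s y)) \o shift x) (h *: v) - psi (s x))) =
   (fun h : R => h^-1 *: ((psi \o shift (s x)) (h *: (l v : R^o)) - psi (s x))).
  by apply/funext => h /=; rewrite sl.
by rewrite /derive E.
Qed.

Lemma derive_dir1 W (psi : R^o -> W) (x v : R) : derivable psi x 1 ->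
  is_derive (x : R^o) (v : R^o) psi (v *: 'D_1 psi x).
Proof.
move=> d1.
have d : differentiable psi x by apply/derivable1_diffP.
apply: DeriveDef; first exact: diff_derivable.
by rewrite !deriveE// -linearZ /=; congr ('d _ _ _); rewrite /GRing.scale /= mulr1.
Qed.

End Ck_calculus.

(** * Smooth steps *)

Section Bump.
Context {R : realType}.

(** The derivatives of [flat n] are combinations of [flat n.+1] and [flat n.+2], so
    the family is closed under derivation and all its members can be proved smooth
    at once. *)
Definition flat (n : nat) (x : R) : R :=
  if 0 < x then (x^-1) ^+ n * expR (- x^-1) else 0.

Lemma flat0 n x : x <= 0 -> flat n x = 0.
Proof. by rewrite /flat leNgt => /negbTE ->. Qed.

Lemma flat_ge0 n x : 0 <= flat n x.
Proof.
rewrite /flat; case: ifPn => // x0.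
by rewrite mulr_ge0 ?expR_ge0// exprn_ge0// invr_ge0 ltW.
Qed.

Lemma flat_gt0 n x : 0 < x -> 0 < flat n x.
Proof.
by rewrite /flat => x0; rewrite x0 mulr_gt0 ?expR_gt0// exprn_gt0// invr_gt0.
Qed.

Lemma flatS n x : flat n.+1 x = x^-1 * flat n x.
Proof. by rewrite /flat; case: ifPn => x0; rewrite ?mulr0// exprS mulrA. Qed.

(** From [y ^ (n + 1) <= (n + 1)! * exp y] at [y = x^-1]. It yields the
    differentiability at 0 here, and later the domination of [eps] by a power of
    [delta * |ln delta|]. *)
Lemma flat_le n x : flat n x <= (n.+1)`!%:R * `|x|.
Proof.
rewrite /flat; case: ifPn => x0; last by rewrite mulr_ge0.
rewrite gtr0_norm//.
have y0 : 0 <= x^-1 by rewrite invr_ge0 ltW.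
have := expR_ge1Dxn n y0 => H.
have {}H : x^-1 ^+ n.+1 <= n.+1`!%:R * expR x^-1.
  rewrite -ler_pdivrMl ?ltr0n ?fact_gt0//.
  by apply: le_trans H; rewrite mulrC lerDr.
rewrite expRN -[X in _ <= X * _]divr1 -(ler_pM2l (_ : 0 < x^-1)) ?invr_gt0//.
rewrite mulrA -exprS mulrCA mulVf ?gt_eqF// mulr1 divr1.
by rewrite ler_pdivrMr ?expR_gt0.
Qed.

Lemma flat_continuous0 n : flat n h @[h --> (0 : R)] --> (0 : R).
Proof.
apply: (@squeeze_cvgr _ _ _ _ (fun=> 0) (fun h => (n.+1)`!%:R * `|h|)).
- by near=> h; rewrite flat_ge0 flat_le.
- exact: cvg_cst.
- rewrite -[X in _ --> X](_ : n.+1`!%:R * `|0 : R| = 0); last by rewrite normr0 mulr0.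
  by apply: cvgM; [exact: cvg_cst|exact: norm_continuous].
Unshelve. all: by end_near. Qed.

Lemma flat_derive_algebra (n : nat) (y e : R) : y != 0 ->
  y^-1 ^+ n * (e / y ^+ 2) + e * (n%:R / y ^+ n.-1 * - y ^- 2) =
  - n%:R * (y ^- n.+1 * e) + y ^- n.+2 * e.
Proof.
move=> y0; case: n => [|n] /=; first by rewrite expr0; field.
by rewrite !exprS exprVn; field; rewrite expf_neq0// y0.
Qed.

Lemma flat_is_derive n x :
  is_derive (x : R^o) 1 (flat n : R^o -> R^o) (- n%:R * flat n.+1 x + flat n.+2 x).
Proof.
case: (ltgtP x 0) => [x0|x0|->].
- rewrite !flat0 ?(ltW x0)// mulr0 addr0.
  apply: (@near_eq_is_derive _ _ _ (cst 0)).
    by near=> y; rewrite /= flat0// ltW//; near: y; exact: (lt_nbhsl x0).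
- apply: (@near_eq_is_derive _ _ _ (fun y : R => (y^-1) ^+ n * expR (- y^-1))).
    near=> y; rewrite /flat ifT//; near: y; exact: (lt_nbhsr x0).
  have xn0 : x != 0 by rewrite gt_eqF.
  have dV : is_derive (x : R) 1 (fun y : R => y^-1) (- x ^- 2).
    have := is_deriveV xn0 (is_derive_id x 1).
    by move=> H; apply: is_derive_eq; rewrite [_%:A]mulr1.
  have dE : is_derive (x : R) 1 (fun y : R => expR (- y^-1)) (expR (- x^-1) * x ^- 2).
    have dN : is_derive x 1 (fun y : R => - y^-1) (x ^- 2).
      have H := is_deriveN dV; rewrite opprK in H; exact: H.
    exact: (@is_derive1_comp _ expR _ x).
  have H := is_deriveM (is_deriveX n dV) dE.
  rewrite [X in is_derive _ _ X](_ : _ =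
    ((fun y : R => y^-1) ^+ n * (fun y : R => expR (- y^-1)))); last first.
    by apply/funext => y; rewrite !fctE.
  apply: is_derive_eq.
  rewrite /flat x0 /GRing.scale /= !exprVn !fctE.
  exact: flat_derive_algebra.
- rewrite !flat0// mulr0 addr0.
  have H : (fun h : R => h^-1 *: ((flat n \o shift 0) (h *: (1 : R^o)) - flat n 0))
     @ 0^' --> (0 : R).
    rewrite [X in X @ _](_ : _ = flat n.+1); last first.
      by apply/funext => h /=; rewrite (@flat0 n 0)// subr0 addr0 flatS /GRing.scale /= mulr1.
    by apply: cvg_within_filter; exact: flat_continuous0.
  apply: DeriveDef; last exact: cvg_lim H.
  by apply/cvg_ex; exists 0; exact: H.
Unshelve. all: by end_near. Qed.

Lemma flat_smooth n : smooth (flat n : R^o -> R^o).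
Proof.
move=> k; elim: k n => [|k IH] n.
  split => // x; have [d _] := flat_is_derive n x.
  exact/differentiable_continuous/derivable1_diffP.
split.
  move=> x; have [d _] := flat_is_derive n x.
  exact/differentiable_continuous/derivable1_diffP.
move=> v.
have D x : is_derive (x : R^o) v (flat n : R^o -> R^o)
    (v *: (- n%:R * flat n.+1 x + flat n.+2 x)).
  have [d e] := flat_is_derive n x; rewrite -e.
  exact: derive_dir1 d.
split; first by move=> x; case: (D x).
rewrite (_ : (fun x => _) = fun x : R^o => (v : R) *: 
   (((- n%:R : R) *: (flat n.+1 x : R^o)) + (flat n.+2 x : R^o))); last first.
  by apply/funext => x; case: (D x).
apply: (@Ck_scale _ _ R^o _ (fun=> v)); first exact: Ck_cst.
apply: Ck_add; last exact: IH.
by apply: (@Ck_scale _ _ R^o _ (fun=> (- n%:R : R^o))); [exact: Ck_cst|exact: IH].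
Qed.

(** The usual smooth transition function. *)
Definition step (y : R) : R := flat 0 y / (flat 0 y + flat 0 (1 - y)).

Lemma step_den_gt0 y : 0 < flat 0 y + flat 0 (1 - y).
Proof.
have [y0|y0] := ltP 0 y; first by rewrite ltr_pwDl ?flat_gt0 ?flat_ge0.
by rewrite ltr_wpDl ?flat_ge0 ?flat_gt0//; lra.
Qed.

Lemma step_ge0 y : 0 <= step y.
Proof. by rewrite /step divr_ge0 ?flat_ge0// ltW// step_den_gt0. Qed.

Lemma step_le1 y : step y <= 1.
Proof. by rewrite /step ler_pdivrMr ?step_den_gt0// mul1r lerDl flat_ge0. Qed.

Lemma step0 y : y <= 0 -> step y = 0.
Proof. by move=> y0; rewrite /step flat0// mul0r. Qed.

Lemma step1 y : 1 <= y -> step y = 1.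
Proof.
move=> y1; rewrite /step (flat0 _ (_ : 1 - y <= 0)); last lra.
by rewrite addr0 divff// gt_eqF// flat_gt0//; lra.
Qed.

Lemma step_smooth : smooth (step : R^o -> R^o).
Proof.
move=> k.
have H1 := @flat_smooth 0 k.
have H2 : Ck k (fun y : R^o => flat 0 (1 - y) : R^o).
  apply: (@Ck_comp_affine _ R^o R^o k (flat 0 : R^o -> R^o) (fun y : R^o => 1 - y : R^o) (fun v => - v)) => //.
    by move=> x; apply: cvgB; [exact: cvg_cst|exact: cvg_id].
  by move=> h v x; rewrite /GRing.scale/=; ring.
apply: (@Ck_scale _ _ R^o _ (flat 0)) => //.
apply: (@Ck_inv _ _ _ (fun y : R^o => (flat 0 y + flat 0 (1 - y) : R^o))).
  by move=> x; rewrite gt_eqF// step_den_gt0.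
exact: Ck_add.
Qed.

End Bump.

(** * Test functions depending on one variable *)

Section Tests.
Context {R : realType}.
Implicit Types (chi psi : R^o -> R^o).

(** One-variable profiles [chi] such that [chi x.1] times a smooth periodic
    function is an admissible test function on [omega]. *)
Definition cutoff chi : Prop :=
  smooth chi /\ exists2 c : R, c < 1 & forall y, c < `|y| -> chi y = 0.

Lemma smooth_derivable (V W : normedModType R) (f : V -> W) x v :
  smooth f -> derivable f x v.
Proof. by move=> sf; have [_ /(_ v)[]] := sf 1. Qed.

Lemma smooth_continuous (V W : normedModType R) (f : V -> W) :
  smooth f -> continuous f.
Proof. by move=> /(_ 0)[]. Qed.

Lemma smooth_derive (V W : normedModType R) (f : V -> W) v :
  smooth f -> smooth (fun x => 'D_v f x).
Proof. by move=> sf k; have [_ /(_ v)[]] := sf k.+1. Qed.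

Lemma smooth_fst (V : normedModType R) chi :
  smooth chi -> smooth (fun x : R * V => chi x.1 : R^o).
Proof.
move=> sc k; apply: (@Ck_comp_affine _ _ R^o k chi (fun x : R * V => x.1 : R^o) (fun v => v.1)) => //.
by move=> x; exact: cvg_fst.
Qed.

Lemma derive_fst (V : normedModType R) chi (x v : R * V) : smooth chi ->
  'D_v (fun x : R * V => chi x.1 : R^o) x = v.1 * 'D_1 chi x.1.
Proof.
move=> sc; rewrite (@derive_comp_affine _ _ R^o chi (fun x : R * V => x.1 : R^o) (fun v => v.1))//.
by have [_ ->] := derive_dir1 v.1 (@smooth_derivable _ _ _ x.1 1 sc).
Qed.

Lemma smooth_scale (V W : normedModType R) (s : V -> R^o) (f : V -> W) :
  smooth s -> smooth f -> smooth (fun x => (s x : R) *: f x).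
Proof. by move=> ss sf k; apply: Ck_scale. Qed.

Lemma smooth_closure_mul chi (phi : R * R -> R^o) :
  smooth chi -> smooth_closure phi ->
  smooth_closure (fun x : R * R => chi x.1 * phi x : R^o).
Proof.
move=> sc [sp pp]; split; last by move=> x1 x2 /=; rewrite pp.
by apply: smooth_scale => //; exact: smooth_fst.
Qed.

Lemma test_mul chi (phi : R * R -> R^o) : smooth chi -> test phi ->
  test (fun x : R * R => chi x.1 * phi x : R^o).
Proof.
move=> sc [sp [c c1 pc]]; split; first exact: smooth_closure_mul.
by exists c => // x cx; rewrite pc// mulr0.
Qed.

Lemma test_cutoff chi (phi : R * R -> R^o) : cutoff chi -> smooth_closure phi ->
  test (fun x : R * R => chi x.1 * phi x : R^o).
Proof.
move=> [sc [c c1 pc]] sp; split; first exact: smooth_closure_mul.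
by exists c => // x cx; rewrite pc// mul0r.
Qed.

Lemma partial_mul chi (phi : R * R -> R^o) j x : smooth chi -> smooth phi ->
  partial j (fun x : R * R => chi x.1 * phi x : R^o) x =
  chi x.1 * partial j phi x + (j == 0)%:R * 'D_1 chi x.1 * phi x.
Proof.
move=> sc sp; rewrite /partial.
have D1 := derivableP (@smooth_derivable _ _ _ x (dir j) (@smooth_fst R^o chi sc)).
have D2 := derivableP (@smooth_derivable _ _ _ x (dir j) sp).
have [_ ->] := is_derive_scale D1 D2.
by rewrite derive_fst.
Qed.

Definition tensor psi chi (c : 'rV[R]_3) : (R * R) * R -> 'rV[R]_3 :=
  fun z => (psi z.2 * chi z.1.1 : R) *: c.

Lemma smooth_time psi : smooth psi -> smooth (fun z : (R * R) * R => psi z.2 : R^o).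
Proof.
move=> sc k; apply: (@Ck_comp_affine _ _ R^o k psi (fun x : (R * R) * R => x.2 : R^o) (fun v => v.2)) => //.
by move=> x; exact: cvg_snd.
Qed.

Lemma smooth_x1 chi : smooth chi -> smooth (fun z : (R * R) * R => chi z.1.1 : R^o).
Proof.
move=> sc k; apply: (@Ck_comp_affine _ _ R^o k chi (fun x : (R * R) * R => x.1.1 : R^o) (fun v => v.1.1)) => //.
by move=> x; apply: (@continuous_comp _ _ _ fst fst); [exact: cvg_fst|exact: cvg_fst].
Qed.

Lemma test_tensor psi chi c : smooth psi -> cutoff chi ->
  (exists a b : R, 0 < a /\ forall t, ~~ (a <= t <= b) -> psi t = 0) ->
  test_time (tensor psi chi c).
Proof.
move=> sp [sc [d d1 dc]] [a [b [a0 ab]]]; split.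
- apply: (@smooth_scale _ _ (fun z => psi z.2 * chi z.1.1 : R^o) (fun=> c)).
    apply: (@smooth_scale _ R^o (fun z => psi z.2 : R^o)); first exact: smooth_time.
    exact: smooth_x1.
  by move=> k; exact: Ck_cst.
- by [].
- by exists a, b; split=> // x t tab; rewrite /tensor /= ab// mul0r scale0r.
- by exists d => // x t dx; rewrite /tensor /= dc// mulr0 scale0r.
Qed.

Lemma tensor_dt psi chi c x t : smooth psi ->
  'D_((0, 1) : (R * R) * R) (tensor psi chi c) (x, t) =
  ('D_1 psi t * chi x.1) *: c.
Proof.
move=> sp.
rewrite (_ : tensor psi chi c = fun z => (psi z.2 : R) *: ((fun z : (R*R)*R => chi z.1.1 *: c) z)); last first.
  by apply/funext => z; rewrite scalerA.
have E z : (fun h : R => h^-1 *: (((fun z => (psi z.2 : R) *: ((fun z : (R*R)*R => chi z.1.1 *: c) z)) \o shift z) (h *: ((0, 1) : (R * R) * R))  -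
   psi z.2 *: (chi z.1.1 *: c))) =
  (fun h : R => h^-1 *: (((fun y : R^o => (psi y : R) *: (chi z.1.1 *: c)) \o shift (z.2 : R^o)) (h *: (1 : R^o)) -
    psi z.2 *: (chi z.1.1 *: c))).
  by apply/funext => h /=; rewrite scaler0 add0r.
rewrite /derive E -/(derive (fun y : R^o => (psi y : R) *: (chi x.1 *: c)) t 1).
have D1 := derivableP (@smooth_derivable _ _ _ (t : R^o) (1 : R^o) sp).
have D2 := is_derive_cst (chi x.1 *: c) (t : R^o) (1 : R^o).
have [_ ->] := is_derive_scale D1 D2.
by rewrite scaler0 add0r scalerA.
Qed.

Lemma tensor_partial psi chi c j x t : smooth chi ->
  partial j (fun x => tensor psi chi c (x, t)) x =
  ((j == 0)%:R * (psi t * 'D_1 chi x.1)) *: c.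
Proof.
move=> sc; rewrite /partial /tensor /=.
rewrite (_ : (fun x : R * R => (psi t * chi x.1) *: c) =
  (fun x => (chi x.1 : R) *: (psi t *: c))); last first.
  by apply/funext => y; rewrite scalerA mulrC.
have D1 := derivableP (@smooth_derivable _ _ _ x (dir j) (@smooth_fst R^o chi sc)).
have D2 := is_derive_cst (psi t *: c) x (dir j).
have [_ ->] := is_derive_scale D1 D2.
rewrite scaler0 add0r derive_fst// scalerA; congr (_ *: _) => /=; ring.
Qed.

End Tests.

(** * Integrals of arbitrary functions *)

Section LowerIntegral.
Context d (T : measurableType d) {R : realType} (mu : {measure set T -> \bar R}).
Implicit Types (D : set T).

(** No measurability: the integrals of the positive and negative parts are suprema
    over simple functions. *)
Lemma integral_mono D (f g : T -> \bar R) :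
  (forall x, D x -> (f x <= g x)%E) ->
  (\int[mu]_(x in D) f x <= \int[mu]_(x in D) g x)%E.
Proof.
move=> fg.
have H (u w : T -> \bar R) : (forall x, 0 <= u x)%E -> (forall x, u x <= w x)%E ->
    (\int[mu]_x u x <= \int[mu]_x w x)%E.
  move=> u0 uw; have w0 x : (0 <= w x)%E by exact: le_trans (uw x).
  rewrite !ge0_integralTE//; apply: le_ereal_sup => _ [h hu <-]; exists h => // x.
  exact: le_trans (uw x).
have H1 x : ((f \_ D) x <= (g \_ D) x)%E.
  by rewrite /patch; case: ifPn => //; rewrite inE => /fg.
rewrite integral_mkcond [leRHS]integral_mkcond integralE [leRHS]integralE.
apply: leeB.
  apply: H => x; first exact: funepos_ge0.
  by rewrite !funeposE ge_max !le_max H1 lexx orbT.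
apply: H => x; first exact: funeneg_ge0.
by rewrite !funenegE ge_max !le_max leeN2 H1 lexx orbT.
Qed.

(** Only the upper function has to be measurable: it is raised to [+oo] on a null set
    containing the exceptional points, which does not change its integral, and then
    [integral_mono] applies. *)
Lemma le_integral_ub D (f g : T -> \bar R) : measurable D -> measurable_fun D g ->
  {ae mu, forall x, D x -> (f x <= g x)%E} ->
  (\int[mu]_(x in D) f x <= \int[mu]_(x in D) g x)%E.
Proof.
move=> mD mg [N [mN N0 fgN]].
pose g' x := if x \in N then +oo%E else g x.
rewrite (_ : \int[mu]_(x in D) g x = \int[mu]_(x in D) g' x)%E.
  apply: integral_mono => x Dx; rewrite /g'; case: ifPn; first by rewrite leey.
  rewrite notin_setE => nN; apply: contrapT => h; apply: nN; apply: fgN => /=.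
  by move/(_ Dx).
apply: ae_eq_integral => //.
  apply: measurable_fun_if => //.
    apply: (measurable_fun_bool true).
    rewrite (_ : _ @^-1` _ = N); last first.
      by apply/seteqP; split => x /=; [exact: set_mem|exact: mem_set].
    exact: measurableI.
  by apply: measurable_funS mg => //; exact: subIsetl.
exists N; split => // x /= /not_implyP[Dx]; rewrite /g'; case: ifPn => //.
by move=> /set_mem.
Qed.

Lemma le_integral_lb D (f g : T -> \bar R) : measurable D -> measurable_fun D f ->
  {ae mu, forall x, D x -> (f x <= g x)%E} ->
  (\int[mu]_(x in D) f x <= \int[mu]_(x in D) g x)%E.
Proof.
move=> mD mf [N [mN N0 fgN]].
pose f' x := if x \in N then -oo%E else f x.
rewrite (_ : \int[mu]_(x in D) f x = \int[mu]_(x in D) f' x)%E.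
  apply: integral_mono => x Dx; rewrite /f'; case: ifPn; first by rewrite leNye.
  rewrite notin_setE => nN; apply: contrapT => h; apply: nN; apply: fgN => /=.
  by move/(_ Dx).
apply: ae_eq_integral => //.
  apply: measurable_fun_if => //.
    apply: (measurable_fun_bool true).
    rewrite (_ : _ @^-1` _ = N); last first.
      by apply/seteqP; split => x /=; [exact: set_mem|exact: mem_set].
    exact: measurableI.
  by apply: measurable_funS mf => //; exact: subIsetl.
exists N; split => // x /= /not_implyP[Dx]; rewrite /f'; case: ifPn => //.
by move=> /set_mem.
Qed.

(** The main use of lower integrals: [F] is arbitrary, and in particular its integral
    is finite. *)
Lemma Rintegral_close D (F A rho : T -> R) : measurable D ->
  mu.-integrable D (EFin \o A) -> mu.-integrable D (EFin \o rho) ->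
  {ae mu, forall x, D x -> `|F x - A x| <= rho x} ->
  `|\int[mu]_(x in D) F x - \int[mu]_(x in D) A x| <= \int[mu]_(x in D) rho x.
Proof.
move=> mD iA irho H.
have iD := integrableD mD iA irho; have iB := integrableB mD iA irho.
have up : (\int[mu]_(x in D) (F x)%:E <= \int[mu]_(x in D) (A x)%:E + \int[mu]_(x in D) (rho x)%:E)%E.
  rewrite -integralD//; apply: le_integral_ub => //; first exact: (measurable_int mu).
  apply: filterS H => x Hx Dx; rewrite lee_fin -lerBlDl.
  exact: le_trans (ler_norm _) (Hx Dx).
have lo : (\int[mu]_(x in D) (A x)%:E - \int[mu]_(x in D) (rho x)%:E <= \int[mu]_(x in D) (F x)%:E)%E.
  rewrite -integralB//; apply: le_integral_lb => //; first exact: (measurable_int mu).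
  apply: filterS H => x Hx Dx; rewrite lee_fin.
  by have := Hx Dx; rewrite ler_norml => /andP[+ _]; lra.
have fA := integrable_fin_num mD iA; have fr := integrable_fin_num mD irho.
rewrite /= in fA fr.
rewrite /Rintegral; move: up lo; rewrite -(fineK fA) -(fineK fr).
case: (\int[mu]_(x in D) (F x)%:E)%E => [r| |] //=.
rewrite lee_fin => h1; rewrite lee_fin => h2.
by rewrite ler_norml; lra.
Qed.

Lemma Rintegral_bound D (F rho : T -> R) : measurable D ->
  mu.-integrable D (EFin \o rho) ->
  {ae mu, forall x, D x -> `|F x| <= rho x} ->
  `|\int[mu]_(x in D) F x| <= \int[mu]_(x in D) rho x.
Proof.
move=> mD irho H.
have := @Rintegral_close D F (fun=> 0) rho mD; rewrite Rintegral_cst// mul0r subr0.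
apply => //; first exact: integrable0.
by apply: filterS H => x Hx Dx; rewrite subr0; exact: Hx.
Qed.

End LowerIntegral.

Section Borel2.
Context {R : realType}.

(** An open subset of the plane is the union of the rational boxes it contains, hence
    lies in the product sigma-algebra. *)
Lemma continuous_measurable2 (f : R * R -> R) : continuous f ->
  measurable_fun (setT : set (measurableTypeR R * measurableTypeR R)%type) f.
Proof.
move=> cf; apply: (measurability _ (RGenOpens.measurableE R)).
move=> _ [_ [a [b ->] <-]]; rewrite setTI.
have oU : open (f @^-1` `]a, b[) by apply: open_comp => //; exact: interval_open.
set U := f @^-1` _ in oU *.
pose box (q : (rat * rat) * (rat * rat)) : set (R * R) :=
  `]ratr q.1.1, ratr q.1.2[%classic `*` `]ratr q.2.1, ratr q.2.2[%classic.
have -> : U = \bigcup_(q in [set q | box q `<=` U]) box q.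
  apply/seteqP; split => [x Ux|x [q /= qU /qU]//].
  have [[A B] [/= nA nB] AB] := oU _ Ux.
  have [e1 /= e10 E1] := nA; have [e2 /= e20 E2] := nB.
  have [p1 /andP[p11 p12]] : exists q : rat, x.1 - e1 < ratr q < x.1.
    by have [q] := @rat_in_itvoo R (x.1 - e1) x.1 (ltac:(lra)); rewrite in_itv /=; exists q.
  have [p2 /andP[p21 p22]] : exists q : rat, x.1 < ratr q < x.1 + e1.
    by have [q] := @rat_in_itvoo R x.1 (x.1 + e1) (ltac:(lra)); rewrite in_itv /=; exists q.
  have [p3 /andP[p31 p32]] : exists q : rat, x.2 - e2 < ratr q < x.2.
    by have [q] := @rat_in_itvoo R (x.2 - e2) x.2 (ltac:(lra)); rewrite in_itv /=; exists q.
  have [p4 /andP[p41 p42]] : exists q : rat, x.2 < ratr q < x.2 + e2.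
    by have [q] := @rat_in_itvoo R x.2 (x.2 + e2) (ltac:(lra)); rewrite in_itv /=; exists q.
  exists ((p1, p2), (p3, p4)).
    move=> y [/=]; rewrite !in_itv /= => /andP[y1 y2] /andP[y3 y4].
    apply: AB; split; [apply: E1|apply: E2] => /=; rewrite ltr_norml; lra.
  by split; rewrite /= in_itv /=; apply/andP.
rewrite bigcup_mkcond; apply: countable_bigcupT_measurable => [|q]; first exact: countableP.
by case: ifP => // _; apply: measurableX; exact: measurable_itv.
Qed.

End Borel2.

(** * Square integrable functions on omega *)

Section EcvgZero.
Context {R : realType} {T : Type} (F : set_system T) {FF : Filter F}.

Lemma ecvg0P (f : T -> \bar R) : (forall x, (0 <= f x)%E) ->
  f x @[x --> F] --> 0%E <-> forall e : R, 0 < e -> \forall x \near F, (f x <= e%:E)%E.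
Proof.
move=> f0; split=> [/fine_cvgP[ffin /cvgrPdist_le fc] e e0|H].
  near=> x; have fx : f x \is a fin_num by near: x.
  rewrite -(fineK fx) lee_fin.
  have : `|0 - fine (f x)| <= e by near: x; exact: fc.
  by rewrite sub0r normrN; apply: le_trans; exact: ler_norm.
apply/fine_cvgP; split.
  near=> x; have : (f x <= 1%:E)%E by near: x; exact: H.
  by move=> /le_lt_trans fx; rewrite ge0_fin_numE// fx// ltry.
apply/cvgrPdist_le => e e0; near=> x.
have fx : (f x <= e%:E)%E by near: x; exact: H.
have fxf : f x \is a fin_num by rewrite ge0_fin_numE//; apply: le_lt_trans fx _; rewrite ltry.
rewrite sub0r normrN ger0_norm; last by rewrite fine_ge0.
by rewrite -lee_fin fineK.
Unshelve. all: by end_near. Qed.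

End EcvgZero.

Section Omega.
Context {R : realType}.
Local Notation leb := (@lebesgue_measure R).
Local Notation leb2 := (leb \x leb)%E.
Local Notation RR := (measurableTypeR R * measurableTypeR R)%type.
Local Notation omega := (@omega R : set RR).
Implicit Types (f g b : R * R -> R).

Lemma measurable_omega : measurable omega.
Proof. by apply: measurableX; exact: measurable_itv. Qed.
Hint Resolve measurable_omega : core.

Lemma leb2_omega : leb2 omega = 2%:E.
Proof.
have E1 : leb (`](-1)%R, 1%R[%classic : set R) = 2%:E.
  by rewrite lebesgue_measure_itv /= lte_fin ifT ?EFinN ?oppeK -?EFinD//; lra.
have E2 : leb (`[0%R, 1%R[%classic : set R) = 1%:E.
  by rewrite lebesgue_measure_itv /= lte_fin ltr01 oppr0 adde0.
transitivity (leb (`](-1)%R, 1%R[%classic : set R) * leb (`[0%R, 1%R[%classic : set R))%E; last by rewrite E1 E2 mule1.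
by apply: product_measure1E; exact: measurable_itv.
Qed.

Definition iom f := leb2.-integrable omega (EFin \o f).

Definition sq f : \bar R := (\int[leb2]_(x in omega) (f x ^+ 2)%:E)%E.

Lemma sq_ge0 f : (0 <= sq f)%E.
Proof. by apply: integral_ge0 => x _; rewrite lee_fin sqr_ge0. Qed.

Lemma L2normE f : L2norm f = (sq f `^ 2^-1)%E.
Proof.
rewrite /L2norm unlock /sq [in RHS]integral_mkcond; congr (_ `^ _)%E.
apply: eq_integral => x _ /=; rewrite /patch; case: ifPn => _.
  by rewrite powR_mulrn// real_normK// num_real.
by rewrite normr0 powR0.
Qed.

Lemma L2norm_sqr f : (L2norm f ^+ 2 = sq f)%E.
Proof.
rewrite L2normE; have := sq_ge0 f; case: (sq f) => [r||//] r0.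
  rewrite poweR_EFin -EFin_expe powR12_sqrt// sqr_sqrtr//.
by rewrite poweRyr// expe2 mulyy.
Qed.

Lemma L2P f : L2 f <-> measurable_fun omega f /\ (sq f < +oo)%E.
Proof.
rewrite measurable_restrictT; last exact: measurable_omega.
have E : (L2norm f < +oo <-> sq f < +oo)%E.
  by rewrite L2normE; split; [exact: lty_poweRy|exact: poweR_lty].
split=> [/andP[/set_mem mf /set_mem]|[mf sf]]; first by move/E.
by apply/andP; split; apply/mem_set => //; exact/E.
Qed.

(** Turns a convergence of extended-real norms into estimates of square integrals,
    the only form used in the sequel. *)
Lemma L2norm_cvg0P (T : Type) (F : set_system T) {FF : Filter F} (u : T -> R * R -> R) :
  L2norm (u x) @[x --> F] --> 0%E <->
  forall e : R, 0 < e -> \forall x \near F, (sq (u x) <= e%:E)%E.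
Proof.
rewrite ecvg0P; last by move=> x; rewrite L2normE poweR_ge0.
split => H e e0.
  near=> x; have : (L2norm (u x) <= (Num.sqrt e)%:E)%E.
    by near: x; apply: H; rewrite sqrtr_gt0.
  have L0 : (0 <= L2norm (u x))%E by rewrite L2normE poweR_ge0.
  move=> h; rewrite -L2norm_sqr expe2 -[e]sqr_sqrtr ?(ltW e0)// expr2 EFinM.
  exact: lee_pmul.
near=> x; have : (sq (u x) <= (e ^+ 2)%:E)%E by near: x; apply: H; rewrite exprn_gt0.
rewrite L2normE => h.
apply: (@le_trans _ _ ((e ^+ 2)%:E `^ 2^-1)%E).
  apply: gt0_ler_poweR => //; rewrite in_itv /= ?leey ?andbT ?sq_ge0// lee_fin sqr_ge0//.
by rewrite poweR_EFin powR12_sqrt ?sqr_ge0// sqrtr_sqr lee_fin gtr0_norm.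
Unshelve. all: by end_near. Qed.

Lemma L2_measurable f : L2 f -> measurable_fun omega f.
Proof. by move/L2P => []. Qed.

Lemma iom_sqr f : L2 f -> iom (fun x => f x ^+ 2).
Proof.
move=> /L2P[mf sf]; apply/integrableP; split.
  by apply/measurable_EFinP; exact: measurable_funX.
apply: le_lt_trans sf; apply: integral_mono => x _ /=.
by rewrite ger0_norm ?sqr_ge0.
Qed.

Lemma iom_dom f g : measurable_fun omega f -> iom g ->
  (forall x, omega x -> `|f x| <= g x) -> iom f.
Proof.
move=> mf ig fg; apply: le_integrable ig => //.
  exact/measurable_EFinP.
by move=> x /fg /= fgx; rewrite lee_fin; apply: le_trans fgx _; exact: ler_norm.
Qed.

Lemma iomD f g : iom f -> iom g -> iom (fun x => f x + g x).
Proof. by move=> iF iG; have := integrableD measurable_omega iF iG; apply: eq_integrable => // x _. Qed.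

Lemma iomB f g : iom f -> iom g -> iom (fun x => f x - g x).
Proof. by move=> iF iG; have := integrableB measurable_omega iF iG; apply: eq_integrable => // x _. Qed.

Lemma iomZ (k : R) f : iom f -> iom (fun x => k * f x).
Proof. by move=> iF; have := integrableZl measurable_omega k iF; apply: eq_integrable => // x _. Qed.

Lemma iom_cst (k : R) : iom (fun=> k).
Proof.
apply/integrableP; split; first exact: measurable_cst.
by rewrite integral_cst//= leb2_omega -EFinM ltry.
Qed.

Lemma L2_M f g : L2 f -> L2 g -> iom (fun x => f x * g x).
Proof.
move=> L2f L2g; apply: (@iom_dom _ (fun x => f x ^+ 2 + g x ^+ 2)).
- by apply: measurable_funM; exact: L2_measurable.
- by apply: iomD; exact: iom_sqr.
- move=> x _; rewrite ler_norml; have := sqr_ge0 (f x + g x); have := sqr_ge0 (f x - g x).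
  by rewrite !sqrrD sqrrN mulrN; nra.
Qed.

Lemma L2_of_iom f : measurable_fun omega f -> iom (fun x => f x ^+ 2) -> L2 f.
Proof.
move=> mf /integrableP[_ H]; apply/L2P; split=> //.
by apply: le_lt_trans H; apply: integral_mono => x _; rewrite lee_fin ler_norm.
Qed.

Lemma L2_D f g : L2 f -> L2 g -> L2 (fun x => f x + g x).
Proof.
move=> L2f L2g; apply: L2_of_iom.
  by apply: measurable_funD; exact: L2_measurable.
rewrite (_ : (fun x => _) = fun x => f x ^+ 2 + (2 * (f x * g x) + g x ^+ 2)).
  by apply: iomD; [exact: iom_sqr|apply: iomD; [exact/iomZ/L2_M|exact: iom_sqr]].
by apply/funext => x; ring.
Qed.

Lemma L2_bM b f (K : R) : measurable_fun omega b -> (forall x, omega x -> `|b x| <= K) ->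
  L2 f -> L2 (fun x => b x * f x).
Proof.
move=> mb bK L2f; have mbf := measurable_funM mb (L2_measurable L2f).
apply: L2_of_iom => //; apply: (@iom_dom _ (fun x => K ^+ 2 * f x ^+ 2)).
- exact: measurable_funX.
- exact/iomZ/iom_sqr.
- move=> x /bK bx; rewrite ger0_norm ?sqr_ge0// exprMn ler_wpM2r ?sqr_ge0//.
  by rewrite -real_normK ?num_real// lerXn2r ?nnegrE// (le_trans _ bx).
Qed.

Lemma L2_bounded b (K : R) : measurable_fun omega b -> (forall x, omega x -> `|b x| <= K) ->
  L2 b.
Proof.
move=> mb bK; apply: L2_of_iom => //; apply: (@iom_dom _ (fun=> K ^+ 2)).
- exact: measurable_funX.
- exact: iom_cst.
- move=> x /bK bx; rewrite ger0_norm ?sqr_ge0//.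
  by rewrite -real_normK ?num_real// lerXn2r ?nnegrE// (le_trans _ bx).
Qed.

Lemma L2_cst (k : R) : L2 (fun=> k).
Proof. by apply: (@L2_bounded _ `|k|) => //; exact: measurable_cst. Qed.

Lemma L2_Z (k : R) f : L2 f -> L2 (fun x => k * f x).
Proof. by apply: (@L2_bM (fun=> k) f `|k|) => //; exact: measurable_cst. Qed.

Lemma L2_B f g : L2 f -> L2 g -> L2 (fun x => f x - g x).
Proof.
move=> L2f L2g; rewrite (_ : (fun x => _) = fun x => f x + (-1) * g x).
  by apply: L2_D => //; exact: L2_Z.
by apply/funext => x; rewrite mulN1r.
Qed.

Lemma L2_sum n (f : 'I_n -> R * R -> R) : (forall i, L2 (f i)) ->
  L2 (fun x => \sum_i f i x).
Proof.
elim: n f => [|n IH] f Hf.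
  rewrite (_ : (fun x => _) = fun=> 0); first exact: L2_cst.
  by apply/funext => x; rewrite big_ord0.
rewrite (_ : (fun x => _) = fun x => \sum_i f (widen_ord (leqnSn n) i) x + f ord_max x).
  by apply: L2_D => //; exact: IH.
by apply/funext => x; rewrite big_ord_recr.
Qed.

Lemma sqE f : L2 f -> sq f = (inner f f)%:E.
Proof.
move=> /iom_sqr Hf; rewrite /inner /Rintegral fineK; last exact: integrable_fin_num Hf.
by [].
Qed.

Lemma inner_ge0 f : 0 <= inner f f.
Proof. by apply: Rintegral_ge0 => x _; rewrite -expr2 sqr_ge0. Qed.

Lemma innerC f g : inner f g = inner g f.
Proof. by apply: eq_Rintegral => x _; rewrite mulrC. Qed.

Lemma innerDl f g h : L2 f -> L2 g -> L2 h ->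
  inner (fun x => f x + g x) h = inner f h + inner g h.
Proof.
move=> Lf Lg Lh; rewrite /inner -RintegralD//; try exact: L2_M.
by apply: eq_Rintegral => x _; rewrite mulrDl.
Qed.

Lemma innerZl (k : R) f h : L2 f -> L2 h ->
  inner (fun x => k * f x) h = k * inner f h.
Proof.
move=> Lf Lh; rewrite /inner -RintegralZl//; last exact: L2_M.
by apply: eq_Rintegral => x _; rewrite mulrA.
Qed.

Lemma innerBl f g h : L2 f -> L2 g -> L2 h ->
  inner (fun x => f x - g x) h = inner f h - inner g h.
Proof.
move=> Lf Lg Lh; rewrite /inner -RintegralB//; try exact: L2_M.
by apply: eq_Rintegral => x _; rewrite mulrBl.
Qed.

Lemma inner_suml n (f : 'I_n -> R * R -> R) h : (forall i, L2 (f i)) -> L2 h ->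
  inner (fun x => \sum_i f i x) h = \sum_i inner (f i) h.
Proof.
move=> + Lh; elim: n f => [|n IH] f Hf.
  rewrite big_ord0 /inner; under eq_Rintegral do rewrite big_ord0 mul0r.
  by rewrite Rintegral_cst// mul0r.
rewrite big_ord_recr /= -IH// -innerDl//; last exact: L2_sum.
by apply: eq_Rintegral => x _; rewrite big_ord_recr.
Qed.

Lemma inner_amgm f g : L2 f -> L2 g -> 2 * `|inner f g| <= inner f f + inner g g.
Proof.
move=> Lf Lg.
have H (s : R) : s ^+ 2 = 1 -> 2 * s * inner f g <= inner f f + inner g g.
  move=> s2; have Lsg := L2_Z s Lg; have := inner_ge0 (fun x => f x - s * g x).
  rewrite innerBl//; last exact: L2_B.
  rewrite (innerC f) innerBl// (innerC _ (fun x => f x - _)) innerBl//.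
  rewrite (innerC f (fun x => s * g x)) !innerZl// (innerC g (fun x => s * g x)) innerZl//.
  by rewrite (innerC g f) mulrA -expr2 s2; lra.
have h1 := H 1 (expr1n _ 2); have h2 := H (-1) (ltac:(by rewrite sqrrN expr1n)).
by have [h|h] := ler0P (inner f g); lra.
Qed.

(** The discriminant argument; when [g] is null the affine function of [s] obtained
    can only be nonnegative if its slope vanishes. *)
Lemma inner_CS f g : L2 f -> L2 g -> inner f g ^+ 2 <= inner f f * inner g g.
Proof.
move=> Lf Lg.
have H (s : R) : 0 <= inner f f - 2 * s * inner f g + s ^+ 2 * inner g g.
  have Lsg := L2_Z s Lg; have := inner_ge0 (fun x => f x - s * g x).
  rewrite innerBl//; last exact: L2_B.
  rewrite (innerC f) innerBl// (innerC _ (fun x => f x - _)) innerBl//.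
  rewrite (innerC f (fun x => s * g x)) !innerZl// (innerC g (fun x => s * g x)) innerZl//.
  by rewrite (innerC g f); lra.
have [g0|gn0] := eqVneq (inner g g) 0.
  rewrite g0 mulr0; have [->|fg0] := eqVneq (inner f g) 0; first by rewrite expr0n.
  have := H ((inner f f + 1) / (2 * inner f g)); rewrite g0 mulr0 addr0.
  rewrite (_ : 2 * _ * _ = inner f f + 1); first lra.
  by field.
have gp : 0 < inner g g by rewrite lt_neqAle eq_sym gn0 inner_ge0.
have := H (inner f g / inner g g).
rewrite (_ : _ + _ = (inner f f * inner g g - inner f g ^+ 2) / inner g g); last by field.
by rewrite pmulr_lge0 ?invr_gt0// subr_ge0.
Qed.

Lemma inner_cvg0 (u : nat -> R * R -> R) f g : (forall n, L2 (u n)) -> L2 f -> L2 g ->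
  L2cvg u f -> inner (u n) g @[n --> \oo] --> inner f g.
Proof.
move=> Lu Lf Lg /L2norm_cvg0P H; apply/cvgrPdist_le => e e0.
set G := inner g g + 1; have G0 : 0 < G by rewrite /G ltr_wpDl// inner_ge0.
near=> n; have : (sq (u n \- f)%R <= (e ^+ 2 / G)%:E)%E.
  by near: n; apply: H; rewrite divr_gt0// exprn_gt0.
have Ld : L2 (u n \- f) by exact: L2_B.
rewrite sqE// lee_fin => h.
rewrite distrC -innerBl// -(ler_pXn2r (_ : (0 < 2)%N)) ?nnegrE ?(ltW e0)//.
rewrite real_normK ?num_real//; apply: le_trans (inner_CS _ _) _ => //.
have h1 : inner g g <= G by rewrite /G lerDl.
apply: (@le_trans _ _ (e ^+ 2 / G * G)).
  by apply: ler_pM => //; exact: inner_ge0.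
by rewrite divfK// gt_eqF.
Unshelve. all: by end_near. Qed.

Lemma continuous_measurable_omega f : continuous f -> measurable_fun omega f.
Proof. by move=> cf; apply: measurable_funTS; exact: continuous_measurable2. Qed.

Lemma continuous_bounded_omega f : continuous f ->
  exists K : R, forall x, omega x -> `|f x| <= K.
Proof.
move=> cf.
have cpt : compact (`[-1, 1]%classic `*` `[0, 1]%classic : set (R * R)).
  by apply: compact_setX; exact: segment_compact.
have := continuous_compact (continuous_subspaceT cf) cpt.
move=> /compact_bounded[M [_ HM]]; exists (M + 1) => x [x1 x2].
apply: (HM (M + 1)); first by rewrite ltrDl ltr01.
exists x => //; move: x1 x2; rewrite /= !in_itv /= => /andP[a1 a2] /andP[b1 b2].
by split => /=; rewrite ?in_itv /=; apply/andP; split => //; exact: ltW.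
Qed.

Lemma continuous_L2 f : continuous f -> L2 f.
Proof.
move=> cf; have [K fK] := continuous_bounded_omega cf.
by apply: L2_bounded fK; exact: continuous_measurable_omega.
Qed.

End Omega.

(** * The inverse Laplacian and its square root *)

Section Spectral.
Context {R : realType}.
Implicit Types (f g u : R * R -> R).

Lemma sum_ord2 (V : nmodType) (F : 'I_2 -> V) : \sum_j F j = F 0 + F 1.
Proof. by rewrite big_ord_recl big_ord1; congr (F _ + F _); apply/val_inj. Qed.

Lemma sum_ord3 (V : nmodType) (F : 'I_3 -> V) : \sum_j F j = F 0 + F 1 + F 2.
Proof.
rewrite !big_ord_recl big_ord0 addr0 addrA.
by congr (F _ + F _ + F _); apply/val_inj.
Qed.

Lemma wderiv_L2 j f : L2 (wderiv j f).
Proof.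
by rewrite /wderiv; case: xgetP => [g _ []//|_]; exact: L2_cst.
Qed.

Lemma wderivP j f : H1 f -> is_wderiv j f (wderiv j f).
Proof. by move=> [_ /(_ j)[g gP]]; rewrite /wderiv; case: xgetP => [//|/(_ g)]. Qed.

Lemma test_smooth (phi : R * R -> R^o) : test phi -> smooth phi.
Proof. by move=> [[]]. Qed.

Lemma smooth_L2 (phi : R * R -> R^o) : smooth phi -> L2 phi.
Proof. by move=> sp; apply: continuous_L2; exact: smooth_continuous. Qed.

Lemma smooth_partial_L2 j (phi : R * R -> R^o) : smooth phi -> L2 (partial j phi).
Proof.
by move=> sp; apply: continuous_L2; apply: smooth_continuous; exact: smooth_derive.
Qed.

Lemma x1_smooth : smooth (id : R^o -> R^o).
Proof.
move=> k; elim: k => [|k IH]; split => //; try by move=> x; exact: cvg_id.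
move=> v; split; first by move=> x; exact: derivable_id.
rewrite (_ : (fun x => _) = fun=> v); first exact: Ck_cst.
by apply/funext => x; rewrite derive_id.
Qed.

Lemma fst_bound (x : R * R) : omega x -> `|x.1| <= 1.
Proof. by move=> [/=]; rewrite in_itv /= => /andP[? ?] _; rewrite ler_norml; lra. Qed.

Lemma fst_measurable : measurable_fun (omega : set (measurableTypeR R * measurableTypeR R)%type) (fun x : R * R => x.1).
Proof. by apply: continuous_measurable_omega => x; exact: cvg_fst. Qed.

Lemma L2_x1 u : L2 u -> L2 (fun x => x.1 * u x).
Proof. by apply: L2_bM; [exact: fst_measurable|exact: fst_bound]. Qed.

Lemma L2cvg_bM (b : R * R -> R) (K : R) (u : nat -> R * R -> R) f :
  measurable_fun (omega : set (measurableTypeR R * measurableTypeR R)%type) b ->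
  (forall x, omega x -> `|b x| <= K) ->
  (forall n, L2 (u n)) -> L2 f -> L2cvg u f ->
  L2cvg (fun n x => b x * u n x) (fun x => b x * f x).
Proof.
move=> mb bK Lu Lf /L2norm_cvg0P H; apply/L2norm_cvg0P => e e0.
have K0 : 0 < K ^+ 2 + 1 by rewrite ltr_wpDl// sqr_ge0.
near=> n; have : (sq (u n \- f)%R <= (e / (K ^+ 2 + 1))%:E)%E.
  by near: n; apply: H; rewrite divr_gt0.
have Ld : L2 (u n \- f) by exact: L2_B.
have LB : L2 (fun x => b x * (u n x - f x)) by exact: L2_bM bK Ld.
rewrite (_ : ((fun x => b x * u n x) \- _)%R = fun x => b x * (u n x - f x)); last first.
  by apply/funext => x /=; rewrite mulrBr.
rewrite !sqE// !lee_fin => h.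
apply: (@le_trans _ _ (K ^+ 2 * inner (u n \- f) (u n \- f))).
  rewrite /inner -RintegralZl//; [|exact: measurable_omega|exact: L2_M].
  apply: le_Rintegral; [exact: measurable_omega|exact: L2_M|exact/iomZ/L2_M|].
  move=> x /bK bx; rewrite mulrACA -!expr2 ler_wpM2r ?sqr_ge0//.
  by rewrite -real_normK ?num_real// lerXn2r ?nnegrE// (le_trans _ bx).
have h0 := inner_ge0 (u n \- f).
move: h; rewrite ler_pdivlMr//; nra.
Unshelve. all: by end_near. Qed.

(** As [\d_1 x.1 = 1], integration by parts gives
    [<u, u> = - 2 * <\d_1 u, x.1 * u>], and [|x.1| <= 1] on [omega]. *)
Lemma H10_poincare u : H10 u -> inner u u <= 4 * inner (wderiv 0 u) (wderiv 0 u).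
Proof.
move=> [Hu [phi [tphi [cu cdu]]]].
have [Lu _] := Hu; have Ld := wderiv_L2 0 u; have Lx := L2_x1 Lu.
have sphi n := test_smooth (tphi n).
have Lphi n := smooth_L2 (sphi n).
have Ldphi n := smooth_partial_L2 0 (sphi n).
have key : inner u u + inner (wderiv 0 u) (fun x => x.1 * u x) =
     - inner (wderiv 0 u) (fun x => x.1 * u x).
  (* The weak derivative of [u] tested with [x.1 * phi n], before the passage to the
     limit [phi n --> u]. *)
  have E n : inner (phi n) u + inner (fun x => x.1 * partial 0 (phi n) x) u =
     - inner (fun x => x.1 * phi n x) (wderiv 0 u).
    have [_ H] := wderivP 0 Hu.
    rewrite (innerC (fun x => x.1 * phi n x)) -(H _ (test_mul x1_smooth (tphi n))).
    rewrite -innerDl//; last exact: L2_x1.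
    rewrite innerC; apply: eq_Rintegral => x _; congr (_ * _).
    rewrite (@partial_mul R (id : R^o -> R^o))//; last exact: x1_smooth.
    by rewrite derive_id /=; ring.
  have c1 := inner_cvg0 Lphi Lu Lu cu.
  have c2 : inner (fun x => x.1 * partial 0 (phi n) x) u @[n --> \oo] -->
      inner (fun x => x.1 * wderiv 0 u x) u.
    apply: (@inner_cvg0 _ (fun n x => x.1 * partial 0 (phi n) x)) => //.
    - by move=> n; exact: L2_x1.
    - exact: L2_x1.
    - by apply: L2cvg_bM => //; [exact: fst_measurable|exact: fst_bound].
  have c3 : inner (fun x => x.1 * phi n x) (wderiv 0 u) @[n --> \oo] -->
      inner (fun x => x.1 * u x) (wderiv 0 u).
    apply: (@inner_cvg0 _ (fun n x => x.1 * phi n x)) => //.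
    - by move=> n; exact: L2_x1.
    - by apply: L2cvg_bM => //; [exact: fst_measurable|exact: fst_bound].
  rewrite (innerC (wderiv 0 u)).
  have c12 : inner (phi n) u + inner (fun x => x.1 * partial 0 (phi n) x) u
      @[n --> \oo] --> inner u u + inner (fun x => x.1 * u x) (wderiv 0 u).
    apply: cvgD => //; rewrite (_ : inner _ (wderiv 0 u) = inner (fun x => x.1 * wderiv 0 u x) u)//.
    by apply: eq_Rintegral => x _; ring.
  have c3' : inner (phi n) u + inner (fun x => x.1 * partial 0 (phi n) x) u
      @[n --> \oo] --> - inner (fun x => x.1 * u x) (wderiv 0 u).
    by under eq_cvg do rewrite E; exact: cvgN.
  exact: (cvg_unique _ c12 c3').
have xu : inner (fun x => x.1 * u x) (fun x => x.1 * u x) <= inner u u.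
  apply: le_Rintegral; [exact: measurable_omega|exact: L2_M|exact: L2_M|].
  move=> x /fst_bound bx; rewrite mulrACA -!expr2 ler_piMl ?sqr_ge0//.
  by rewrite -real_normK ?num_real// expr_le1.
have := inner_amgm (L2_Z 2 Ld) Lx.
have -> : inner (fun x => 2 * wderiv 0 u x) (fun x => 2 * wderiv 0 u x) =
    4 * inner (wderiv 0 u) (wderiv 0 u).
  by rewrite innerZl//; [rewrite innerC innerZl//; ring|exact: L2_Z].
rewrite innerZl//.
rewrite normrM (ger0_norm (_ : 0 <= 2))//.
have := ler_norm (- inner (wderiv 0 u) (fun x => x.1 * u x)); rewrite normrN.
lra.
Qed.

(** The weak formulation tested with the solution itself, reached as the limit of
    its approximating test functions. *)
Lemma inv_lap_energy f u : L2 f -> is_inv_lap f u ->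
  \sum_j inner (wderiv j u) (wderiv j u) = inner f u.
Proof.
move=> Lf [[Hu [phi [tphi [cu cdu]]]] E].
have [Lu _] := Hu.
have Lphi n := smooth_L2 (test_smooth (tphi n)).
have c1 := inner_cvg0 Lphi Lu Lf cu.
have c2 : (fun n => \sum_j inner (partial j (phi n)) (wderiv j u)) @ \oo --> \sum_j inner (wderiv j u) (wderiv j u).
  have cj j : (fun n => inner (partial j (phi n)) (wderiv j u)) @ \oo -->
      inner (wderiv j u) (wderiv j u).
    apply: inner_cvg0; try exact: wderiv_L2.
      by move=> n; exact: smooth_partial_L2 (test_smooth (tphi n)).
    exact: cdu.
  rewrite sum_ord2.
  under eq_cvg do rewrite sum_ord2.
  by apply: cvgD; exact: cj.
have Efun : (fun n => \sum_j inner (partial j (phi n)) (wderiv j u)) =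
    (fun n => inner (phi n) f).
  apply/funext => n; rewrite innerC -(E _ (tphi n)).
  by apply: eq_bigr => j _; rewrite innerC.
rewrite Efun in c2; rewrite (innerC f).
exact: (cvg_unique _ c2 c1).
Qed.

Lemma eigenvalue_arith (a b c : R) : a ^+ 2 <= 4 * b -> b + c = a ->
  0 <= b -> 0 <= c -> 0 <= a <= 4.
Proof.
move=> P E b0 c0; have h3 : 0 <= a by lra.
have h4 : a ^+ 2 <= 4 * a by lra.
by rewrite h3 /=; have [//|?] := leP a 4; nra.
Qed.

Section Eigen.
Variables (e : nat -> R * R -> R) (mu : nat -> R).
Hypothesis emu : eigenbasis e mu.

Let Le k : L2 (e k). Proof. by case: emu. Qed.
Let orth k l : inner (e k) (e l) = (k == l)%:R. Proof. by case: emu. Qed.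

(** Let [u = mu_k e_k], the image of [e_k]. Then [<e_k, u> = mu_k] is the Dirichlet
    energy of [u], which is nonnegative, while [mu_k ^ 2 = <u, u>] is at most 4 times
    this energy by [H10_poincare]. *)
Lemma eigenvalue_itv k : 0 <= mu k <= 4.
Proof.
have [_ _ _ /(_ k) H] := emu.
have E := inv_lap_energy (Le k) H.
have P := H10_poincare H.1.
move: P E; set u := (fun x => _); rewrite sum_ord2 => P.
have -> : inner (e k) u = mu k.
  by rewrite innerC innerZl// orth eqxx mulr1.
have uu : inner u u = mu k ^+ 2.
  by rewrite innerZl//; [rewrite innerC innerZl// orth eqxx mulr1 expr2|exact: L2_Z].
have h1 := inner_ge0 (wderiv 0 u).
have h2 := inner_ge0 (wderiv 1 u).
rewrite uu in P; move=> E.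
exact: (eigenvalue_arith P E h1 h2).
Qed.

Lemma inner_comb n (a : nat -> R) h : L2 h ->
  inner (fun x => \sum_(k < n) a k * e k x) h = \sum_(k < n) a k * inner (e k) h.
Proof.
move=> Lh; rewrite inner_suml//; last by move=> i; exact: L2_Z.
by apply: eq_bigr => i _; rewrite innerZl.
Qed.

Lemma L2_comb n (a : nat -> R) : L2 (fun x => \sum_(k < n) a k * e k x).
Proof. by apply: L2_sum => i; exact: L2_Z. Qed.

Lemma inner_comb2 n (a : nat -> R) :
  inner (fun x => \sum_(k < n) a k * e k x) (fun x => \sum_(k < n) a k * e k x)
  = \sum_(k < n) a k ^+ 2.
Proof.
rewrite inner_comb; last exact: L2_comb.
apply: eq_bigr => i _; rewrite innerC inner_comb// (bigD1 i)//= orth eqxx mulr1.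
rewrite big1 ?addr0 ?expr2// => j ji; rewrite orth.
by rewrite (_ : (j == i :> nat) = false) ?mulr0//; apply/negbTE.
Qed.

Lemma bessel n f : L2 f -> \sum_(k < n) inner f (e k) ^+ 2 <= inner f f.
Proof.
move=> Lf; pose S := fun x => \sum_(k < n) inner f (e k) * e k x.
have LS : L2 S by exact: (L2_comb n (fun k => inner f (e k))).
have := inner_ge0 (fun x => f x - S x).
rewrite innerBl//; last exact: L2_B.
rewrite (innerC f) innerBl// (innerC S (fun x => f x - S x)) innerBl// (innerC f S).
have -> : inner S f = \sum_(k < n) inner f (e k) ^+ 2.
  rewrite (inner_comb n (fun k => inner f (e k)))//.
  by apply: eq_bigr => i _; rewrite (innerC (e i)) expr2.
rewrite (inner_comb2 n (fun k => inner f (e k))); lra.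
Qed.

End Eigen.

(** The partial sums have square norm at most [4 * <f, f>] by the bound on the
    eigenvalues and Bessel's inequality; pair them with the limit [g]. *)
Lemma inv_lap_half_bound f g : L2 f -> is_inv_lap_pow 2^-1 f g ->
  inner g g <= 4 * inner f f.
Proof.
move=> Lf [Lg [e [mu [emu cg]]]].
have Le k : L2 (e k) by case: emu.
pose a k := mu k `^ 2^-1 * inner f (e k).
have c := inner_cvg0 (fun n => L2_comb emu n a) Lg Lg cg.
have H : inner g g <= 2^-1 * (4 * inner f f + inner g g).
  apply: (cvgr_to_le c); near=> n.
  have LS := L2_comb emu n a.
  have := inner_amgm LS Lg; rewrite (inner_comb2 emu).
  have : \sum_(k < n) a k ^+ 2 <= 4 * inner f f.
    apply: le_trans (_ : 4 * \sum_(k < n) inner f (e k) ^+ 2 <= _); last first.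
      by apply: ler_wpM2l; [|exact: (bessel emu n Lf)].
    rewrite mulr_sumr; apply: ler_sum => k _.
    have /andP[m0 m4] := eigenvalue_itv emu k.
    by rewrite /a exprMn powR12_sqrt// sqr_sqrtr// ler_wpM2r// sqr_ge0.
  have := ler_norm (inner (fun x => \sum_(k < n) a k * e k x) g).
  lra.
lra.
Unshelve. all: by end_near. Qed.

(** The default value 0, taken when no value of the operator exists, satisfies the
    same bound. *)
Lemma inv_lap_half_L2 f : L2 f -> L2 (inv_lap_pow 2^-1 f) /\
  inner (inv_lap_pow 2^-1 f) (inv_lap_pow 2^-1 f) <= 4 * inner f f.
Proof.
move=> Lf; rewrite /inv_lap_pow; case: xgetP => [g _ gP|_].
  by split; [case: gP|exact: inv_lap_half_bound].
split; first exact: L2_cst.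
rewrite /inner Rintegral_cst; last exact: measurable_omega.
by rewrite !mul0r mulr_ge0// inner_ge0.
Qed.

End Spectral.

(** * Estimates at a fixed time *)

Section Slice.
Context {R : realType}.
Local Notation leb := (@lebesgue_measure R).
Local Notation leb2 := (leb \x leb)%E.
Local Notation RR := (measurableTypeR R * measurableTypeR R)%type.
Local Notation omega := (@omega R : set RR).

Lemma dot_delta (u : 'rV[R]_3) (k : R) i : dot u (k *: delta_mx 0 i) = k * u 0 i.
Proof.
rewrite /dot (bigD1 i)//= !mxE !eqxx mulr1 mulrC big1 ?addr0// => j ji.
by rewrite !mxE eqxx (negbTE ji) mulr0n !mulr0.
Qed.

Lemma dot_ge0 n (u : 'rV[R]_n) : 0 <= dot u u.
Proof. by apply: sumr_ge0 => i _; rewrite -expr2 sqr_ge0. Qed.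

Lemma dot_comp n (u : 'rV[R]_n) i : u 0 i ^+ 2 <= dot u u.
Proof.
rewrite /dot (bigD1 i)//= -expr2 lerDl.
by apply: sumr_ge0 => j _; rewrite -expr2 sqr_ge0.
Qed.

Lemma unit_comp n (u : 'rV[R]_n) i : dot u u = 1 -> `|u 0 i| <= 1.
Proof.
by move=> u1; rewrite -(@expr_le1 _ 2)// real_normK ?num_real// -u1 dot_comp.
Qed.

Lemma crossE (u w : 'rV[R]_3) i :
  cross u w 0 i = u 0 (i + 1) * w 0 (i + 2) - u 0 (i + 2) * w 0 (i + 1).
Proof. by rewrite mxE. Qed.

Lemma cross_le (u w : 'rV[R]_3) (M : R) i : dot u u = 1 -> (forall b, `|w 0 b| <= M) ->
  `|cross u w 0 i| <= 2 * M.
Proof.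
move=> u1 wM; rewrite crossE (le_trans (ler_normB _ _))// !normrM mulr2n mulrDl mul1r.
by apply: lerD; rewrite -[leRHS]mul1r ler_pM// unit_comp.
Qed.

Lemma Rint_omega_cst (k : R) : \int[leb2]_(x in omega) k = k * 2.
Proof.
rewrite Rintegral_cst; last exact: measurable_omega.
by rewrite /= leb2_omega.
Qed.

Local Notation divp := Defs.divp.

Local Opaque wderiv inv_lap_pow.

Variables (delta eps E : R) (mm : R * R -> 'rV[R]_3).
Hypotheses (delta0 : 0 < delta) (eps0 : 0 < eps).
Hypothesis mH1 : forall i, H1 (mcomp mm i).
Hypothesis mapprox : forall i, exists phi : nat -> R * R -> R^o,
  (forall n, smooth_closure (phi n)) /\ H1cvg phi (mcomp mm i).
Hypothesis msph : {ae leb2, forall x, omega x -> dot (mm x) (mm x) = 1}.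
Hypothesis mE : (energy delta eps mm <= E%:E)%E.

Variable dm : 'I_2 -> 'I_3 -> R * R -> R.
Hypothesis dmE : forall j i, wderiv j (mcomp mm i) = dm j i.

Definition dirichlet (x : R * R) : R := \sum_j \sum_i dm j i x ^+ 2.
Local Notation Dir := dirichlet.

Lemma dotE j x : dot (wderivv j mm x) (wderivv j mm x) = \sum_i dm j i x ^+ 2.
Proof. by apply: eq_bigr => i _; rewrite !mxE dmE expr2. Qed.

Lemma comp_L2 i : L2 (mcomp mm i). Proof. by case: (mH1 i). Qed.

Lemma dm_L2 j i : L2 (dm j i). Proof. by rewrite -dmE; exact: wderiv_L2. Qed.

Lemma dirichlet_iom : iom Dir.
Proof.
rewrite (_ : Dir = fun x => (dm 0 0 x ^+ 2 + dm 0 1 x ^+ 2 + dm 0 2 x ^+ 2) +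
  (dm 1 0 x ^+ 2 + dm 1 1 x ^+ 2 + dm 1 2 x ^+ 2)); last first.
  by apply/funext => x; rewrite /Dir sum_ord2 !sum_ord3.
have i j a : iom (fun x => dm j a x ^+ 2) by apply: iom_sqr; exact: dm_L2.
exact: (iomD (iomD (iomD (i 0 0) (i 0 1)) (i 0 2)) (iomD (iomD (i 1 0) (i 1 1)) (i 1 2))).
Qed.

Lemma dirichlet_ge0 x : 0 <= Dir x.
Proof. by apply: sumr_ge0 => j _; apply: sumr_ge0 => i _; exact: sqr_ge0. Qed.

Lemma dm_sqr_le j i x : dm j i x ^+ 2 <= Dir x.
Proof.
have h k : 0 <= \sum_i dm k i x ^+ 2 by apply: sumr_ge0 => l _; exact: sqr_ge0.
rewrite /Dir (bigD1 j)//= (bigD1 i)//= -addrA lerDl addr_ge0//.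
  by apply: sumr_ge0 => l _; exact: sqr_ge0.
by apply: sumr_ge0 => l _; exact: h.
Qed.

Lemma dm_le j i x : `|dm j i x| <= 1 + Dir x.
Proof.
have := dm_sqr_le j i x; have := dirichlet_ge0 x.
have := sqr_ge0 (`|dm j i x| - 1); rewrite -[dm j i x ^+ 2]real_normK ?num_real//.
nra.
Qed.

(** The nonlocal part of the energy is nonnegative and can be dropped. *)
Lemma energy_split : \int[leb2]_(x in omega) Dir x <= E /\
  inner (mcomp mm 2) (mcomp mm 2) <= eps ^+ 2 * E.
Proof.
have i3 : iom (fun x => (eps ^+ 2)^-1 * mcomp mm 2 x ^+ 2) by exact/iomZ/iom_sqr/comp_L2.
have itot := iomD dirichlet_iom i3.
have H : (\int[leb2]_(x in omega) (Dir x + (eps ^+ 2)^-1 * mcomp mm 2 x ^+ 2)%:E <= E%:E)%E.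
  apply: le_trans mE; rewrite /energy.
  rewrite (_ : (\int[leb2]_(x in omega) _ = \int[leb2]_(x in omega) (\sum_j dot (wderivv j mm x) (wderivv j mm x) +
      (eps ^+ 2)^-1 * mm x 0 2 ^+ 2)%:E)%E); last first.
    by apply: eq_integral => x _; congr (EFin (_ + _)); apply: eq_bigr => j _; rewrite dotE.
  rewrite leeDl// mule_ge0//.
    by rewrite lee_fin invr_ge0 mulr_ge0// ltW.
  by apply: integral_ge0 => x _; rewrite lee_fin sqr_ge0.
have {}H : \int[leb2]_(x in omega) (Dir x + (eps ^+ 2)^-1 * mcomp mm 2 x ^+ 2) <= E.
  by rewrite -lee_fin /Rintegral fineK// (integrable_fin_num measurable_omega itot).
rewrite RintegralD// in H; [|exact: measurable_omega|exact: dirichlet_iom].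
have h1 : 0 <= \int[leb2]_(x in omega) Dir x.
  by apply: Rintegral_ge0 => x _; exact: dirichlet_ge0.
rewrite RintegralZl// in H; [|exact: measurable_omega|exact/iom_sqr/comp_L2].
rewrite (_ : \int[leb2]_(x in omega) mcomp mm 2 x ^+ 2 = inner (mcomp mm 2) (mcomp mm 2)) in H; last first.
  by rewrite /inner; apply: eq_Rintegral => x _; rewrite expr2.
have h2 := inner_ge0 (mcomp mm 2).
have e2 : 0 < (eps ^+ 2)^-1 by rewrite invr_gt0 exprn_gt0.
have h3 : 0 <= (eps ^+ 2)^-1 * inner (mcomp mm 2) (mcomp mm 2) by rewrite mulr_ge0// ltW.
split; first by apply: le_trans H; rewrite lerDl.
rewrite -ler_pdivrMl ?exprn_gt0//; apply: le_trans H.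
by rewrite lerDr.
Qed.

Lemma energy_ge0 : 0 <= E.
Proof.
have [+ _] := energy_split; apply: le_trans.
by apply: Rintegral_ge0 => x _; exact: dirichlet_ge0.
Qed.

Lemma m_sqr_int a : inner (mcomp mm a) (mcomp mm a) <= 2.
Proof.
have : `|inner (mcomp mm a) (mcomp mm a)| <= \int[leb2]_(x in omega) 1.
  apply: Rintegral_bound; [exact: measurable_omega|exact: iom_cst|].
  apply: filterS msph => x Hx ox; rewrite -expr2 normrX exprn_ile1//.
  exact/unit_comp/Hx.
by rewrite Rint_omega_cst mul1r; apply: le_trans; exact: ler_norm.
Qed.

Lemma dm_sqr_int j i : inner (dm j i) (dm j i) <= E.
Proof.
have [+ _] := energy_split; apply: le_trans.
apply: le_Rintegral; [exact: measurable_omega|by apply: L2_M; exact: dm_L2|exact: dirichlet_iom|].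
by move=> x _; rewrite -expr2 dm_sqr_le.
Qed.

Lemma divp_L2 : L2 (divp mm).
Proof. exact: (L2_D (wderiv_L2 0 _) (wderiv_L2 1 _)). Qed.

Lemma divpE : divp mm = fun x => dm 0 0 x + dm 1 1 x.
Proof. by apply/funext => x; rewrite /divp !dmE. Qed.

Lemma divp_int : inner (divp mm) (divp mm) <= 2 * E.
Proof.
have [EE _] := energy_split.
apply: (@le_trans _ _ (\int[leb2]_(x in omega) (2 * Dir x))); last first.
  rewrite RintegralZl//; [|exact: measurable_omega|exact: dirichlet_iom].
  by apply: ler_wpM2l.
apply: le_Rintegral; [exact: measurable_omega|apply: L2_M; exact: divp_L2|exact/iomZ/dirichlet_iom|].
move=> x _; rewrite divpE.
apply: (@le_trans _ _ (2 * (dm 0 0 x ^+ 2 + dm 1 1 x ^+ 2))).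
  by have := sqr_ge0 (dm 0 0 x - dm 1 1 x); nra.
rewrite ler_wpM2l// /Dir sum_ord2 !sum_ord3.
have h j i := sqr_ge0 (dm j i x).
have := h 0 1; have := h 0 2; have := h 1 0; have := h 1 2; lra.
Qed.

Variables (chi : R^o -> R^o) (K : R).
Hypotheses (chic : cutoff chi) (chiK : forall y, `|chi y| <= K)
  (dchiK : forall y, `|'D_1 chi y| <= K).

Lemma cutoff_bound_ge0 : 0 <= K. Proof. exact: le_trans (chiK 0). Qed.

Lemma cutoff_measurable : measurable_fun omega (fun x : R * R => chi x.1 : R).
Proof.
apply: continuous_measurable_omega.
exact: (smooth_continuous (@smooth_fst R R^o chi chic.1)).
Qed.

Lemma dcutoff_measurable : measurable_fun omega (fun x : R * R => 'D_1 chi x.1 : R).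
Proof.
apply: continuous_measurable_omega.
exact: (smooth_continuous (@smooth_fst R R^o _ (smooth_derive (1 : R^o) chic.1))).
Qed.

Lemma nonlocal_arith (b c c' d m : R) : `|c| <= K -> `|c'| <= K -> b ^+ 2 <= 1 ->
  (c * d + b * (c' * m)) ^+ 2 <= 2 * K ^+ 2 * (d ^+ 2 + m ^+ 2).
Proof.
move=> cK c'K b1.
have c2 : c ^+ 2 <= K ^+ 2 by rewrite -real_normK ?num_real// lerXn2r ?nnegrE ?cutoff_bound_ge0.
have c2' : c' ^+ 2 <= K ^+ 2 by rewrite -real_normK ?num_real// lerXn2r ?nnegrE ?cutoff_bound_ge0.
have e1 : (b * (c' * m)) ^+ 2 <= K ^+ 2 * m ^+ 2.
  rewrite !exprMn; apply: (@le_trans _ _ (1 * (c' ^+ 2 * m ^+ 2))).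
    by rewrite ler_wpM2r// mulr_ge0// sqr_ge0.
  by rewrite mul1r ler_wpM2r// sqr_ge0.
have e2 : (c * d) ^+ 2 <= K ^+ 2 * d ^+ 2 by rewrite exprMn ler_wpM2r// sqr_ge0.
move: (c * d) (b * _) e1 e2 => p q e1 e2.
have := sqr_ge0 (p - q); rewrite !sqrrD sqrrN mulrN; lra.
Qed.

(** The gradient in [calP] is integrated by parts against [chi * m_a]. The weak
    derivative only accepts smooth test functions vanishing near the boundary, hence
    the smooth approximations of [m_a]; the two factors that remain are square
    integrable with norms controlled by the energy. When [g] has no weak derivative
    its representative is 0 and there is nothing to bound. *)
Lemma nonlocal_bound j a :
  `|inner (calP mm j) (fun x => chi x.1 * mcomp mm a x)| <=
  4 * E + K ^+ 2 * (E + 2).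
Proof.
have [Lg gb] := inv_lap_half_L2 divp_L2; set g := inv_lap_pow _ _ in Lg gb.
have Lchi u : L2 u -> L2 (fun x => chi x.1 * u x) by move=> Lu; apply: (L2_bM _ _ Lu); [exact: cutoff_measurable|move=> x _; exact: chiK].
have Ldchi u : L2 u -> L2 (fun x => 'D_1 chi x.1 * u x) by move=> Lu; apply: (L2_bM _ _ Lu); [exact: dcutoff_measurable|move=> x _; exact: dchiK].
have rhs0 : 0 <= 4 * E + K ^+ 2 * (E + 2).
  by have := energy_ge0; have := sqr_ge0 K; nra.
have calPE h : L2 h -> inner (calP mm j) h = - inner (wderiv j g) h.
  move=> Lh; rewrite -mulN1r -innerZl//; last exact: wderiv_L2.
  by rewrite /inner; apply: eq_Rintegral => x _; rewrite /calP mulN1r.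
have Lma := comp_L2 a.
rewrite calPE; last exact: Lchi.
rewrite normrN.
have [[p pP]|nex] := pselect (exists p, is_wderiv j g p); last first.
  rewrite (_ : inner _ _ = 0) ?normr0//.
  rewrite /inner (_ : wderiv j g = fun=> 0); last by apply: xgetPN => p pP; apply: nex; exists p.
  under eq_Rintegral do rewrite mul0r.
  by rewrite Rintegral_cst ?mul0r//; exact: measurable_omega.
have {p pP} pP : is_wderiv j g (wderiv j g) by apply: xgetI pP.
move: (wderiv j g) pP => p [Lp pP].
pose h := fun x => chi x.1 * dm j a x + (j == 0)%:R * ('D_1 chi x.1 * mcomp mm a x).
have Lw := dm_L2 j a.
have Lh : L2 h by apply: L2_D; [exact: Lchi|exact/L2_Z/Ldchi].
have [phi [sphi [cphi cdphi]]] := mapprox a.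
have Lphi n : L2 (phi n) by apply: smooth_L2; case: (sphi n).
have Ldphi n : L2 (partial j (phi n)) by apply: smooth_partial_L2; case: (sphi n).
(* The identity holds with [phi n] in place of [m_a], and both sides converge. *)
have key : inner p (fun x => chi x.1 * mcomp mm a x) = - inner g h.
  have c1 : inner (fun x => chi x.1 * phi n x) p @[n --> \oo] --> inner (fun x => chi x.1 * mcomp mm a x) p.
    apply: (@inner_cvg0 _ (fun n x => chi x.1 * phi n x)); [by move=> n; exact: Lchi|exact: Lchi|exact: Lp|].
    exact: (L2cvg_bM cutoff_measurable (fun x _ => chiK x.1) Lphi Lma cphi).
  have c2 : inner (fun x => chi x.1 * partial j (phi n) x) g @[n --> \oo] --> inner (fun x => chi x.1 * dm j a x) g.
    apply: (@inner_cvg0 _ (fun n x => chi x.1 * partial j (phi n) x)); [by move=> n; exact: Lchi|exact: Lchi|exact: Lg|].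
    by have := cdphi j; rewrite dmE; exact: (L2cvg_bM cutoff_measurable (fun x _ => chiK x.1) Ldphi Lw).
  have c3 : inner (fun x => 'D_1 chi x.1 * phi n x) g @[n --> \oo] --> inner (fun x => 'D_1 chi x.1 * mcomp mm a x) g.
    apply: (@inner_cvg0 _ (fun n x => 'D_1 chi x.1 * phi n x)); [by move=> n; exact: Ldchi|exact: Ldchi|exact: Lg|].
    exact: (L2cvg_bM dcutoff_measurable (fun x _ => dchiK x.1) Lphi Lma cphi).
  have c4 : inner (fun x => chi x.1 * phi n x) p @[n --> \oo] -->
     - (inner (fun x => chi x.1 * dm j a x) g + (j == 0)%:R * inner (fun x => 'D_1 chi x.1 * mcomp mm a x) g).
    rewrite (_ : (fun n => _) = fun n => - (inner (fun x => chi x.1 * partial j (phi n) x) g +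
       (j == 0)%:R * inner (fun x => 'D_1 chi x.1 * phi n x) g)).
      by apply: cvgN; apply: cvgD => //; apply: cvgM => //; exact: cvg_cst.
    apply/funext => n; have [sc _] := chic; have [sp _] := sphi n.
    rewrite innerC -[LHS]opprK -pP; last exact: test_cutoff.
    congr (- _); rewrite -innerZl//; last exact: Ldchi.
    rewrite -innerDl//; [|exact: Lchi|exact/L2_Z/Ldchi].
    rewrite innerC /inner; apply: eq_Rintegral => x _; congr (_ * _).
    by rewrite partial_mul// !mulrA.
  rewrite (innerC p) (innerC g) /h innerDl//; [|exact: Lchi|exact/L2_Z/Ldchi].
  rewrite innerZl//; last exact: Ldchi.
  exact: (cvg_unique _ c1 c4).
rewrite key normrN.
have hb : inner h h <= 2 * K ^+ 2 * (E + 2).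
  have i1 : iom (fun x => dm j a x ^+ 2) by exact: iom_sqr.
  have i2 : iom (fun x => mcomp mm a x ^+ 2) by exact: iom_sqr.
  apply: (@le_trans _ _ (\int[leb2]_(x in omega) (2 * K ^+ 2 * (dm j a x ^+ 2 + mcomp mm a x ^+ 2)))).
    apply: le_Rintegral; [exact: measurable_omega|exact: L2_M|exact/iomZ/iomD|].
    move=> x _; rewrite /h -expr2; apply: nonlocal_arith => //.
    by case: (j == 0); rewrite ?expr1n ?expr0n.
  rewrite RintegralZl//; [|exact: measurable_omega|exact: iomD].
  apply: ler_wpM2l; first by rewrite mulr_ge0// sqr_ge0.
  rewrite RintegralD//; last exact: measurable_omega.
  apply: lerD.
    have := dm_sqr_int j a; rewrite /inner; apply: le_trans.
    by under eq_Rintegral do rewrite expr2.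
  have := m_sqr_int a; rewrite /inner; apply: le_trans.
  by under eq_Rintegral do rewrite expr2.
have := inner_amgm Lg Lh; have := divp_int.
move: (inner g g) (inner h h) (inner g h) (inner (divp mm) (divp mm)) gb hb.
by move=> a1 a2 a3 a4; lra.
Qed.

Lemma one_dirichlet_int : \int[leb2]_(x in omega) (1 + Dir x) <= 2 + E.
Proof.
rewrite RintegralD//; [|exact: measurable_omega|exact: iom_cst|exact: dirichlet_iom].
by rewrite Rint_omega_cst mul1r lerD2l; case: energy_split.
Qed.

(** Terms that are affine in the gradient are dominated in this way, as
    [|p| <= 1 + p ^ 2]. *)
Lemma dirichlet_bound (F : R * R -> R) (c : R) : 0 <= c ->
  {ae leb2, forall x, omega x -> `|F x| <= c * (1 + Dir x)} ->
  `|\int[leb2]_(x in omega) F x| <= c * (2 + E).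
Proof.
move=> c0 H; have i1 : iom (fun x => 1 + Dir x) by apply: iomD; [exact: iom_cst|exact: dirichlet_iom].
apply: le_trans (Rintegral_bound measurable_omega (iomZ c i1) H) _.
rewrite RintegralZl//; [|exact: measurable_omega].
by apply: ler_wpM2l => //; exact: one_dirichlet_int.
Qed.

Variables (psi : R^o -> R^o) (t : R) (i : 'I_3).
Hypothesis psi1 : `|psi t| <= 1.
Let phi (x : R * R) := tensor psi chi (delta_mx 0 i) (x, t).

Lemma cross_lap_bound : `|cross_lap mm phi| <= 4 * K * (2 + E).
Proof.
have H j : `|vinner (fun x => cross (mm x) (wderivv j mm x)) (partial j phi)| <= 2 * K * (2 + E).
  apply: dirichlet_bound; first by rewrite mulr_ge0// cutoff_bound_ge0.
  apply: filterS msph => x Hx ox.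
  rewrite (tensor_partial psi (delta_mx 0 i) j x t chic.1) dot_delta normrM.
  have b1 : `|(j == 0)%:R * (psi t * 'D_1 chi x.1)| <= K.
    rewrite !normrM -[leRHS]mul1r -[leRHS]mul1r; apply: ler_pM => //.
      by case: (j == 0); rewrite ?normr1 ?normr0.
    by apply: ler_pM.
  have c1 : `|cross (mm x) (wderivv j mm x) 0 i| <= 2 * (1 + Dir x).
    by apply: cross_le (Hx ox) _ => b; rewrite mxE dmE; exact: dm_le.
  by apply: le_trans (ler_pM _ _ b1 c1) _ => //; rewrite mulrA (mulrC K).
rewrite /cross_lap normrN sum_ord2; apply: le_trans (ler_normD _ _) _.
apply: le_trans (lerD (H 0) (H 1)) _.
by rewrite -mulrDl -mulrDl -natrD.
Qed.

Lemma gradE0_comp b : (exists j, forall x, gradE0 delta eps mm x 0 b = delta^-1 * calP mm j x) \/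
  (forall x, gradE0 delta eps mm x 0 b = 2 * mm x 0 2 / eps ^+ 2).
Proof.
case: b => [[|[|[|//]]] ib].
- by left; exists 0 => x; rewrite mxE.
- by left; exists 1 => x; rewrite mxE.
- by right=> x; rewrite mxE.
Qed.

Lemma gradE0_L2 b : L2 (fun x => gradE0 delta eps mm x 0 b).
Proof.
case: (gradE0_comp b) => [[j Hj]|Hb].
  rewrite (_ : (fun x => _) = fun x => delta^-1 * (-1 * wderiv j (inv_lap_pow 2^-1 (divp mm)) x)).
    by do 2 apply: L2_Z; exact: wderiv_L2.
  by apply/funext => x; rewrite Hj mulN1r.
rewrite (_ : (fun x => _) = fun x => (2 / eps ^+ 2) * mcomp mm 2 x); first exact/L2_Z/comp_L2.
by apply/funext => x; rewrite Hb mulrAC.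
Qed.

Lemma calP_L2 j : L2 (calP mm j).
Proof.
rewrite (_ : calP mm j = fun x => (-1) * wderiv j (inv_lap_pow 2^-1 (divp mm)) x).
  by apply: L2_Z; exact: wderiv_L2.
by apply/funext => x; rewrite mulN1r.
Qed.

Lemma L2_chi u : L2 u -> L2 (fun x => chi x.1 * u x).
Proof. by move=> Lu; apply: (L2_bM _ _ Lu); [exact: cutoff_measurable|move=> x _; exact: chiK]. Qed.

Variable theta : R.
Hypothesis theta0 : 0 < theta.

(** The two summands come from the nonlocal term and from the anisotropy; [theta] is
    the weight of the arithmetic-geometric inequality
    [2 * |m_3| <= theta + m_3 ^ 2 / theta], to be chosen as a function of [delta]. *)
Definition grad_bound : R :=
  delta^-1 * (4 * E + K ^+ 2 * (E + 2)) + K * (2 * theta / eps ^+ 2 + E / theta).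

Lemma nonlocal_part_ge0 : 0 <= delta^-1 * (4 * E + K ^+ 2 * (E + 2)).
Proof.
have := energy_ge0; have := sqr_ge0 K => k2 e0.
by rewrite mulr_ge0 ?invr_ge0 ?(ltW delta0)//; nra.
Qed.

Lemma local_part_ge0 : 0 <= K * (2 * theta / eps ^+ 2 + E / theta).
Proof.
rewrite mulr_ge0 ?cutoff_bound_ge0// addr_ge0//.
  by rewrite divr_ge0 ?sqr_ge0// mulr_ge0// ltW.
by rewrite divr_ge0 ?energy_ge0// ltW.
Qed.

Lemma gradE0_term a b :
  `|inner (fun x => gradE0 delta eps mm x 0 b) (fun x => chi x.1 * mcomp mm a x)|
  <= grad_bound.
Proof.
have Lma := comp_L2 a.
case: (gradE0_comp b) => [[j Hj]|Hb].
  rewrite (_ : (fun x => gradE0 _ _ _ _ _ _) = fun x => delta^-1 * calP mm j x); last first.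
    by apply/funext => x; rewrite Hj.
  rewrite innerZl; [|exact: calP_L2|exact: L2_chi].
  rewrite normrM ger0_norm ?invr_ge0 ?(ltW delta0)//.
  apply: (@le_trans _ _ (delta^-1 * (4 * E + K ^+ 2 * (E + 2)))).
    by rewrite ler_wpM2l ?invr_ge0 ?(ltW delta0)//; exact: nonlocal_bound.
  by rewrite lerDl; exact: local_part_ge0.
apply: (@le_trans _ _ (K * (2 * theta / eps ^+ 2 + E / theta))); last first.
  by rewrite lerDr; exact: nonlocal_part_ge0.
have i1 : iom (fun x => K / eps ^+ 2 * (theta + theta^-1 * mcomp mm 2 x ^+ 2)).
  by apply: iomZ; apply: iomD; [exact: iom_cst|exact/iomZ/iom_sqr/comp_L2].
apply: (le_trans (Rintegral_bound measurable_omega i1 _)).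
  apply: filterS msph => x Hx ox; rewrite Hb !normrM.
  have e2 : 0 < (eps ^+ 2)^-1 by rewrite invr_gt0 exprn_gt0.
  rewrite (gtr0_norm e2) (ger0_norm (_ : 0 <= 2))//.
  have m1 := unit_comp a (Hx ox).
  have cm : `|chi x.1| * `|mcomp mm a x| <= K * 1 by apply: ler_pM => //; exact: chiK.
  rewrite -[mcomp mm 2 x ^+ 2]real_normK ?num_real// /mcomp.
  rewrite /mcomp in cm.
  set q := `|mm x 0 2|; set c := `|chi x.1| * _ in cm *.
  have q0 : 0 <= q by exact: normr_ge0.
  have c0 : 0 <= c by rewrite mulr_ge0.
  have h : 2 * q <= theta + theta^-1 * q ^+ 2.
    have := sqr_ge0 (theta - q); rewrite sqrrB => h.
    rewrite -(ler_pM2l theta0) mulrDr (mulrA theta theta^-1) divff ?gt_eqF// mul1r.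
    by move: h; rewrite !expr2; lra.
  have Kn := cutoff_bound_ge0.
  rewrite [leLHS](_ : _ = (eps ^+ 2)^-1 * (c * (2 * q))); last by ring.
  rewrite [leRHS](_ : _ = (eps ^+ 2)^-1 * (K * (theta + theta^-1 * q ^+ 2))); last by ring.
  rewrite ler_pM2l//; apply: ler_pM => //; [by rewrite mulr_ge0|by rewrite mulr1 in cm].
rewrite RintegralZl//; [|exact: measurable_omega|]; last first.
  by apply: iomD; [exact: iom_cst|exact/iomZ/iom_sqr/comp_L2].
rewrite RintegralD//; [|exact: measurable_omega|exact: iom_cst|exact/iomZ/iom_sqr/comp_L2].
rewrite Rint_omega_cst RintegralZl//; [|exact: measurable_omega|exact/iom_sqr/comp_L2].
have [_ m3] := energy_split.
have -> : \int[leb2]_(x in omega) mcomp mm 2 x ^+ 2 = inner (mcomp mm 2) (mcomp mm 2).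
  by rewrite /inner; apply: eq_Rintegral => x _; rewrite expr2.
rewrite -mulrA; apply: ler_wpM2l; first exact: cutoff_bound_ge0.
have e2 : 0 < (eps ^+ 2)^-1 by rewrite invr_gt0 exprn_gt0.
rewrite mulrDr; apply: lerD; first by rewrite mulrC (mulrC 2).
rewrite mulrCA mulrC ler_pM2r ?invr_gt0//.
by rewrite ler_pdivrMl ?exprn_gt0.
Qed.

Lemma gradE0_bound :
  `|vinner (fun x => cross (mm x) (gradE0 delta eps mm x)) phi| <= 2 * grad_bound.
Proof.
pose T a b := inner (fun x => gradE0 delta eps mm x 0 b) (fun x => chi x.1 * mcomp mm a x).
have -> : vinner (fun x => cross (mm x) (gradE0 delta eps mm x)) phi =
    psi t * (T (i + 1) (i + 2) - T (i + 2) (i + 1)).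
  have i1 a b : iom (fun x => gradE0 delta eps mm x 0 b * (chi x.1 * mcomp mm a x)).
    by apply: L2_M; [exact: gradE0_L2|exact/L2_chi/comp_L2].
  rewrite /T /inner -RintegralB//; try exact: measurable_omega; try exact: i1.
  rewrite -RintegralZl//; [|exact: measurable_omega|by apply: iomB; exact: i1].
  by apply: eq_Rintegral => x _; rewrite dot_delta crossE /mcomp; ring.
rewrite normrM -[leRHS]mul1r; apply: ler_pM => //.
apply: le_trans (ler_normB _ _) _; rewrite mulr2n mulrDl mul1r.
by apply: lerD; exact: gradE0_term.
Qed.

Variables (v : R * R -> 'rV[R]_2) (V : R).
Hypothesis (vV : {ae leb2, forall x, omega x -> enorm (v x) <= V}) (V0 : 0 <= V).

Lemma transportE x b : transport v mm x 0 b = \sum_j v x 0 j * dm j b x.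
Proof. by rewrite /transport summxE; apply: eq_bigr => j _; rewrite !mxE dmE. Qed.

Lemma transport_comp x b : enorm (v x) <= V ->
  `|transport v mm x 0 b| <= 2 * V * (1 + Dir x).
Proof.
move=> vx; rewrite transportE sum_ord2.
have h j : `|v x 0 j| <= V.
  apply: le_trans vx; rewrite /enorm -sqrtr_sqr ler_wsqrtr//; exact: dot_comp.
apply: le_trans (ler_normD _ _) _; rewrite -mulrA mulr2n mulrDl mul1r !normrM.
by apply: lerD; apply: ler_pM => //; exact: dm_le.
Qed.

Lemma transport_bound : `|vinner (transport v mm) phi| <= 2 * K * V * (2 + E).
Proof.
apply: dirichlet_bound; first by rewrite mulr_ge0// mulr_ge0// cutoff_bound_ge0.
apply: filterS vV => x vx ox; rewrite dot_delta !normrM.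
have := transport_comp i (vx ox); have := chiK x.1 => h1 h2.
have h3 : `|psi t| * `|chi x.1| <= K by rewrite -[leRHS]mul1r; apply: ler_pM.
apply: (@le_trans _ _ (K * (2 * V * (1 + Dir x)))).
  by apply: ler_pM => //; rewrite mulr_ge0.
rewrite le_eqVlt; apply/orP; left; apply/eqP; ring.
Qed.

Lemma cross_transport_bound :
  `|vinner (fun x => cross (mm x) (transport v mm x)) phi| <= 4 * K * V * (2 + E).
Proof.
apply: dirichlet_bound; first by rewrite mulr_ge0// mulr_ge0// cutoff_bound_ge0.
apply: filterS2 msph vV => x mx vx ox; rewrite dot_delta !normrM.
have h2 := cross_le i (mx ox) (fun b => transport_comp b (vx ox)).
have h3 : `|psi t| * `|chi x.1| <= K by rewrite -[leRHS]mul1r; apply: ler_pM => //; exact: chiK.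
apply: (@le_trans _ _ (K * (2 * (2 * V * (1 + Dir x))))).
  by apply: ler_pM => //; rewrite mulr_ge0.
rewrite le_eqVlt; apply/orP; left; apply/eqP; ring.
Qed.

Variables (w : R * R -> 'rV[R]_3) (alpha beta : R).
Hypotheses (Lw : forall b, L2 (mcomp w b)) (alpha0 : 0 <= alpha) (beta0 : 0 <= beta).

Lemma dot_w_iom : iom (fun x => dot (w x) (w x)).
Proof.
rewrite (_ : (fun x => _) = fun x => mcomp w 0 x ^+ 2 + mcomp w 1 x ^+ 2 + mcomp w 2 x ^+ 2).
  by apply: iomD; [apply: iomD|]; exact: iom_sqr.
by apply/funext => x; rewrite /dot sum_ord3 !expr2.
Qed.

(** The damping is treated as a perturbation of [w] because [w] itself pairs well:
    its pairing is kept exactly and gives the variation of the amplitude. *)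
Lemma damping_bound :
  `|vinner (fun x => w x + alpha *: cross (mm x) (w x)) phi - vinner w phi| <=
  alpha * K * (2 + \int[leb2]_(x in omega) dot (w x) (w x)).
Proof.
have iA : iom (fun x => dot (w x) (phi x)).
  rewrite (_ : (fun x => _) = fun x => psi t * (chi x.1 * mcomp w i x)).
    apply: iomZ; apply: (L2_M (f := fun x => chi x.1)) => //.
    by apply: (@L2_bounded _ _ K) => [|x _]; [exact: cutoff_measurable|exact: chiK].
  by apply/funext => x; rewrite dot_delta mulrA.
have i2 : iom (fun x => 1 + dot (w x) (w x)) by apply: iomD; [exact: iom_cst|exact: dot_w_iom].
apply: le_trans (Rintegral_close measurable_omega iA (iomZ (alpha * K) i2) _) _.
  apply: filterS msph => x mx ox; rewrite !dot_delta !mxE -mulrBr addrAC subrr add0r.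
  rewrite !normrM (ger0_norm alpha0).
  have h3 : `|psi t| * `|chi x.1| <= K by rewrite -[leRHS]mul1r; apply: ler_pM => //; exact: chiK.
  have h4 : `|cross (mm x) (w x) 0 i| <= 1 + dot (w x) (w x).
    have h b : `|w x 0 b| <= 2^-1 * (1 + dot (w x) (w x)).
      have := dot_comp (w x) b; have := sqr_ge0 (`|w x 0 b| - 1).
      by rewrite -[w x 0 b ^+ 2]real_normK ?num_real//; nra.
    by have := cross_le i (mx ox) h; rewrite mulrA divff// mul1r.
  rewrite mxE in h4.
  rewrite mulrCA -(mulrA alpha K); apply: ler_wpM2l => //.
  by apply: ler_pM => //; rewrite mulr_ge0.
rewrite RintegralZl//; [|exact: measurable_omega].
rewrite RintegralD//; [|exact: measurable_omega|exact: iom_cst|exact: dot_w_iom].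
by rewrite Rint_omega_cst mul1r.
Qed.

Definition slice_bound (W : R) : R :=
  alpha * K * (2 + W) + beta * (8 * K * (2 + E) + 2 * grad_bound)
  + 2 * K * V * (2 + E).

(** At a fixed time, the left-hand side of the equation tested with [phi] is the time
    derivative [w] up to an error controlled by the energy and by the square norm
    of [w]. *)
Lemma slice_estimate :
  `|vinner (fun x => w x + alpha *: cross (mm x) (w x)) phi +
    beta * cross_gradE delta eps mm phi + vinner (transport v mm) phi - vinner w phi|
  <= slice_bound (\int[leb2]_(x in omega) dot (w x) (w x)).
Proof.
have h1 := damping_bound; have h2 := transport_bound.
have h3 := cross_lap_bound; have h4 := gradE0_bound.
rewrite /slice_bound /cross_gradE.
have -> (a b c d : R) : a + b + c - d = (a - d) + b + c by ring.
apply: le_trans (ler_normD _ _) _; apply: lerD => //.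
apply: le_trans (ler_normD _ _) _; apply: lerD => //.
rewrite normrM (ger0_norm beta0); apply: ler_wpM2l => //.
apply: le_trans (ler_normD _ _) _; apply: lerD => //.
rewrite normrM normrN (ger0_norm (_ : 0 <= 2))//.
rewrite (_ : 8 * K * (2 + E) = 2 * (4 * K * (2 + E))); last by ring.
exact: ler_wpM2l.
Qed.

End Slice.

(** * Sections of space-time functions *)

Section AeSections.
Context d1 d2 (T1 : measurableType d1) (T2 : measurableType d2) {R : realType}.
Variable m1 : {sigma_finite_measure set T1 -> \bar R}.
Variable m2 : {sigma_finite_measure set T2 -> \bar R}.

(** A null set has almost all its sections null, by Tonelli's theorem. *)
Lemma ae_ysection (P : T1 * T2 -> Prop) : {ae (m1 \x m2)%E, forall z, P z} ->
  {ae m2, forall y, {ae m1, forall x, P (x, y)}}.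
Proof.
move=> [N [mN N0 PN]].
have H : (\int[m2]_y `|(m1 \o ysection N) y| = 0)%E.
  have E : (\int[m2]_y fubini_G m1 (EFin \o \1_N) y = 0)%E.
    rewrite -(indic_fubini_tonelli m1 m2 mN) -(indic_fubini_tonelli1 m1 m2 mN).
    by rewrite integral_indic// setIT; exact: N0.
  rewrite -[RHS]E indic_fubini_tonelli_GE//.
  by apply: eq_integral => y _; rewrite gee0_abs.
have /ae_eq_integral_abs := H; move=> /(_ measurableT (measurable_fun_ysection _ mN)) H1.
apply: filterS H1 => y /(_ Logic.I) /= Hy.
exists (ysection N y); split => //; first exact: measurable_ysection.
by move=> x /= nP; rewrite /ysection /= inE; exact: PN.
Qed.

Lemma measurable_section_integral (f : T1 * T2 -> R) : measurable_fun setT f ->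
  measurable_fun setT (fun y => \int[m1]_x f (x, y)).
Proof.
move=> mf; apply: measurableT_comp => //.
rewrite (_ : (fun y => _) = fun y => (fubini_G m1 (EFin \o f)^\+ y - fubini_G m1 (EFin \o f)^\- y)%E); last first.
  by apply/funext => y; rewrite integralE /fubini_G; congr (_ - _)%E; apply: eq_integral => x _; rewrite ?funeposE ?funenegE.
apply: emeasurable_funB; apply: measurable_fun_fubini_tonelli_G => //.
- by apply: measurable_funepos; exact/measurable_EFinP.
- by apply: measurable_funeneg; exact/measurable_EFinP.
Qed.

End AeSections.

Section Area.
Context {R : realType}.
Local Notation leb := (@lebesgue_measure R).
Local Notation mR := (measurableTypeR R).

Lemma plane_sigma_finite : sigma_finite setT (leb \x leb)%E.
Proof.
pose I n : set mR := `[- n%:R, n%:R]%classic.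
exists (fun n => I n `*` I n).
  apply/seteqP; split => // -[x y] _.
  exists (Num.truncn (`|x| + `|y|)).+1 => //; split; rewrite /I /= in_itv /= -ler_norml.
    by apply: le_trans (ltW (truncnS_gt _)); rewrite lerDl.
  by apply: le_trans (ltW (truncnS_gt _)); rewrite lerDr.
move=> n; split; first by apply: measurableX; exact: measurable_itv.
rewrite product_measure1E; [|exact: measurable_itv|exact: measurable_itv].
have fin : (leb (I n) < +oo)%E.
  by rewrite lebesgue_measure_itv /=; case: ifP => _; rewrite ?ltry// -EFinD ltry.
by rewrite lte_mul_pinfty// ge0_fin_numE.
Qed.

(** A name for the product measure that carries its sigma-finiteness, as required by
    the theorems of Fubini and Tonelli. *)
Definition area : set (mR * mR)%type -> \bar R := (leb \x leb)%E.
HB.instance Definition _ := Measure.on area.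
HB.instance Definition _ :=
  @Measure_isSigmaFinite.Build _ _ _ area plane_sigma_finite.

End Area.

Section SpaceTime.
Context {R : realType}.
Local Notation leb := (@lebesgue_measure R).
Local Notation leb2 := (leb \x leb)%E.
Local Notation RR := (measurableTypeR R * measurableTypeR R)%type.
Local Notation omega := (@omega R : set RR).
Local Notation cylinder := (@cylinder R : set (RR * measurableTypeR R)).

Lemma measurable_cylinder : measurable cylinder.
Proof.
exact: (measurableX (@measurable_omega R) (measurable_itv `[(0 : R), +oo[)).
Qed.

(** Measurability is only assumed on the cylinder; the extension by 0 is measurable
    on the whole of space-time, so that sections can be taken. *)
Definition extend n (f : R -> R * R -> 'rV[R]_n) (i : 'I_n) : (R * R) * R -> R :=
  (fun z => f z.2 z.1 0 i) \_ cylinder.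

Lemma extendE n (f : R -> R * R -> 'rV[R]_n) i x t : 0 <= t -> omega x ->
  extend f i (x, t) = f t x 0 i.
Proof.
move=> t0 ox; rewrite /extend /patch ifT// inE; split => //=.
by rewrite in_itv /= t0.
Qed.

Lemma measurable_extend n (f : R -> R * R -> 'rV[R]_n) i : joint_measurable f ->
  measurable_fun (setT : set (RR * measurableTypeR R)) (extend f i).
Proof.
move=> /(_ i) mf.
exact: (measurable_restrictT _ measurable_cylinder).1 mf.
Qed.

Lemma measurable_slice n (f : R -> R * R -> 'rV[R]_n) i t : joint_measurable f ->
  0 <= t -> measurable_fun omega (mcomp (f t) i).
Proof.
move=> mf t0; have H := measurable_fun_pair1 t (measurable_extend i mf).
apply: (eq_measurable_fun (fun x => extend f i (x, t))).
  by move=> x; rewrite inE => ox; rewrite extendE.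
exact: measurable_funTS.
Qed.

End SpaceTime.

(** * The equation tested with a tensor product *)

Section TimeEstimate.
Context {R : realType}.
Local Notation leb := (@lebesgue_measure R).
Local Notation leb2 := (leb \x leb)%E.
Local Notation mR := (measurableTypeR R).
Local Notation RR := (mR * mR)%type.
Local Notation omega := (@omega R : set RR).

Local Opaque wderiv inv_lap_pow tderiv.

Lemma measurable_itvT (J : interval R) : measurable ([set` J] : set mR).
Proof. exact: measurable_itv. Qed.

Lemma vL2norm_sqr n (f : R * R -> 'rV[R]_n) :
  (vL2norm f ^+ 2 = \int[leb2]_(x in omega) (dot (f x) (f x))%:E)%E.
Proof.
rewrite /vL2norm L2norm_sqr; apply: eq_integral => x _.
by rewrite sqr_sqrtr ?dot_ge0.
Qed.

Lemma vinner0 n (f : R * R -> 'rV[R]_n) : vinner f (fun=> 0) = 0.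
Proof.
rewrite /vinner -[RHS](mul0r 2) -Rint_omega_cst; apply: eq_Rintegral => x _.
by rewrite /dot big1// => i _; rewrite mxE mulr0.
Qed.

Lemma cross_lap0 (mm : R * R -> 'rV[R]_3) : cross_lap mm (fun=> 0) = 0.
Proof.
rewrite /cross_lap big1 ?oppr0// => j _.
rewrite (_ : partial j (fun=> 0) = fun=> 0); first exact: vinner0.
by apply/funext => x; rewrite /partial derive_cst.
Qed.

Lemma Rintegral_vanish (f : R -> R) (T : R) : (forall t, T < t -> f t = 0) ->
  \int[leb]_(t in `]0, +oo[) f t = \int[leb]_(t in `]0, T]) f t.
Proof.
move=> f0; rewrite Rintegral_mkcond [RHS]Rintegral_mkcond; congr (Rintegral _ _ _).
apply/funext => t; rewrite /patch !mem_setE !in_itv /= andbT.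
by have [tT|tT] := leP t T; rewrite ?andbT// andbF f0// if_same.
Qed.

Variables (delta eps alpha beta E T V W0 theta K : R).
Variables (v : R -> R * R -> 'rV[R]_2) (m : R -> R * R -> 'rV[R]_3).
Variables (chi psi : R^o -> R^o) (a b : R) (i : 'I_3).
Hypotheses (delta0 : 0 < delta) (eps0 : 0 < eps) (alpha0 : 0 < alpha)
  (beta0 : 0 < beta) (theta0 : 0 < theta) (V0 : 0 <= V) (T0 : 0 <= T).
Hypothesis mH1 : forall t : R, 0 <= t -> forall k, H1 (mcomp (m t) k).
Hypothesis mapprox : forall t : R, 0 <= t -> forall k, exists phi : nat -> R * R -> R^o,
  (forall n, smooth_closure (phi n)) /\ H1cvg phi (mcomp (m t) k).
Hypothesis msph : forall t : R, 0 <= t ->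
  {ae leb2, forall x, omega x -> dot (m t x) (m t x) = 1}.
Hypothesis mE : forall t : R, 0 <= t <= T -> (energy delta eps (m t) <= E%:E)%E.
Hypothesis Hw : is_tderiv m (tderiv m).
Hypothesis HW : (\int[leb]_(s in `[0%R, T]) vL2norm (tderiv m s) ^+ 2 <= W0%:E)%E.
Hypothesis Hllg : LLG delta eps alpha beta v m.
Hypothesis Hv : {ae leb, forall t : R, 0 <= t ->
  {ae leb2, forall x, omega x -> enorm (v t x) <= V}}.
Hypotheses (chic : cutoff chi) (chiK : forall y, `|chi y| <= K)
  (dchiK : forall y, `|'D_1 chi y| <= K).
Hypotheses (psis : smooth psi) (psi1 : forall t, `|psi t| <= 1)
  (a0 : 0 < a) (bT : b <= T) (psi_supp : forall t, ~~ (a <= t <= b) -> psi t = 0).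

Local Notation w := (tderiv m).
Local Notation D := (`]0, T]%classic : set mR).

Definition kinetic (t : R) : \bar R := (\int[leb2]_(x in omega) (dot (w t x) (w t x))%:E)%E.
Local Notation WE := kinetic.
Local Notation W t := (\int[leb2]_(x in omega) dot (w t x) (w t x)).

Lemma kinetic_ge0 t : (0 <= WE t)%E.
Proof. by apply: integral_ge0 => x _; rewrite lee_fin dot_ge0. Qed.

Lemma tderiv_measurable : joint_measurable w. Proof. by case: Hw. Qed.

Lemma measurable_kinetic : measurable_fun (`[0, +oo[%classic : set mR) WE.
Proof.
pose f z := \sum_(k < 3) extend w k z ^+ 2.
have mf : measurable_fun (setT : set (RR * mR)) f.
  by apply: measurable_sum => k; apply: measurable_funX; exact: measurable_extend tderiv_measurable.
apply: (eq_measurable_fun (fubini_G area (EFin \o f))).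
  move=> t; rewrite inE /= in_itv /= andbT => t0.
  rewrite /fubini_G /WE [RHS]integral_mkcond; apply: eq_integral => x _ /=.
  rewrite /patch; case: ifPn => ox.
    congr EFin; apply: eq_bigr => k _; rewrite extendE ?expr2//.
    exact: set_mem.
  rewrite /f big1// => k _; rewrite /extend /patch ifF ?expr0n//.
  apply/negbTE; apply/negP => /set_mem [/= o' _].
  by move/negP: ox; apply; exact/mem_set.
have mEf : measurable_fun (setT : set (RR * mR)) (EFin \o f) by exact/measurable_EFinP.
have f0 z : (0 <= (EFin \o f) z)%E.
  by rewrite lee_fin; apply: sumr_ge0 => k _; exact: sqr_ge0.
exact: (measurable_funTS (measurable_fun_fubini_tonelli_G (m1 := area) (EFin \o f) mEf f0)).
Qed.

Lemma kinetic_integrable : leb.-integrable (`[0, T]%classic : set mR) WE.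
Proof.
apply/integrableP; split.
  apply: measurable_funS measurable_kinetic => //.
  by move=> t /=; rewrite !in_itv /= andbT => /andP[].
apply: le_lt_trans (_ : (W0%:E < +oo)%E); last by rewrite ltry.
apply: le_trans HW; apply: integral_mono => t _.
by rewrite gee0_abs ?kinetic_ge0// vL2norm_sqr.
Qed.

Lemma slab_sub : D `<=` `[0, T].
Proof. by move=> t /=; rewrite !in_itv /= => /andP[/ltW -> ->]. Qed.

Lemma measurable_slab : measurable D. Proof. exact: measurable_itv. Qed.

Lemma kinetic_fin : {ae leb, forall t, D t -> (WE t < +oo)%E}.
Proof.
have := integrable_ae (measurable_itvT _) kinetic_integrable.
apply: filterS => t Ht Dt; rewrite -ge0_fin_numE ?kinetic_ge0//.
by apply: Ht; exact: slab_sub.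
Qed.

Lemma kinetic_Rintegrable : leb.-integrable D (fun t => (W t)%:E).
Proof.
have iWE : leb.-integrable D WE by apply: integrableS kinetic_integrable => //; exact: slab_sub.
apply: le_integrable iWE => //.
  apply/measurable_EFinP; apply: measurableT_comp => //.
  apply: measurable_funS measurable_kinetic => //.
  by move=> t /slab_sub /=; rewrite !in_itv /= andbT => /andP[].
move=> t _; rewrite (gee0_abs (kinetic_ge0 _)) /= ger0_norm; last first.
  by apply: Rintegral_ge0 => x _; exact: dot_ge0.
rewrite /Rintegral -/(WE t); have := kinetic_ge0 t.
by case: (WE t) => [r||]//=; rewrite leey.
Qed.

Lemma kinetic_le : \int[leb]_(t in D) W t <= W0.
Proof.
rewrite -lee_fin /Rintegral fineK; last exact: integrable_fin_num kinetic_Rintegrable.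
apply: le_trans (_ : (\int[leb]_(t in `[0%R, T]) WE t <= _)%E); last first.
  by apply: le_trans HW; apply: integral_mono => t _; rewrite vL2norm_sqr.
apply: le_trans (_ : (\int[leb]_(t in D) WE t <= _)%E).
  apply: integral_mono => t _; rewrite -/(WE t).
  by have := kinetic_ge0 t; case: (WE t) => [r||]//=; rewrite leey.
apply: ge0_subset_integral => //.
- exact: (measurable_int leb kinetic_integrable).
- by move=> t _; exact: kinetic_ge0.
- exact: slab_sub.
Qed.

Lemma tderiv_L2 t k : 0 <= t -> (WE t < +oo)%E -> L2 (mcomp (w t) k).
Proof.
move=> t0 fin; apply/L2P; split; first exact: measurable_slice tderiv_measurable _.
apply: le_lt_trans fin; apply: integral_mono => x _.
by rewrite lee_fin dot_comp.
Qed.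

Let phi := tensor psi chi (delta_mx 0 i).
Local Notation phit t := (fun x => phi (x, t)).

Lemma test_phi : test_time phi.
Proof. by apply: test_tensor => //; exists a, b. Qed.

Lemma phi_zero t : psi t = 0 -> phit t = fun=> 0.
Proof. by move=> p0; apply/funext => x; rewrite /phi /tensor /= p0 mul0r scale0r. Qed.

Lemma psi_after t : T < t -> psi t = 0.
Proof. by move=> tT; apply: psi_supp; rewrite negb_and orbC -!ltNge (le_lt_trans bT tT). Qed.

Definition amplitude t := inner (fun x => chi x.1) (mcomp (m t) i).

Lemma chi_L2 : L2 (fun x : R * R => chi x.1 : R).
Proof. by apply: smooth_L2; apply: smooth_fst; case: chic. Qed.

Lemma weak_tderiv : \int[leb]_(t in `]0, +oo[) ('D_1 psi t * amplitude t) =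
  - \int[leb]_(t in D) vinner (w t) (phit t).
Proof.
rewrite -(@Rintegral_vanish _ T); last by move=> t /psi_after p0; rewrite phi_zero ?vinner0.
have [_ _ /(_ _ test_phi) <-] := Hw.
apply: eq_Rintegral => t; rewrite inE /= in_itv /= andbT => /ltW t0.
have Lm : L2 (mcomp (m t) i) by case: (mH1 t0 i).
rewrite -innerZl//; last exact: chi_L2.
by apply: eq_Rintegral => x _; rewrite tensor_dt// dot_delta.
Qed.

Lemma pairing_integrable : leb.-integrable D (fun t => (vinner (w t) (phit t))%:E).
Proof.
have K0 : 0 <= K by exact: le_trans (chiK 0).
apply/integrableP; split.
  apply/measurable_EFinP.
  pose f z := psi z.2 * chi z.1.1 * extend w i z.
  have mf : measurable_fun (setT : set (RR * mR)) f.
    have mpsi : measurable_fun (setT : set mR) (psi : R -> R).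
      exact: continuous_measurable_fun (smooth_continuous psis).
    have mchi : measurable_fun (setT : set mR) (chi : R -> R).
      exact: continuous_measurable_fun (smooth_continuous chic.1).
    apply: measurable_funM; last exact: measurable_extend tderiv_measurable.
    apply: measurable_funM.
      exact: (measurableT_comp mpsi measurable_snd).
    exact: (measurableT_comp mchi (measurableT_comp measurable_fst measurable_fst)).
  apply: (eq_measurable_fun (fun t => \int[leb2]_x f (x, t))).
    move=> t; rewrite inE => /slab_sub /=; rewrite in_itv /= => /andP[t0 _].
    rewrite /vinner [RHS]Rintegral_mkcond; apply: eq_Rintegral => x _.
    rewrite /f /patch; case: ifPn => ox.
      by rewrite extendE// ?dot_delta//; exact: set_mem.
    rewrite /extend /patch ifF ?mulr0//.
    apply/negbTE; apply/negP => /set_mem [/= o' _].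
    by move/negP: ox; apply; exact/mem_set.
  exact: (measurable_funTS (measurable_section_integral area mf)).
have iB : leb.-integrable D (fun t => (K * (2 + W t))%:E).
  have i1 : leb.-integrable D (fun t => (2%:E + (W t)%:E)%E).
    apply: (integrableD measurable_slab _ kinetic_Rintegrable).
    apply/integrableP; split; first exact: measurable_cst.
    by rewrite integral_cst//= lebesgue_measure_itv /=; case: ifP => _; rewrite ?mule0 ?ltry// -EFinD -EFinM ltry.
  have := integrableZl measurable_slab K i1; apply: eq_integrable => //.
apply: le_lt_trans (integrable_lty measurable_slab iB).
apply: le_integral_ub => //; first exact: (measurable_int leb iB).
apply: filterS kinetic_fin => t fin Dt; rewrite /= lee_fin.
have t0 : 0 <= t by move: Dt => /slab_sub /=; rewrite in_itv /= => /andP[].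
have Lw k := tderiv_L2 k t0 (fin Dt).
have iw := dot_w_iom Lw.
have i2 := iomD (@iom_cst _ 1) iw.
apply: le_trans (Rintegral_bound (@measurable_omega R) (iomZ K i2) _) _.
  apply: nearW => x ox; rewrite dot_delta !normrM.
  apply: ler_pM; rewrite ?mulr_ge0//.
    by rewrite -[leRHS]mul1r; apply: ler_pM.
  have := dot_comp (w t x) i; have := sqr_ge0 (`|w t x 0 i| - 1).
  have := dot_ge0 (w t x).
  by rewrite -[w t x 0 i ^+ 2]real_normK ?num_real//; nra.
rewrite RintegralZl//; [|exact: measurable_omega].
rewrite RintegralD//; [|exact: measurable_omega|exact: iom_cst].
by rewrite Rint_omega_cst mul1r.
Qed.

(** All terms of the equation other than the time derivative, integrated over
    [[0, T]] with a test function bounded by [K] together with its derivative in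
    [x.1]; [W0] bounds the space-time integral of [|d_t m| ^ 2]. *)
Definition flux_bound : R :=
  alpha * K * (2 * T + W0) +
  T * (beta * (8 * K * (2 + E) + 2 * grad_bound delta eps E K theta) + 6 * K * V * (2 + E)).

(** By [weak_tderiv] the integral is minus that of the pairing of [d_t m] with the test
    function. The weak equation equates the integrals of its two sides [F] and [G]; at
    a fixed time [F] is this pairing up to [slice_estimate], and [G] is a small
    transport term. *)
Lemma time_estimate :
  `|\int[leb]_(t in `]0, +oo[) ('D_1 psi t * amplitude t)| <= flux_bound.
Proof.
rewrite weak_tderiv normrN.
have K0 : 0 <= K by exact: le_trans (chiK 0).
pose F t := vinner (fun x => w t x + alpha *: cross (m t x) (w t x)) (phit t) +
  beta * cross_gradE delta eps (m t) (phit t) + vinner (transport (v t) (m t)) (phit t).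
pose G t := vinner (fun x => cross (m t x) (transport (v t) (m t) x)) (phit t).
have FG : \int[leb]_(t in D) F t = \int[leb]_(t in D) G t.
  rewrite -!(@Rintegral_vanish _ T); first exact: (Hllg test_phi).
    by move=> t /psi_after p0; rewrite /G phi_zero ?vinner0.
  move=> t /psi_after p0; rewrite /F phi_zero// !vinner0 /cross_gradE cross_lap0 vinner0.
  by rewrite ?(mulr0, addr0).
set c := beta * (8 * K * (2 + E) + 2 * grad_bound delta eps E K theta) + 2 * K * V * (2 + E).
(* The integrable bound of the error [F t - <d_t m, phi>], by [slice_estimate]. *)
pose rho t := alpha * K * (2 + W t) + c.
have mD : leb D = T%:E.
  rewrite lebesgue_measure_itv /= lte_fin; case: ifPn; first by rewrite oppr0 adde0.
  by rewrite -leNgt => Tle0; congr EFin; apply/eqP; rewrite eq_le T0.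
have icst (k : R) : leb.-integrable D (EFin \o (fun=> k)).
  apply/integrableP; split; first exact: measurable_cst.
  by rewrite integral_cst//= mD -EFinM ltry.
have i1 : leb.-integrable D (EFin \o (fun t => 2 + W t)).
  have := integrableD measurable_slab (icst 2) kinetic_Rintegrable.
  by apply: eq_integrable => // t _.
have i2 : leb.-integrable D (EFin \o (fun t => alpha * K * (2 + W t))).
  have := integrableZl measurable_slab (alpha * K) i1.
  by apply: eq_integrable => // t _.
have irho : leb.-integrable D (EFin \o rho).
  have := integrableD measurable_slab i2 (icst c).
  by apply: eq_integrable => // t _.
have slice t : D t -> (WE t < +oo)%E -> {ae leb2, forall x, omega x -> enorm (v t x) <= V} ->
    `|F t - vinner (w t) (phit t)| <= rho t /\ `|G t| <= 4 * K * V * (2 + E).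
  move=> Dt fin vt.
  have t0T : 0 <= t <= T by move: Dt => /slab_sub /=; rewrite in_itv.
  have t0 : 0 <= t by case/andP: t0T.
  split.
    rewrite /rho /c addrA; apply: (@slice_estimate R delta eps E (m t) delta0 eps0
      (mH1 t0) (mapprox t0) (msph t0) (mE t0T) (fun j k => wderiv j (mcomp (m t) k))) => //.
    - by move=> k; exact: tderiv_L2.
    - exact: ltW.
    - exact: ltW.
  by apply: (@cross_transport_bound R delta eps E (m t) delta0 eps0
      (mH1 t0) (msph t0) (mE t0T) (fun j k => wderiv j (mcomp (m t) k))).
have b1 : `|\int[leb]_(t in D) F t - \int[leb]_(t in D) vinner (w t) (phit t)| <= \int[leb]_(t in D) rho t.
  apply: Rintegral_close => //; first exact: pairing_integrable.
  apply: filterS2 kinetic_fin Hv => t h1 h2 Dt.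
  have t0 : 0 <= t by move: Dt => /slab_sub /=; rewrite in_itv /= => /andP[].
  by have [] := slice t Dt (h1 Dt) (h2 t0).
have b2 : `|\int[leb]_(t in D) G t| <= \int[leb]_(t in D) (4 * K * V * (2 + E)).
  apply: (Rintegral_bound measurable_slab (icst _)).
  apply: filterS2 kinetic_fin Hv => t h1 h2 Dt.
  have t0 : 0 <= t by move: Dt => /slab_sub /=; rewrite in_itv /= => /andP[].
  by have [] := slice t Dt (h1 Dt) (h2 t0).
have e1 : \int[leb]_(t in D) rho t = alpha * K * (2 * T + \int[leb]_(t in D) W t) + c * T.
  rewrite /rho RintegralD; [|exact: measurable_slab|exact: i2|exact: icst].
  rewrite RintegralZl; [|exact: measurable_slab|exact: i1].
  rewrite RintegralD; [|exact: measurable_slab|exact: icst|exact: kinetic_Rintegrable].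
  by rewrite !(Rintegral_cst leb measurable_slab)/= mD.
have e2 : \int[leb]_(t in D) (4 * K * V * (2 + E)) = 4 * K * V * (2 + E) * T.
  by rewrite (Rintegral_cst leb measurable_slab)/= mD.
rewrite e1 in b1; rewrite e2 -FG in b2.
have h3 : alpha * K * (2 * T + \int[leb]_(t in D) W t) <= alpha * K * (2 * T + W0).
  by apply: ler_wpM2l; [rewrite mulr_ge0// ltW|rewrite lerD2l; exact: kinetic_le].
have tri (x y : R) : `|y| <= `|x| + `|x - y|.
  by have := ler_normB x (x - y); rewrite subKr.
apply: le_trans (tri (\int[leb]_(t in D) F t) _) _.
apply: le_trans (lerD b2 (le_trans b1 (lerD h3 (lexx _)))) _.
rewrite /flux_bound /c le_eqVlt; apply/orP; left; apply/eqP; ring.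
Qed.

End TimeEstimate.

(** * Temporal plateaus *)

Section Ramp.
Context {R : realType}.
Local Notation leb := (@lebesgue_measure R).
Local Notation mR := (measurableTypeR R).

Definition ramp (c h : R) : R^o -> R^o := fun t => step ((t - c) / h).

Lemma ramp_smooth c h : smooth (ramp c h).
Proof.
move=> k; apply: (@Ck_comp_affine _ R^o R^o k (step : R^o -> R^o) (fun t : R^o => (t - c) / h : R^o) (fun v => v / h)).
- by move=> x; apply: cvgMr_tmp; apply: cvgB; [exact: cvg_id|exact: cvg_cst].
- by move=> u v x; rewrite /GRing.scale /=; ring.
- exact: step_smooth.
Qed.

Lemma ramp_ge0 c h t : 0 <= ramp c h t. Proof. exact: step_ge0. Qed.
Lemma ramp_le1 c h t : ramp c h t <= 1. Proof. exact: step_le1. Qed.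

Lemma ramp0 c h t : 0 < h -> t <= c -> ramp c h t = 0.
Proof. by move=> h0 tc; apply: step0; rewrite pmulr_lle0 ?invr_gt0// subr_le0. Qed.

Lemma ramp1 c h t : 0 < h -> c + h <= t -> ramp c h t = 1.
Proof. by move=> h0 tc; apply: step1; rewrite ler_pdivlMr// mul1r lerBrDl. Qed.

Lemma derive_locally_cst (f : R^o -> R^o) (k x : R) : (\forall y \near x, f y = k) ->
  'D_1 f x = 0.
Proof.
move=> H; rewrite (@near_eq_derive _ _ _ f (cst (k : R^o)) x 1); first exact: derive_cst.
exact: H.
Qed.

Lemma dramp0 c h t : 0 < h -> ~~ (c <= t <= c + h) -> 'D_1 (ramp c h) t = 0.
Proof.
move=> h0; rewrite negb_and -!ltNge => /orP[tc|ct].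
  apply: (@derive_locally_cst _ 0); near=> y; apply: ramp0 => //.
  by apply: ltW; near: y; exact: lt_nbhsl.
apply: (@derive_locally_cst _ 1); near=> y; apply: ramp1 => //.
by apply: ltW; near: y; exact: lt_nbhsr.
Unshelve. all: by end_near. Qed.

Lemma continuous_segment_bounded (f : R^o -> R^o) (a b : R) : continuous f ->
  exists2 K : R, 0 <= K & forall y, a <= y <= b -> `|f y| <= K.
Proof.
move=> cf; have cpt : compact (`[a, b]%classic : set R) by exact: segment_compact.
have := continuous_compact (continuous_subspaceT cf) cpt.
move=> /compact_bounded[M [_ HM]]; exists (`|M| + 1) => [|y yab]; first by rewrite addr_ge0.
apply: (HM (`|M| + 1)); first by rewrite (le_lt_trans (ler_norm _))// ltrDl ltr01.
by exists y => //=; rewrite in_itv.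
Qed.

Lemma dstep_bounded : exists2 M : R, 0 <= M & forall y, `|'D_1 (step : R^o -> R^o) y| <= M.
Proof.
have sd := smooth_derive (1 : R^o) (@step_smooth R).
have [M M0 HM] := @continuous_segment_bounded _ 0 1 (smooth_continuous sd).
exists M => // y; have [y01|y01] := boolP (0 <= y <= 0 + 1).
  by apply: HM; rewrite add0r in y01.
rewrite (_ : step = ramp 0 1) ?dramp0 ?normr0//.
by apply/funext => z; rewrite /ramp subr0 divr1.
Qed.

Lemma drampE c h t : 'D_1 (ramp c h) t = h^-1 * 'D_1 (step : R^o -> R^o) ((t - c) / h).
Proof.
rewrite (@derive_comp_affine _ R^o R^o (step : R^o -> R^o) (fun t : R^o => (t - c) / h : R^o) (fun v => v / h)); last first.
  by move=> u v x; rewrite /GRing.scale /=; ring.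
have [_ ->] := derive_dir1 (1 / h) (@smooth_derivable _ R^o R^o _ ((t - c) / h : R^o) (1 : R^o) (@step_smooth R)).
by rewrite mul1r.
Qed.

Lemma dramp_bounded c h M t : 0 < h -> (forall y, `|'D_1 (step : R^o -> R^o) y| <= M) ->
  `|'D_1 (ramp c h) t| <= M / h.
Proof.
move=> h0 HM; rewrite drampE normrM ger0_norm ?invr_ge0 ?(ltW h0)// mulrC.
by rewrite ler_wpM2r ?invr_ge0 ?(ltW h0).
Qed.

Lemma dramp_continuous c h : continuous (fun t : R => 'D_1 (ramp c h) t : R).
Proof.
exact: (smooth_continuous (smooth_derive (1 : R^o) (ramp_smooth c h))).
Qed.

Lemma dramp_patch c h : 0 < c -> 0 < h ->
  (fun t => 'D_1 (ramp c h) t) \_ (`]0, +oo[%classic : set mR) =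
  (fun t => 'D_1 (ramp c h) t) \_ (`[c, c + h]%classic : set mR).
Proof.
move=> c0 h0; apply/funext => t; rewrite /patch !mem_setE !in_itv /= andbT.
have [tc|tc] := boolP (c <= t <= c + h).
  by case/andP: tc => tc _; rewrite (lt_le_trans c0 tc).
by rewrite dramp0// if_same.
Qed.

Lemma dramp_integrable c h : 0 < c -> 0 < h ->
  leb.-integrable (`]0, +oo[%classic : set mR) (fun t => ('D_1 (ramp c h) t)%:E).
Proof.
move=> c0 h0.
have i1 : leb.-integrable (`[c, c + h]%classic : set mR) (fun t => ('D_1 (ramp c h) t)%:E).
  apply: continuous_compact_integrable; first exact: segment_compact.
  by apply: continuous_subspaceT; exact: dramp_continuous.
have E : (EFin \o (fun t => 'D_1 (ramp c h) t)) \_ (`]0, +oo[%classic : set mR) =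
    (EFin \o (fun t => 'D_1 (ramp c h) t)) \_ (`[c, c + h]%classic : set mR).
  by rewrite !restrict_EFin dramp_patch.
apply/(integrable_mkcond _ (measurable_itvT _)); rewrite E.
exact/(integrable_mkcond _ (measurable_itvT _)).
Qed.

Lemma dramp_integral c h : 0 < c -> 0 < h ->
  \int[leb]_(t in `]0, +oo[) 'D_1 (ramp c h) t = 1.
Proof.
move=> c0 h0; rewrite Rintegral_mkcond dramp_patch// -Rintegral_mkcond.
rewrite /Rintegral (@continuous_FTC2 _ _ (ramp c h)).
- by rewrite ramp1// ramp0//= subr0.
- by rewrite ltrDl.
- by apply: continuous_subspaceT; exact: dramp_continuous.
- have cr := smooth_continuous (ramp_smooth c h).
  split; [by move=> x _; exact: smooth_derivable (ramp_smooth c h)| |].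
    by apply: cvg_at_right_filter; exact: cr.
  by apply: cvg_at_left_filter; exact: cr.
- by move=> x _; rewrite derive1E.
Qed.

(** Rises from 0 to 1 on [[h, 2 * h]] and returns to 0 on [[t + h, t + 2 * h]]; the
    support stays away from time 0, as required of test functions on the open half
    line. *)
Definition plateau (t h : R) : R^o -> R^o := fun s => ramp h h s - ramp (t + h) h s.

Lemma plateau_smooth t h : smooth (plateau t h).
Proof.
move=> k; rewrite (_ : plateau t h = fun s => ramp h h s + (-1 : R) *: (ramp (t + h) h s : R^o)).
  apply: Ck_add; first exact: ramp_smooth.
  by apply: (@Ck_scale _ _ R^o _ (fun=> -1 : R^o)); [exact: Ck_cst|exact: ramp_smooth].
by apply/funext => s; rewrite scaleN1r.
Qed.

Lemma plateau_le1 t h s : `|plateau t h s| <= 1.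
Proof.
rewrite ler_norml /plateau; have := ramp_ge0 h h s; have := ramp_le1 h h s.
by have := ramp_ge0 (t + h) h s; have := ramp_le1 (t + h) h s; lra.
Qed.

Lemma plateau_supp t h s : 0 <= t -> 0 < h -> ~~ (h <= s <= t + 2 * h) -> plateau t h s = 0.
Proof.
move=> t0 h0; rewrite negb_and -!ltNge /plateau => /orP[sh|sh].
  by rewrite !ramp0 ?subrr//; lra.
by rewrite !ramp1 ?subrr//; lra.
Qed.

Lemma dplateau t h s : 'D_1 (plateau t h) s = 'D_1 (ramp h h) s - 'D_1 (ramp (t + h) h) s.
Proof.
rewrite -deriveB//; exact: smooth_derivable (ramp_smooth _ _).
Qed.

(** Each edge of the plateau has derivative of integral 1 in absolute value, supported
    in an interval of length [h] and bounded by [M / h]: it averages [a] near 0, resp.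
    near [t]. The function [a] is not assumed measurable. *)
Lemma plateau_pairing (a : R -> R) (t h M eta : R) : 0 <= t -> 0 < h -> 0 <= eta ->
  (forall y, `|'D_1 (step : R^o -> R^o) y| <= M) ->
  (forall s, 0 <= s <= 2 * h -> `|a s - a 0| <= eta) ->
  (forall s, t <= s <= t + 2 * h -> `|a s - a t| <= eta) ->
  `|\int[leb]_(s in `]0, +oo[) ('D_1 (plateau t h) s * a s) - (a 0 - a t)| <= 2 * M * eta.
Proof.
move=> t0 h0 eta0 HM a0 at_.
have M0 : 0 <= M by apply: le_trans (HM 0).
have th0 : 0 < t + h by lra.
set D := (`]0, +oo[%classic : set mR).
have mD : measurable D by exact: measurable_itv.
have i1 := dramp_integrable h0 h0; have i2 := dramp_integrable th0 h0.
have iZ (k : R) (f : R -> R) : leb.-integrable D (EFin \o f) -> leb.-integrable D (EFin \o (fun s => k * f s)).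
  by move=> iF; have := integrableZl mD k iF; apply: eq_integrable.
have iA : leb.-integrable D (EFin \o (fun s => a 0 * 'D_1 (ramp h h) s - a t * 'D_1 (ramp (t + h) h) s)).
  have := integrableB mD (iZ (a 0) _ i1) (iZ (a t) _ i2); by apply: eq_integrable.
pose I1 : set mR := `[h, h + h]%classic; pose I2 : set mR := `[t + h, t + h + h]%classic.
have iI c : leb.-integrable D (EFin \o (\1_(`[c, c + h]%classic : set mR) : R -> R)).
  exact: (integrableS measurableT mD (@subsetT _ _) (integrable_indic_itv c (c + h) true false)).
have iR : leb.-integrable D (EFin \o (fun s => M / h * eta * (\1_I1 s + \1_I2 s))).
  apply: iZ; have := integrableD mD (iI h) (iI (t + h)); by apply: eq_integrable.
have := @Rintegral_close _ mR R leb D (fun s => 'D_1 (plateau t h) s * a s) _ _ mD iA iR.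
have IA : \int[leb]_(s in D) (a 0 * 'D_1 (ramp h h) s - a t * 'D_1 (ramp (t + h) h) s) = a 0 - a t.
  rewrite (RintegralB mD (iZ _ _ i1) (iZ _ _ i2)).
  congr (_ - _).
    by rewrite (RintegralZl (a 0) mD i1) (dramp_integral h0 h0) mulr1.
  by rewrite (RintegralZl (a t) mD i2) (dramp_integral th0 h0) mulr1.
have IR : \int[leb]_(s in D) (M / h * eta * (\1_I1 s + \1_I2 s)) <= 2 * M * eta.
  rewrite RintegralZl//; last first.
    by have := integrableD mD (iI h) (iI (t + h)); apply: eq_integrable.
  rewrite RintegralD//; [|exact: iI|exact: iI].
  have L c : \int[leb]_(s in D) (\1_(`[c, c + h]%classic : set mR) s : R) <= h.
    rewrite /Rintegral integral_indic//.
    have lI : leb (`[c, c + h]%classic : set mR) = h%:E.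
      by rewrite lebesgue_measure_itv /= lte_fin ltrDl h0 -EFinD addrC addKr.
    rewrite -lee_fin fineK; last first.
      rewrite ge0_fin_numE//; apply: le_lt_trans (_ : (h%:E < +oo)%E); last by rewrite ltry.
      by rewrite -lI; apply: le_measure; [apply: mem_set; exact: measurableI|apply: mem_set; exact: measurable_itv|exact: subIsetl].
    by rewrite -lI; apply: le_measure; [apply: mem_set; exact: measurableI|apply: mem_set; exact: measurable_itv|exact: subIsetl].
  apply: (@le_trans _ _ (M / h * eta * (h + h))).
    by apply: ler_wpM2l; [rewrite mulr_ge0// divr_ge0// ltW|apply: lerD; exact: L].
  rewrite le_eqVlt; apply/orP; left; apply/eqP; field; by rewrite gt_eqF.
rewrite IA => H; apply: le_trans IR; apply: H.
apply: nearW => s; rewrite /D /= in_itv /= andbT => s0.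
rewrite dplateau.
have key c c0 : c = c0 + h -> (forall s, c0 <= s <= c0 + 2 * h -> `|a s - a c0| <= eta) ->
    `|'D_1 (ramp c h) s * (a s - a c0)| <= M / h * eta * \1_(`[c, c + h]%classic : set mR) s.
  move=> -> Hc; rewrite indicE mem_setE in_itv /=.
  have [sc|sc] := boolP (c0 + h <= s <= c0 + h + h); last by rewrite dramp0// mul0r normr0 mulr0.
  rewrite mulr1 normrM; apply: ler_pM => //; first exact: dramp_bounded.
  by apply: Hc; move: sc => /andP[]; lra.
have k1 := key h 0 (esym (add0r _)) (ltac:(by move=> z; rewrite add0r; exact: a0)).
have k2 := key (t + h) t erefl at_.
have alg (x y p q r : R) : (x - y) * p - (q * x - r * y) = x * (p - q) - y * (p - r) by ring.
rewrite alg [leRHS]mulrDr.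
by apply: le_trans (ler_normB _ _) _; exact: lerD.
Qed.

End Ramp.

(** * Variation of an amplitude *)

Section AmplitudeDrift.
Context {R : realType}.
Local Notation leb := (@lebesgue_measure R).
Local Notation leb2 := (leb \x leb)%E.
Local Notation mR := (measurableTypeR R).
Local Notation RR := (mR * mR)%type.
Local Notation omega := (@omega R : set RR).

Local Opaque wderiv inv_lap_pow tderiv.

Lemma L2_continuous_sq (m : R -> R * R -> 'rV[R]_3) : L2_continuous m ->
  forall t0, 0 <= t0 -> forall e, 0 < e -> exists2 r : R, 0 < r &
    forall s, 0 <= s -> `|s - t0| < r ->
    (sq (fun x => enorm ((m s \- m t0) x)) <= e%:E)%E.
Proof.
move=> cm t0 t00 e e0; have /L2norm_cvg0P H := cm t0 t00.
have [r /= r0 rH] := H e e0; exists r => // s s0 st.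
by apply: rH => /=; [rewrite distrC|rewrite in_itv /= s0].
Qed.

Lemma sq_comp_le n (f : R * R -> 'rV[R]_n) i :
  (sq (mcomp f i) <= sq (fun x => enorm (f x)))%E.
Proof.
apply: integral_mono => x _; rewrite lee_fin sqr_sqrtr ?dot_ge0//.
exact: dot_comp.
Qed.

Lemma amplitude_continuous (m : R -> R * R -> 'rV[R]_3) (chi : R^o -> R^o) i :
  cutoff chi -> L2_continuous m -> (forall t, 0 <= t -> L2 (mcomp (m t) i)) ->
  forall t0, 0 <= t0 -> forall eta, 0 < eta -> exists2 r : R, 0 < r &
    forall s, 0 <= s -> `|s - t0| < r ->
    `|amplitude m chi i s - amplitude m chi i t0| <= eta.
Proof.
move=> chic cm Lm t0 t00 eta eta0; have Lchi := chi_L2 chic.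
set C := inner (fun x : R * R => chi x.1) (fun x => chi x.1) + 1.
have C0 : 0 < C by rewrite ltr_wpDl// inner_ge0.
have [r r0 rH] := L2_continuous_sq cm t00 (divr_gt0 (exprn_gt0 2 eta0) C0).
exists r => // s s0 st; have := rH s s0 st => H.
have Ld : L2 (fun x => mcomp (m s) i x - mcomp (m t0) i x) by apply: L2_B; exact: Lm.
have dE : inner (fun x => mcomp (m s) i x - mcomp (m t0) i x) (fun x => mcomp (m s) i x - mcomp (m t0) i x) <= eta ^+ 2 / C.
  rewrite -lee_fin -sqE//; apply: le_trans H; apply: le_trans (sq_comp_le _ i).
  by apply: integral_mono => x _; rewrite /mcomp !mxE.
rewrite /amplitude (innerC (fun x => chi x.1)) (innerC (fun x => chi x.1) (mcomp (m t0) i)).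
rewrite -innerBl//; try exact: Lm.
rewrite -(ler_pXn2r (_ : (0 < 2)%N)) ?nnegrE ?(ltW eta0)//.
rewrite real_normK ?num_real//; apply: le_trans (inner_CS Ld Lchi) _.
apply: (@le_trans _ _ (eta ^+ 2 / C * C)); last by rewrite divfK// gt_eqF.
by apply: ler_pM => //; rewrite ?inner_ge0// /C lerDl.
Qed.

Variables (delta eps alpha beta E V W0 theta K : R) (t : R).
Variables (v : R -> R * R -> 'rV[R]_2) (m : R -> R * R -> 'rV[R]_3).
Variables (chi : R^o -> R^o) (i : 'I_3).
Hypotheses (delta0 : 0 < delta) (eps0 : 0 < eps) (alpha0 : 0 < alpha)
  (beta0 : 0 < beta) (theta0 : 0 < theta) (V0 : 0 <= V) (t0 : 0 <= t).
Local Notation T := (t + 1).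
Hypothesis mH1 : forall s : R, 0 <= s -> forall k, H1 (mcomp (m s) k).
Hypothesis mapprox : forall s : R, 0 <= s -> forall k, exists phi : nat -> R * R -> R^o,
  (forall n, smooth_closure (phi n)) /\ H1cvg phi (mcomp (m s) k).
Hypothesis msph : forall s : R, 0 <= s ->
  {ae leb2, forall x, omega x -> dot (m s x) (m s x) = 1}.
Hypothesis mE : forall s : R, 0 <= s <= T -> (energy delta eps (m s) <= E%:E)%E.
Hypothesis Hw : is_tderiv m (tderiv m).
Hypothesis HW : (\int[leb]_(s in `[0%R, T]) vL2norm (tderiv m s) ^+ 2 <= W0%:E)%E.
Hypothesis Hllg : LLG delta eps alpha beta v m.
Hypothesis Hv : {ae leb, forall s : R, 0 <= s ->
  {ae leb2, forall x, omega x -> enorm (v s x) <= V}}.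
Hypothesis cm : L2_continuous m.
Hypotheses (chic : cutoff chi) (chiK : forall y, `|chi y| <= K)
  (dchiK : forall y, `|'D_1 chi y| <= K).

(** Let the edges of the plateau become steep; [amplitude] is continuous because [m]
    is continuous with values in [L^2]. *)
Lemma amplitude_drift : `|amplitude m chi i 0 - amplitude m chi i t| <=
  flux_bound delta eps alpha beta E T V W0 theta K.
Proof.
apply/ler_addgt0Pr => e e0.
have [M M0 HM] := @dstep_bounded R.
set eta := e / (2 * M + 1).
have M1 : 0 < 2 * M + 1 by rewrite ltr_wpDl// mulr_ge0.
have eta0 : 0 < eta by rewrite divr_gt0.
have Lm s : 0 <= s -> L2 (mcomp (m s) i) by move=> s0; case: (mH1 s0 i).
have [r1 r10 H1] := amplitude_continuous chic cm Lm (lexx 0) eta0.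
have [r2 r20 H2] := amplitude_continuous chic cm Lm t0 eta0.
(* Both edges of the plateau lie where [amplitude] varies by at most [eta], and its
   support lies in [[0, t + 1]]. *)
pose h := Num.min (1 / 2) (Num.min (r1 / 4) (r2 / 4)).
have h0 : 0 < h by rewrite !lt_min divr_gt0 ?divr_gt0//=.
have h1 : h <= 1 / 2 by rewrite ge_min lexx.
have h2 : h <= r1 / 4 by rewrite !ge_min lexx orbT.
have h3 : h <= r2 / 4 by rewrite !ge_min lexx !orbT.
have P := @plateau_pairing R (amplitude m chi i) t h M eta t0 h0 (ltW eta0) HM.
have {}P : `|\int[leb]_(s in `]0, +oo[) ('D_1 (plateau t h) s * amplitude m chi i s) -
    (amplitude m chi i 0 - amplitude m chi i t)| <= 2 * M * eta.
  apply: P => s /andP[s1 s2].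
    by apply: H1 => //; rewrite subr0 ger0_norm//; lra.
  by apply: H2; [exact: le_trans s1|rewrite ger0_norm ?subr_ge0//; lra].
have F := @time_estimate R delta eps alpha beta E T V W0 theta K v m chi (plateau t h) h (t + 2 * h) i.
have {}F : `|\int[leb]_(s in `]0, +oo[) ('D_1 (plateau t h) s * amplitude m chi i s)| <=
    flux_bound delta eps alpha beta E T V W0 theta K.
  apply: F => //; first by rewrite addr_ge0.
  - exact: plateau_smooth.
  - by move=> s; exact: plateau_le1.
  - by rewrite lerD2l; lra.
  - by move=> s; exact: plateau_supp.
have eM : 2 * M * eta <= e.
  by rewrite /eta mulrA ler_pdivrMr//; nra.
move: P F; move: (\int[leb]_(s in _) _) (amplitude m chi i 0 - _) => I A.
rewrite ler_distl => /andP[P1 P2]; rewrite !ler_norml => /andP[F1 F2].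
by apply/andP; split; lra.
Qed.

End AmplitudeDrift.

(** * Consequences of the energy inequality *)

Section FixedDelta.
Context {R : realType}.
Local Notation leb := (@lebesgue_measure R).
Local Notation leb2 := (leb \x leb)%E.
Local Notation leb3 := (leb2 \x leb)%E.
Local Notation mR := (measurableTypeR R).
Local Notation RR := (mR * mR)%type.
Local Notation omega := (@omega R : set RR).

Local Opaque wderiv inv_lap_pow tderiv.

Lemma sqre_le_inv (N : \bar R) (V : R) : 0 <= V -> (N ^+ 2 <= (V ^+ 2)%:E)%E ->
  (N <= V%:E)%E.
Proof.
move=> V0; case: N => [r| |]; [|by rewrite expe2 mulyy leye_eq|by rewrite leNye].
rewrite expe2 -EFinM !lee_fin => h; rewrite leNgt; apply/negP => Vr.
by move: h; rewrite -expr2 leNgt ltr_pXn2r ?nnegrE// ?(le_trans V0 (ltW Vr))// Vr.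
Qed.

Lemma Lnorm_infty_ae d (T : measurableType d) (mu : {measure set T -> \bar R}) (f : T -> \bar R) (V : R) :
  ('N[mu]_+oo[f] <= V%:E)%E -> {ae mu, forall z, (`|f z| <= V%:E)%E}.
Proof.
rewrite unlock; case: ifPn => [_ /ess_supP //|mu0 _].
exists setT; split => //; apply/eqP; rewrite eq_le measure_ge0 andbT.
by rewrite leNgt.
Qed.

Lemma ae_Lnorm_infty d (T : measurableType d) (mu : {measure set T -> \bar R}) (f : T -> \bar R) (V : R) :
  0 <= V -> {ae mu, forall z, (`|f z| <= V%:E)%E} -> ('N[mu]_+oo[f] <= V%:E)%E.
Proof.
move=> V0 H; rewrite unlock; case: ifPn => [_|_]; last by rewrite lee_fin.
exact/ess_supP.
Qed.

(** The bound in space-time holds at almost every time, by [ae_ysection]. *)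
Lemma velocity_ae (v : R -> R * R -> 'rV[R]_2) (V : R) : 0 <= V ->
  (Linf_norm_time v ^+ 2 <= (V ^+ 2)%:E)%E ->
  {ae leb, forall s : R, 0 <= s -> {ae leb2, forall x, omega x -> enorm (v s x) <= V}}.
Proof.
move=> V0 /(sqre_le_inv V0) /Lnorm_infty_ae H.
have := @ae_ysection _ _ RR mR R area leb _ H.
apply: filterS => s Hs s0; apply: filterS Hs => x + ox.
rewrite /= /patch ifT; last first.
  by rewrite inE; split => //=; rewrite in_itv /= s0.
by rewrite lee_fin; apply: le_trans; exact: ler_norm.
Qed.

Lemma velocity_integral (v : R -> R * R -> 'rV[R]_2) (V t : R) : 0 <= V -> 0 <= t ->
  {ae leb, forall s : R, 0 <= s -> {ae leb2, forall x, omega x -> enorm (v s x) <= V}} ->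
  (\int[leb]_(s in `[0%R, t]) Linf_norm (v s) ^+ 2 <= (V ^+ 2 * t)%:E)%E.
Proof.
move=> V0 t0 H; set D := (`[0%R, t]%classic : set mR).
apply: (@le_trans _ _ (\int[leb]_(s in D) (V ^+ 2)%:E)%E); last first.
  rewrite integral_cst//= ?lebesgue_measure_itv /=; last exact: measurable_itv.
  case: ifPn => _; first by rewrite oppr0 adde0.
  by rewrite mule0 lee_fin mulr_ge0 ?sqr_ge0.
apply: (@le_integral_ub _ mR R leb D); [exact: measurable_itv|exact: measurable_cst|].
apply: (@filterS _ _ (ae_filter_ringOfSetsType leb) _ _ _ H) => s Hs; rewrite /D /= in_itv /= => /andP[s0 _].
have : (Linf_norm (v s) <= V%:E)%E.
  apply: ae_Lnorm_infty => //; apply: filterS (Hs s0) => x Hx.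
  rewrite /= /patch; case: ifPn => ox; last by rewrite normr0 lee_fin.
  rewrite lee_fin ger0_norm ?sqrtr_ge0//; apply: Hx; exact: set_mem.
have : (0 <= Linf_norm (v s))%E by exact: Lnorm_ge0.
by move=> h1 h2; rewrite expr2 EFinM; exact: lee_pmul.
Qed.

Lemma ae_exists_itv (P : R -> Prop) (a b : R) : a < b -> {ae leb, forall s, P s} ->
  exists s, [/\ a < s, s < b & P s].
Proof.
move=> ab [N [mN N0 PN]]; apply: contrapT => nex.
have sub : (`]a, b[%classic : set mR) `<=` N.
  move=> s /=; rewrite in_itv /= => /andP[s1 s2]; apply: PN => /= Ps.
  by apply: nex; exists s.
have : (leb (`]a, b[%classic : set mR) <= leb N)%E.
  by apply: le_measure => //; apply: mem_set => //; exact: measurable_itv.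
rewrite N0 lebesgue_measure_itv /= lte_fin ab -EFinB lee_fin.
by rewrite subr_le0 leNgt ab.
Qed.

Lemma dotC n (u w : 'rV[R]_n) : dot u w = dot w u.
Proof. by apply: eq_bigr => i _; rewrite mulrC. Qed.

Lemma dot_sub n (u w : 'rV[R]_n) : dot (u - w) (u - w) = dot u u - 2 * dot u w + dot w w.
Proof.
rewrite /dot mulr_sumr -sumrB -big_split /=; apply: eq_bigr => i _.
by rewrite !mxE; ring.
Qed.

Lemma dotZr n (u w : 'rV[R]_n) c : dot u (c *: w) = c * dot u w.
Proof. by rewrite /dot mulr_sumr; apply: eq_bigr => i _; rewrite mxE; ring. Qed.

Lemma dot_unit_le n (u w : 'rV[R]_n) : dot w w = 1 -> dot w u <= enorm u.
Proof.
move=> w1; apply: le_trans (ler_norm _) _; rewrite -sqrtr_sqr.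
apply: ler_wsqrtr; set c := dot w u.
have : 0 <= dot (u - c *: w) (u - c *: w) by exact: dot_ge0.
rewrite dot_sub.
rewrite (dotZr u w c) (dotZr (c *: w) w c) (dotC (c *: w) w) (dotZr w w c) w1.
rewrite (dotC u w) -/c mulr1.
by lra.
Qed.

Lemma sphere_dist n (u w : 'rV[R]_n) : dot w w = 1 ->
  (enorm u - 1) ^+ 2 <= dot (w - u) (w - u).
Proof.
move=> w1; rewrite dot_sub w1; have := dot_unit_le u w1.
have : enorm u ^+ 2 = dot u u by rewrite sqr_sqrtr ?dot_ge0.
by move: (enorm u) (dot w u) (dot u u) => a b c <-; rewrite sqrrB; lra.
Qed.

(** The constraint is given for almost every time only. Times satisfying it accumulate
    at every [t], and it passes to the limit since [m] is continuous with values in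
    [L^2]: by [sphere_dist], [(|m t| - 1) ^ 2 <= |m s - m t| ^ 2] where [|m s| = 1]. *)
Lemma sphere_everywhere (m : R -> R * R -> 'rV[R]_3) :
  Linf_loc_H1S2 m -> L2_continuous m ->
  forall t, 0 <= t -> {ae leb2, forall x, omega x -> dot (m t x) (m t x) = 1}.
Proof.
move=> [mjm mS] cm t t0.
pose f x := enorm (m t x) - 1.
have me : measurable_fun omega (fun x => enorm (m t x)).
  apply: (@measurableT_comp _ _ _ _ _ _ (@Num.sqrt R)).
    exact: continuous_measurable_fun (@sqrt_continuous R).
  rewrite (_ : (fun x => _) = fun x => mcomp (m t) 0 x * mcomp (m t) 0 x +
     mcomp (m t) 1 x * mcomp (m t) 1 x + mcomp (m t) 2 x * mcomp (m t) 2 x); last first.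
    by apply/funext => x; rewrite /dot sum_ord3.
  have M k := measurable_slice k mjm t0.
  exact: (measurable_funD (measurable_funD (measurable_funM (M 0) (M 0)) (measurable_funM (M 1) (M 1))) (measurable_funM (M 2) (M 2))).
have small e : 0 < e -> (sq f <= e%:E)%E.
  move=> e0; have [r r0 rH] := L2_continuous_sq cm t0 e0.
  have [C HC] := mS (t + r).
  (* A time [s] close to [t] at which the constraint holds. *)
  have [s [s1 s2 Hs]] := @ae_exists_itv _ t (t + r) (ltac:(by rewrite ltrDl)) HC.
  have s0 : 0 <= s by apply: le_trans t0 (ltW s1).
  have [[_ sph] _] := Hs (introT andP (conj s0 (ltW s2))).
  have st : `|s - t| < r by rewrite ger0_norm; lra.
  apply: le_trans (rH s s0 st).
  have mse : measurable_fun omega (fun x => (f x ^+ 2)%:E).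
    by apply/measurable_EFinP; apply: measurable_funX; apply: measurable_funB => //; exact: measurable_cst.
  apply: le_integral_lb => //; first exact: measurable_omega.
  apply: (@filterS _ _ (ae_filter_ringOfSetsType leb2) _ _ _ sph) => x Hx ox; rewrite lee_fin sqr_sqrtr ?dot_ge0//.
  exact: sphere_dist (Hx ox).
have f0 : sq f = 0%E.
  apply/eqP; rewrite eq_le sq_ge0 andbT.
  by apply/lee_addgt0Pr => e e0; rewrite add0e; exact: small.
have mf2 : measurable_fun omega (fun x => (f x ^+ 2)%:E).
  by apply/measurable_EFinP; apply: measurable_funX; apply: measurable_funB => //; exact: measurable_cst.
have E0 : (\int[leb2]_(x in omega) `|(f x ^+ 2)%:E| = 0)%E.
  by rewrite -f0; apply: eq_integral => x _; rewrite gee0_abs// lee_fin sqr_ge0.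
have := (ae_eq_integral_abs leb2 (@measurable_omega R) mf2).1 E0.
apply: filterS => x Hx ox; have := Hx ox => /= -[] /eqP.
rewrite sqrf_eq0 subr_eq0 => /eqP e1.
have : enorm (m t x) ^+ 2 = 1 by rewrite e1 expr1n.
by rewrite sqr_sqrtr ?dot_ge0.
Qed.

Lemma energy_nonneg (delta eps : R) (m : R * R -> 'rV[R]_3) : 0 < delta ->
  (0 <= energy delta eps m)%E.
Proof.
move=> d0; apply: adde_ge0.
  apply: integral_ge0 => x _; rewrite lee_fin addr_ge0//.
    by apply: sumr_ge0 => j _; exact: dot_ge0.
  by rewrite mulr_ge0 ?invr_ge0 ?sqr_ge0.
rewrite mule_ge0//; first by rewrite lee_fin invr_ge0 mulr_ge0// ltW.
by apply: integral_ge0 => x _; rewrite lee_fin sqr_ge0.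
Qed.

(** As [|v| ^ 2 <= alpha * beta], the exponent [4 / (alpha * beta) * \int |v| ^ 2] is
    at most [4 * t]. *)
Lemma energy_growth (delta eps alpha beta C t : R) (v : R -> R * R -> 'rV[R]_2)
    (m0 : R * R -> 'rV[R]_3) (m : R -> R * R -> 'rV[R]_3) :
  0 < delta -> 0 < alpha -> 0 < beta -> 0 <= C -> 0 <= t ->
  (energy delta eps m0 <= C%:E)%E ->
  (Linf_norm_time v ^+ 2 <= (alpha * beta)%:E)%E ->
  energy_inequality delta eps alpha beta v m0 m ->
  (energy delta eps (m t) <= (C * expR (4 * t))%:E)%E /\
  (\int[leb]_(s in `[0%R, t]) vL2norm (tderiv m s) ^+ 2 <= (2 * beta / alpha * (C * expR (4 * t)))%:E)%E.
Proof.
move=> d0 a0 b0 C0 t0 HC Hv HE.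
pose V := Num.sqrt (alpha * beta).
have ab0 : 0 < alpha * beta by rewrite mulr_gt0.
have V2 : V ^+ 2 = alpha * beta by rewrite sqr_sqrtr// ltW.
have V0 : 0 <= V by exact: sqrtr_ge0.
rewrite -V2 in Hv.
have Vi := velocity_integral V0 t0 (velocity_ae V0 Hv).
have ex : (expeR ((4 / (alpha * beta))%:E * \int[leb]_(s in `[0%R, t]) Linf_norm (v s) ^+ 2) <= (expR (4 * t))%:E)%E.
  have I0 : (0 <= \int[leb]_(s in `[0%R, t]) Linf_norm (v s) ^+ 2)%E.
    by apply: integral_ge0 => s _; rewrite expe2 mule_ge0// Lnorm_ge0.
  move: Vi I0; case: (\int[leb]_(s in _) _)%E => [I|//|//].
  rewrite !lee_fin V2 => I1 I0; rewrite ler_expR.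
  rewrite [leRHS](_ : _ = 4 / (alpha * beta) * (alpha * beta * t)); last by field; rewrite !gt_eqF.
  by apply: ler_wpM2l => //; rewrite divr_ge0// ltW.
have rhs : (energy delta eps m0 * expeR ((4 / (alpha * beta))%:E * \int[leb]_(s in `[0%R, t]) Linf_norm (v s) ^+ 2) <= (C * expR (4 * t))%:E)%E.
  rewrite (EFinM C); apply: lee_pmul => //; last exact: expeR_ge0.
  by apply: energy_nonneg.
have tot := le_trans (HE t t0) rhs.
have e1 : (0 <= energy delta eps (m t))%E by exact: energy_nonneg.
have e2 : (0 <= \int[leb]_(s in `[0%R, t]) vL2norm (tderiv m s) ^+ 2)%E.
  by apply: integral_ge0 => s _; rewrite vL2norm_sqr integral_ge0// => x _; rewrite lee_fin dot_ge0.
have c0 : 0 < alpha / (2 * beta) by rewrite divr_gt0// mulr_gt0.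
split.
  apply: le_trans tot; rewrite leeDl// mule_ge0// lee_fin ltW//.
have h : ((alpha / (2 * beta))%:E * \int[leb]_(s in `[0%R, t]) vL2norm (tderiv m s) ^+ 2 <= (C * expR (4 * t))%:E)%E.
  by apply: le_trans tot; rewrite leeDr.
have -> : 2 * beta / alpha = (alpha / (2 * beta))^-1 by rewrite invf_div.
by rewrite EFinM lee_pdivlMl.
Qed.

End FixedDelta.

(** * Approximation of step functions by cutoffs *)

Section StepApproximation.
Context {R : realType}.
Local Notation leb := (@lebesgue_measure R).
Local Notation leb2 := (leb \x leb)%E.
Local Notation mR := (measurableTypeR R).
Local Notation RR := (mR * mR)%type.
Local Notation omega := (@omega R : set RR).

Lemma cutoff_bounded (chi : R^o -> R^o) : cutoff chi -> exists K : R,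
  (forall y, `|chi y| <= K) /\ (forall y, `|'D_1 chi y| <= K).
Proof.
move=> [sc [c c1 H]].
have [K1 K10 HK1] := @continuous_segment_bounded _ _ (-1) 1 (smooth_continuous sc).
have [K2 K20 HK2] := @continuous_segment_bounded _ _ (-1) 1 (smooth_continuous (smooth_derive (1 : R^o) sc)).
have out y : ~~ (-1 <= y <= 1) -> c < `|y|.
  by move=> /negP h; rewrite ltNge; apply/negP => yc; apply: h; rewrite -ler_norml (le_trans yc)// ltW.
exists (K1 + K2); split => y; have [y1|/out y1] := boolP (-1 <= y <= 1).
- by apply: le_trans (HK1 _ y1) _; rewrite lerDl.
- by rewrite H// normr0 addr_ge0.
- by apply: le_trans (HK2 _ y1) _; rewrite lerDr.
- rewrite (@derive_locally_cst _ _ 0) ?normr0 ?addr_ge0//.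
  near=> z; apply: H; near: z.
  exact: (@norm_continuous _ R^o y _ (lt_nbhsr y1)).
Unshelve. all: by end_near. Qed.

(** Three such strips cover the places where a step function and its smoothing
    differ. *)
Definition strip (a b : R) : R * R -> R := \1_(`[a, b]%classic `*` `[0, 1[%classic).

Lemma stripE a b x : omega x -> strip a b x = ((a <= x.1 <= b)%R)%:R.
Proof.
move=> [_ x2]; rewrite /strip indicE; congr (nat_of_bool _)%:R.
apply/idP/idP => [/set_mem[/=]|x1]; first by rewrite in_itv.
by apply/mem_set; split => //=; rewrite in_itv.
Qed.

Lemma strip_ge0 a b x : 0 <= strip a b x. Proof. by rewrite /strip indicE. Qed.

Lemma strip_set_measurable a b : measurable (`[a, b]%classic `*` `[0%R, 1%R[%classic : set RR).
Proof. exact: (measurableX (measurable_itvT `[a, b]) (measurable_itvT `[0%R, 1%R[)). Qed.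

Lemma strip_iom a b : iom (strip a b).
Proof.
apply: (@iom_dom _ _ (fun=> 1)); [|exact: iom_cst|].
  exact: (measurable_indic (strip_set_measurable a b)).
by move=> x _; rewrite /strip indicE ger0_norm//; case: (_ \in _).
Qed.

Lemma strip_int a b : a <= b -> \int[leb2]_(x in omega) strip a b x <= b - a.
Proof.
move=> ab; have mS := strip_set_measurable a b.
have mA : (leb2 (`[a, b]%classic `*` `[0%R, 1%R[%classic : set RR) = (b - a)%:E).
  transitivity (leb (`[a, b]%classic : set mR) * leb (`[0%R, 1%R[%classic : set mR))%E.
    by apply: product_measure1E; exact: measurable_itv.
  rewrite !lebesgue_measure_itv /= !lte_fin ltr01 oppr0 adde0 mule1.
  case: ifPn => [_|]; first by rewrite EFinB.
  by rewrite -leNgt => ba; congr EFin; apply/eqP; rewrite eq_sym subr_eq0 eq_le ab ba.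
rewrite -lee_fin /Rintegral fineK; last exact: (integrable_fin_num (@measurable_omega R) (strip_iom a b)).
rewrite integral_indic//; last exact: measurable_omega.
rewrite -mA; apply: le_measure; [|exact: mem_set|exact: subIsetl].
by apply: mem_set; apply: measurableI => //; exact: measurable_omega.
Qed.

(** A smooth substitute for the indicator of [[a, b]] that vanishes outside
    [[a + h, b - h]] and equals 1 on [[a + 2 * h, b - 2 * h]]; if [b - a] is small the
    second interval is empty, which is harmless. *)
Definition window (a b h : R) : R^o -> R^o :=
  fun y => ramp (a + h) h y * (1 - ramp (b - 2 * h) h y).

Lemma window_smooth a b h : smooth (window a b h).
Proof.
move=> k; apply: (@Ck_scale _ _ R^o _ (ramp (a + h) h)); first exact: ramp_smooth.
rewrite (_ : (fun x => _) = fun x => (1 : R^o) + (-1 : R) *: (ramp (b - 2 * h) h x : R^o)).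
  apply: Ck_add; first exact: Ck_cst.
  by apply: (@Ck_scale _ _ R^o _ (fun=> -1 : R^o)); [exact: Ck_cst|exact: ramp_smooth].
by apply/funext => s; rewrite scaleN1r.
Qed.

Lemma window_itv a b h y : 0 <= window a b h y <= 1.
Proof.
have := ramp_ge0 (a + h) h y; have := ramp_le1 (a + h) h y.
have := ramp_ge0 (b - 2 * h) h y; have := ramp_le1 (b - 2 * h) h y.
rewrite /window => h1 h2 h3 h4; apply/andP; split; first by rewrite mulr_ge0// subr_ge0.
by rewrite mulr_ile1// ?subr_ge0// lerBlDr lerDl.
Qed.

Lemma window0 a b h y : 0 < h -> (y <= a + h) || (b - h <= y) -> window a b h y = 0.
Proof.
move=> h0 /orP[ya|yb]; rewrite /window; first by rewrite ramp0// mul0r.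
by rewrite [X in 1 - X]ramp1 ?subrr ?mulr0//; lra.
Qed.

Lemma window1 a b h y : 0 < h -> a + 2 * h <= y <= b - 2 * h -> window a b h y = 1.
Proof.
by move=> h0 /andP[ya yb]; rewrite /window ramp1 ?ramp0 ?subr0 ?mulr1//; lra.
Qed.

(** The jump and the two boundary components are surrounded by strips of width of
    order [h], outside of which the step function and its smoothing agree. This
    covers jumps at or near the boundary. *)
Lemma step_approx (p q xs e : R) : `|p| <= 1 -> `|q| <= 1 -> -1 <= xs <= 1 -> 0 < e ->
  exists (chi : R^o -> R^o) (rho : R * R -> R),
    [/\ cutoff chi, iom rho, \int[leb2]_(x in omega) rho x <= e &
      forall x, omega x -> `|(if x.1 < xs then p else q) - chi x.1| <= rho x].
Proof.
move=> p1 q1 /andP[xs1 xs2] e0; pose h := Num.min (1 / 2) (e / 8).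
have h0 : 0 < h by rewrite lt_min !divr_gt0.
have he : h <= e / 8 by rewrite ge_min lexx orbT.
have h1 : h <= 1 / 2 by rewrite ge_min lexx.
pose chi : R^o -> R^o := fun y => p * window (-1) xs h y + q * window xs 1 h y.
pose rho x := strip (-1) (-1 + 2 * h) x + (strip (xs - 2 * h) (xs + 2 * h) x + strip (1 - 2 * h) 1 x).
exists chi, rho; split.
- split.
    move=> k; apply: Ck_add.
      by apply: (@Ck_scale _ _ R^o _ (fun=> p : R^o)); [exact: Ck_cst|exact: window_smooth].
    by apply: (@Ck_scale _ _ R^o _ (fun=> q : R^o)); [exact: Ck_cst|exact: window_smooth].
  exists (1 - h); first lra.
  move=> y; rewrite ltr_normr => /orP[yh|yh].
    by rewrite /chi !window0 ?mulr0 ?addr0//; apply/orP; right; lra.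
  by rewrite /chi !window0 ?mulr0 ?addr0//; apply/orP; left; lra.
- by apply: iomD; [|apply: iomD]; exact: strip_iom.
- rewrite RintegralD; [|exact: measurable_omega|exact: strip_iom|by apply: iomD; exact: strip_iom].
  rewrite RintegralD; [|exact: measurable_omega|exact: strip_iom|exact: strip_iom].
  have i1 := @strip_int (-1) (-1 + 2 * h) (ltac:(lra)).
  have i2 := @strip_int (xs - 2 * h) (xs + 2 * h) (ltac:(lra)).
  have i3 := @strip_int (1 - 2 * h) 1 (ltac:(lra)).
  apply: le_trans (lerD i1 (lerD i2 i3)) _; lra.
- move=> x ox; have ox' := ox; case: ox' => /= + _; rewrite in_itv /= => /andP[x1 x2].
  have r0 : 0 <= rho x by rewrite /rho !addr_ge0// strip_ge0.
  have rho1 : [|| -1 <= x.1 <= -1 + 2 * h, xs - 2 * h <= x.1 <= xs + 2 * h | 1 - 2 * h <= x.1 <= 1] -> 1 <= rho x.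
    rewrite /rho !stripE//.
    have G (b1 b2 b3 : bool) : [|| b1, b2 | b3] -> (1 : R) <= b1%:R + (b2%:R + b3%:R).
      by move: b1 b2 b3 => [] [] [] //= _; lra.
    exact: G.
  have W a b := window_itv a b h x.1.
  have bnd (c w : R) : `|c| <= 1 -> 0 <= w <= 1 -> `|c - c * w| <= 1.
    move=> c1 /andP[w0 w1]; have -> : c - c * w = c * (1 - w) by ring.
    rewrite normrM (@ger0_norm _ (1 - w)) ?subr_ge0//.
    by apply: mulr_ile1; rewrite ?subr_ge0// lerBlDr lerDl.
  rewrite /chi; case: ltP => xxs.
    rewrite (@window0 xs) ?mulr0 ?addr0//; last by apply/orP; left; lra.
    have [mid|nmid] := boolP (-1 + 2 * h <= x.1 <= xs - 2 * h).
      by rewrite window1// mulr1 subrr normr0.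
    apply: le_trans (bnd _ _ p1 (W _ _)) _; apply: rho1.
    move: nmid; rewrite negb_and -!ltNge => /orP[g|g]; apply/orP; [left|right; apply/orP; left]; lra.
  rewrite (@window0 (-1)) ?mulr0 ?add0r//; last by apply/orP; right; lra.
  have [mid|nmid] := boolP (xs + 2 * h <= x.1 <= 1 - 2 * h).
    by rewrite window1// mulr1 subrr normr0.
  apply: le_trans (bnd _ _ q1 (W _ _)) _; apply: rho1.
  move: nmid; rewrite negb_and -!ltNge => /orP[g|g]; apply/orP; right; apply/orP; [left|right]; lra.
Qed.

End StepApproximation.

(** * Asymptotic regime *)

Section Asymptotics.
Context {R : realType}.

Definition xlog (delta : R) : R := delta * `|ln delta|.

Lemma xlog_gt0 delta : 0 < delta < 2^-1 -> 0 < xlog delta.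
Proof.
move=> /andP[d0 d1]; rewrite mulr_gt0// normr_gt0 lt_eqF// ln_lt0// d0/=.
by rewrite (lt_le_trans d1)// invf_le1 ?ler1n.
Qed.

(** With [s = sqrt delta], [delta * |ln delta| = 2 * s ^ 2 * ln (1 / s) <= 2 * s]. *)
Lemma xlog_sqr delta : 0 < delta < 2^-1 -> xlog delta ^+ 2 <= 4 * delta.
Proof.
move=> dd; have x0 := xlog_gt0 dd; case/andP: dd => d0 d1.
pose s := Num.sqrt delta; have s0 : 0 < s by rewrite sqrtr_gt0.
have sE : s ^+ 2 = delta by rewrite sqr_sqrtr// ltW.
have h : xlog delta <= 2 * s.
  rewrite /xlog ltr0_norm; last first.
    by rewrite ln_lt0// d0/= (lt_le_trans d1)// invf_le1 ?ler1n.
  have -> : - ln delta = 2 * ln s^-1.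
    by rewrite lnV ?posrE// -sE lnXn// mulrN mulr_natl.
  have : ln s^-1 <= s^-1 by apply/ltW/ln_sublinear; rewrite invr_gt0.
  rewrite -{1}sE => l1; apply: (@le_trans _ _ (s ^+ 2 * (2 * s^-1))).
    by rewrite ler_wpM2l ?sqr_ge0// ler_wpM2l.
  by rewrite le_eqVlt; apply/orP; left; apply/eqP; field; rewrite gt_eqF.
have -> : 4 * delta = (2 * s) ^+ 2 by rewrite exprMn sE -natrX.
by apply: lerXn2r; rewrite ?nnegrE ?(ltW x0) ?mulr_ge0 ?(ltW s0).
Qed.

Definition flux_cst (nu C1 T K : R) : R :=
  2 * nu * K * T + 2 * K * C1 + 8 * K * T * (2 + C1) +
  8 * T * ((4 + K ^+ 2) * C1 + 2 * K ^+ 2) + 6 * K * T * (1 + nu) * (2 + C1).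

Lemma flux_cst_ge0 nu C1 T K : 0 < nu -> 0 <= C1 -> 0 <= T -> 0 <= K ->
  0 <= flux_cst nu C1 T K.
Proof.
move=> nu0 C0 T0 K0; have nu0' := ltW nu0; have K2 := sqr_ge0 K.
by rewrite /flux_cst; repeat (apply: addr_ge0 || apply: mulr_ge0).
Qed.

(** The weight is [theta = eps * eta / lambda], so that the anisotropy contributes
    [eta + lambda ^ 2 / (x * eta)] up to constants, while every other term is at most
    a constant times [eps / x ^ 3]. *)
Lemma flux_le (nu C1 T K x delta eps lam eta : R) :
  0 < nu -> 0 <= C1 -> 0 <= T -> 0 <= K -> 0 < x -> x <= 1 -> 0 < delta ->
  0 < eps -> 0 < lam -> lam <= 1 -> 0 < eta -> x ^+ 2 <= 4 * delta ->
  flux_bound delta eps (nu * eps) (lam * eps) (C1 / x) T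
    (Num.sqrt (nu * eps * (lam * eps))) (2 * (lam * eps) / (nu * eps) * (C1 / x))
    (eps * eta / lam) K
  <= flux_cst nu C1 T K * (eps / x ^+ 3)
     + 2 * K * T * (2 * eta + lam ^+ 2 / x * (C1 / eta)).
Proof.
move=> nu0 C0 T0 K0 x0 x1 d0 e0 l0 l1 eta0 xd.
have nu0' := ltW nu0; have l0' := ltW l0; have e0' := ltW e0.
pose z := eps / x ^+ 3.
have xn n : 0 < x ^+ n by rewrite exprn_gt0.
have zn n : (n <= 3)%N -> eps / x ^+ n <= z.
  move=> n3; rewrite /z ler_pM2l// lef_pV2 ?posrE//.
  by apply: ler_wiXn2l => //; exact: ltW.
have z0 : 0 <= z by rewrite divr_ge0// ltW.
have ze : eps <= z by have := zn 0%N isT; rewrite expr0 divr1.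
have zx : eps / x <= z by have := zn 1%N isT; rewrite expr1.
have zx2 : eps / x ^+ 2 <= z by exact: zn.
have ecx (a b : R) : 0 <= a -> 0 <= b -> eps * (a + b / x) <= (a + b) * z.
  move=> a0 b0; rewrite (_ : eps * _ = a * eps + b * (eps / x)); last by ring.
  by rewrite mulrDl; apply: lerD; exact: ler_wpM2l.
have V1 : Num.sqrt (nu * eps * (lam * eps)) <= (1 + nu) * eps.
  rewrite -(@ger0_norm _ ((1 + nu) * eps)) ?mulr_ge0 ?addr_ge0// -sqrtr_sqr.
  apply: ler_wsqrtr; rewrite (_ : _ * _ = (nu * lam) * eps ^+ 2); last by ring.
  rewrite exprMn ler_wpM2r ?sqr_ge0//; nra.
have p0 : 0 <= 2 + C1 / x by rewrite addr_ge0// divr_ge0// ltW.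
have t1 : nu * eps * K * (2 * T + 2 * (lam * eps) / (nu * eps) * (C1 / x)) <=
    (2 * nu * K * T + 2 * K * C1) * z.
  rewrite (_ : _ * _ = eps * (2 * nu * K * T + (2 * K * C1 * lam) / x)); last first.
    by field; rewrite !gt_eqF.
  apply: le_trans (ecx _ _ _ _) _; rewrite ?mulr_ge0//.
  by rewrite ler_wpM2r// lerD2l ler_piMr// mulr_ge0// mulr_ge0.
have t2 : lam * eps * (8 * K * (2 + C1 / x)) <= 8 * K * (2 + C1) * z.
  apply: (@le_trans _ _ (8 * K * (eps * (2 + C1 / x)))).
    rewrite (_ : _ * _ = lam * (8 * K * (eps * (2 + C1 / x)))); last by ring.
    by rewrite ler_piMl// !mulr_ge0.
  by rewrite -[leRHS]mulrA ler_wpM2l ?mulr_ge0//; exact: ecx.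
have t3 : lam * eps * (2 * (delta^-1 * (4 * (C1 / x) + K ^+ 2 * (C1 / x + 2)))) <=
    8 * ((4 + K ^+ 2) * C1 + 2 * K ^+ 2) * z.
  have dx : delta^-1 <= 4 / x ^+ 2.
    by rewrite -[leLHS]mul1r ler_pdivrMr// mulrAC ler_pdivlMr// mul1r.
  set Q := 4 * (C1 / x) + K ^+ 2 * (C1 / x + 2).
  have cx0 : 0 <= C1 / x by rewrite divr_ge0// ltW.
  have Q0 : 0 <= Q by apply: addr_ge0; apply: mulr_ge0; rewrite ?sqr_ge0// addr_ge0.
  apply: (@le_trans _ _ (eps * (2 * (4 / x ^+ 2 * Q)))).
    apply: ler_pM.
    - by rewrite mulr_ge0.
    - by rewrite !mulr_ge0// invr_ge0 ltW.
    - by rewrite ler_piMl.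
    - by rewrite ler_wpM2l// ler_wpM2r.
  rewrite (_ : eps * _ = 8 * (((4 + K ^+ 2) * C1) * (eps / x ^+ 3) + 2 * K ^+ 2 * (eps / x ^+ 2))); last first.
    by rewrite /Q; field; rewrite gt_eqF.
  rewrite (_ : 8 * _ * z = 8 * (((4 + K ^+ 2) * C1) * z + 2 * K ^+ 2 * z)); last by ring.
  apply: ler_wpM2l => //; apply: lerD => //.
  by apply: ler_wpM2l => //; rewrite mulr_ge0// sqr_ge0.
have t4 : lam * eps * (2 * (K * (2 * (eps * eta / lam) / eps ^+ 2 + C1 / x / (eps * eta / lam)))) =
    2 * K * (2 * eta + lam ^+ 2 / x * (C1 / eta)).
  by field; rewrite !gt_eqF.
have t5 : 6 * K * Num.sqrt (nu * eps * (lam * eps)) * (2 + C1 / x) <= 6 * K * (1 + nu) * (2 + C1) * z.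
  apply: (@le_trans _ _ (6 * K * ((1 + nu) * eps) * (2 + C1 / x))).
    by rewrite ler_wpM2r// ler_wpM2l// mulr_ge0.
  rewrite (_ : _ * _ = 6 * K * (1 + nu) * (eps * (2 + C1 / x))); last by ring.
  by rewrite -[leRHS]mulrA ler_wpM2l ?mulr_ge0 ?addr_ge0//; exact: ecx.
rewrite /flux_bound /grad_bound /flux_cst -/z.
set G1 := delta^-1 * _ in t3 *; set G2 := K * (_ + _) in t4 *.
rewrite (_ : lam * eps * (_ + 2 * (G1 + G2)) = lam * eps * (8 * K * (2 + C1 / x)) + lam * eps * (2 * G1) + lam * eps * (2 * G2)); last by ring.
rewrite t4.
apply: (@le_trans _ _ ((2 * nu * K * T + 2 * K * C1) * z + T * ((8 * K * (2 + C1) * z + 8 * ((4 + K ^+ 2) * C1 + 2 * K ^+ 2) * z + 2 * K * (2 * eta + lam ^+ 2 / x * (C1 / eta))) + 6 * K * (1 + nu) * (2 + C1) * z))).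
  apply: lerD => //; apply: ler_wpM2l => //; apply: lerD => //.
  by rewrite lerD2r; apply: lerD.
by rewrite le_eqVlt; apply/orP; left; apply/eqP; ring.
Qed.

(** First [eta] is chosen small, then [delta] such that [lambda ^ 2 / x] is small
    compared with [eta]; and [eps <= exp (- 1 / x)] gives
    [eps / x ^ 3 <= 24 * x] by [flat_le]. *)
Lemma flux_small (nu C1 T K : R) (eps lambda : R -> R) (e : R) :
  0 < nu -> 0 <= C1 -> 0 <= T -> 0 <= K -> 0 < e ->
  (forall delta : R, 0 < delta < 2^-1 -> 0 < eps delta) ->
  eps delta @[delta --> 0^'+] --> 0 ->
  ((fun delta : R => ((delta * `|ln delta|)^-1)%R : R^o) =o_ (at_right (0 : R))
              (fun delta : R => `|ln (eps delta)|%R : R^o)) ->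
  (forall delta : R, 0 < delta < 2^-1 -> 0 < lambda delta) ->
  ((lambda : R -> R^o) =o_ (at_right (0 : R))
                 (fun delta : R => (Num.sqrt (delta * `|ln delta|))%R : R^o)) ->
  exists2 r : R, 0 < r & forall delta : R, 0 < delta < 2^-1 -> delta < r ->
   exists2 theta : R, 0 < theta &
    flux_bound delta (eps delta) (nu * eps delta) (lambda delta * eps delta)
      (C1 / xlog delta) T
      (Num.sqrt (nu * eps delta * (lambda delta * eps delta)))
      (2 * (lambda delta * eps delta) / (nu * eps delta) * (C1 / xlog delta)) theta K <= e.
Proof.
move=> nu0 C0 T0 K0 e0 ep0 ecvg erate l0 lrate.
pose A := flux_cst nu C1 T K; have A0 : 0 <= A by exact: flux_cst_ge0.
(* The summands 1 in [kt], [C1 + 1] and [A + 1] only serve to divide by positive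
   numbers. *)
pose kt := 2 * K * T + 1; have kt0 : 0 < kt by rewrite ltr_wpDl ?mulr_ge0.
pose eta := e / (8 * kt); have eta0 : 0 < eta by rewrite divr_gt0// mulr_gt0.
pose c := Num.sqrt (e * eta / (4 * kt * (C1 + 1))).
have C11 : 0 < C1 + 1 by rewrite ltr_wpDl.
have A11 : 0 < A + 1 by rewrite ltr_wpDl.
have cc : 0 < e * eta / (4 * kt * (C1 + 1)).
  by apply: divr_gt0; do ?[apply: mulr_gt0 => //].
have c0 : 0 < c by rewrite sqrtr_gt0.
pose d := e / (4 * 24 * (A + 1)).
have d0 : 0 < d by apply: divr_gt0; do ?[apply: mulr_gt0 => //].
have /eqoP E1 := erate; have /eqoP L1 := lrate.
have [r1 /= r10 H1] := E1 1 ltr01.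
have [r2 /= r20 H2] := L1 (Num.min c 1) (ltac:(by rewrite lt_min c0 ltr01)).
have /cvgrPdist_lt E2 := ecvg; have [r3 /= r30 H3] := E2 1 ltr01.
pose r4 := (Num.min 1 d) ^+ 2 / 4.
have m0 : 0 < Num.min 1 d by rewrite lt_min ltr01.
have r40 : 0 < r4 by rewrite divr_gt0// exprn_gt0.
exists (Num.min (Num.min r1 r2) (Num.min r3 r4)); first by rewrite !lt_min r10 r20 r30 r40.
move=> delta dd; rewrite !lt_min => /andP[/andP[dr1 dr2] /andP[dr3 dr4]].
have [del0 _] := andP dd.
have dist r : delta < r -> `|0 - delta| < r by rewrite sub0r normrN gtr0_norm.
have x0 := xlog_gt0 dd; have x2 := xlog_sqr dd.
have := H1 delta (dist _ dr1) del0; have := H2 delta (dist _ dr2) del0.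
have := H3 delta (dist _ dr3) del0; rewrite sub0r normrN gtr0_norm ?ep0// => e1.
rewrite /= -/(xlog delta) mul1r !normr_id => Hl He.
have xm : xlog delta <= Num.min 1 d.
  rewrite -(ler_pXn2r (_ : (0 < 2)%N)) ?nnegrE ?(ltW x0) ?(ltW m0)//.
  by apply: le_trans x2 _; rewrite -ler_pdivlMl// mulrC ltW.
move: xm; rewrite le_min => /andP[x1 xd].
have lx : lambda delta <= Num.min c 1 * Num.sqrt (xlog delta).
  by move: Hl; rewrite (gtr0_norm (l0 _ dd)) (ger0_norm (sqrtr_ge0 _)).
have sx1 : Num.sqrt (xlog delta) <= 1 by rewrite -sqrtr1 ler_wsqrtr.
have l1 : lambda delta <= 1.
  have mc0 : 0 <= Num.min c 1 by rewrite le_min (ltW c0) ler01.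
  have mc1 : Num.min c 1 <= 1 by rewrite ge_min lexx orbT.
  exact: le_trans lx (mulr_ile1 mc0 (sqrtr_ge0 _) mc1 sx1).
have lsq : lambda delta ^+ 2 / xlog delta <= c ^+ 2.
  rewrite ler_pdivrMr// -[X in _ * X]sqr_sqrtr ?(ltW x0)// -exprMn lerXn2r ?nnegrE ?(ltW (l0 _ dd))//.
    by rewrite mulr_ge0 ?sqrtr_ge0// ltW.
  by apply: le_trans lx _; rewrite ler_wpM2r ?sqrtr_ge0// ge_min lexx.
have ez : eps delta / xlog delta ^+ 3 <= 24 * xlog delta.
  (* The little-o with constant 1, since [ln (eps delta) < 0]. *)
  have lne : (xlog delta)^-1 <= - ln (eps delta).
    move: He; rewrite gtr0_norm ?invr_gt0// => /le_trans; apply.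
    by rewrite ltr0_norm// ln_lt0// ep0//= e1.
  have ee : eps delta <= expR (- (xlog delta)^-1).
    by rewrite -[leLHS]lnK ?posrE ?ep0// ler_expR lerNr.
  have := flat_le 3 (xlog delta); rewrite /flat x0 gtr0_norm// => h.
  apply: le_trans h; rewrite mulrC exprVn; apply: ler_wpM2l => //.
  by rewrite invr_ge0 exprn_ge0// (ltW x0).
exists (eps delta * eta / lambda delta).
  have el0 := ep0 _ dd; have la0 := l0 _ dd.
  by apply: divr_gt0 => //; exact: mulr_gt0.
apply: le_trans (flux_le nu0 C0 T0 K0 x0 x1 del0 (ep0 _ dd) (l0 _ dd) l1 eta0 x2) _.
have b1 : A * (eps delta / xlog delta ^+ 3) <= e / 4.
  apply: (@le_trans _ _ (A * (24 * d))).
    by rewrite ler_wpM2l//; apply: le_trans ez _; rewrite ler_wpM2l.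
  have -> : A * (24 * d) = e / 4 * (A / (A + 1)).
    by rewrite /d; field; rewrite gt_eqF.
  rewrite ler_piMr//; first by rewrite divr_ge0// ltW.
  by rewrite ler_pdivrMr ?ltr_wpDl// mul1r lerDl.
have b2 : 2 * K * T * (2 * eta + lambda delta ^+ 2 / xlog delta * (C1 / eta)) <= e / 2.
  have c2 : c ^+ 2 = e * eta / (4 * kt * (C1 + 1)) by rewrite sqr_sqrtr// ltW.
  have p2 : lambda delta ^+ 2 / xlog delta * (C1 / eta) <= e / (4 * kt).
    apply: (@le_trans _ _ (c ^+ 2 * (C1 / eta))).
      by rewrite ler_wpM2r// divr_ge0// ltW.
    have -> : c ^+ 2 * (C1 / eta) = e / (4 * kt) * (C1 / (C1 + 1)).
      by rewrite c2; field; rewrite !gt_eqF.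
    rewrite ler_piMr//; first by rewrite divr_ge0 ?(ltW e0)// mulr_ge0// ltW.
    by rewrite ler_pdivrMr ?ltr_wpDl// mul1r lerDl.
  have p1 : 2 * eta = e / (4 * kt) by rewrite /eta; field; rewrite gt_eqF.
  apply: (@le_trans _ _ (kt * (e / (4 * kt) + e / (4 * kt)))).
    have h1 : 0 <= 2 * K * T by rewrite !mulr_ge0.
    have h2 : 0 <= 2 * eta + lambda delta ^+ 2 / xlog delta * (C1 / eta).
      have c1 : 0 <= C1 / eta by rewrite divr_ge0// ltW.
      have c3 : 0 <= lambda delta ^+ 2 / xlog delta by rewrite divr_ge0 ?sqr_ge0// ltW.
      by apply: addr_ge0; apply: mulr_ge0 => //; exact: ltW.
    have h3 : 2 * K * T <= kt by rewrite /kt lerDl.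
    by apply: ler_pM => //; rewrite p1 lerD2l.
  by rewrite le_eqVlt; apply/orP; left; apply/eqP; field; rewrite gt_eqF.
by apply: le_trans (lerD b1 b2) _; lra.
Qed.

End Asymptotics.

(** * Distance to the wall *)

Section WallPairing.
Context {R : realType}.
Local Notation leb := (@lebesgue_measure R).
Local Notation leb2 := (leb \x leb)%E.
Local Notation mR := (measurableTypeR R).
Local Notation RR := (mR * mR)%type.
Local Notation omega := (@omega R : set RR).

Definition jump (p q xs : R) : R * R -> R := fun x => if x.1 < xs then p else q.

Lemma jump_L2 p q xs : L2 (jump p q xs).
Proof.
apply: (@L2_bounded _ _ (`|p| + `|q|)).
  apply: (@measurable_funTS _ _ RR).
  apply: measurable_fun_ifT; [|exact: measurable_cst|exact: measurable_cst].
  by apply: measurable_fun_ltr; [exact: measurable_fst|exact: measurable_cst].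
by move=> x _; rewrite /jump; case: ifP => _; rewrite ?lerDl ?lerDr.
Qed.

(** Here [chi] and [rho] are those provided by [step_approx]; replacing the step
    function by [chi] costs [|u_k - w_k| <= 2] times the integral of [rho]. *)
Lemma jump_pairing_le (u w : R * R -> 'rV[R]_3) (chi : R^o -> R^o) (rho : R * R -> R) k p q xs e :
  L2 (mcomp u k) -> L2 (mcomp w k) -> cutoff chi -> iom rho ->
  {ae leb2, forall x, omega x -> `|u x 0 k| <= 1} ->
  {ae leb2, forall x, omega x -> `|w x 0 k| <= 1} ->
  \int[leb2]_(x in omega) rho x <= e ->
  (forall x, omega x -> `|jump p q xs x - chi x.1| <= rho x) ->
  inner (jump p q xs) (mcomp u k) - inner (jump p q xs) (mcomp w k) <=
  2 * e + `|inner (fun x => chi x.1) (mcomp u k) - inner (fun x => chi x.1) (mcomp w k)|.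
Proof.
move=> Lu Lw chic irho u1 w1 rhoe jc.
have Lj := jump_L2 p q xs; have Lc := chi_L2 chic.
have Ld := L2_B Lu Lw.
rewrite !(innerC _ (mcomp u k)) !(innerC _ (mcomp w k)) -!innerBl//.
set d := fun x => _.
have := @Rintegral_close _ RR R leb2 omega (fun x => d x * jump p q xs x) (fun x => d x * chi x.1)
  (fun x => 2 * rho x) (@measurable_omega R) (L2_M Ld Lc) (iomZ 2 irho).
rewrite RintegralZl; [|exact: measurable_omega|exact: irho].
rewrite -/(inner d _) -/(inner d (fun x => chi x.1)) => H.
have {}H : `|inner d (jump p q xs) - inner d (fun x => chi x.1)| <= 2 * \int[leb2]_(x in omega) rho x.
  apply: H; apply: filterS2 u1 w1 => x ux wx ox.
  rewrite -mulrBr normrM; apply: ler_pM => //; last exact: jc.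
  apply: le_trans (ler_normB _ _) _; apply: lerD; [exact: ux|exact: wx].
have := le_trans (ler_norm _) H; have := ler_norm (inner d (fun x => chi x.1)).
lra.
Qed.

Variables (a xs : R).
Hypothesis a01 : 0 <= a < 1.
Local Notation s := (Num.sqrt (1 - a ^+ 2)).
Local Notation wall := (straight_wall a xs).

Lemma wall_sqr : s ^+ 2 = 1 - a ^+ 2.
Proof. by case/andP: a01 => a0 a1; rewrite sqr_sqrtr//; nra. Qed.

Lemma wall_le1 : `|s| <= 1.
Proof.
rewrite ger0_norm ?sqrtr_ge0// -(ler_pXn2r (_ : (0 < 2)%N)) ?nnegrE ?sqrtr_ge0// wall_sqr expr1n.
by rewrite lerBlDr lerDl sqr_ge0.
Qed.

Lemma dot_wall (u : 'rV[R]_3) x : dot u (wall x) = jump a a xs x * u 0 0 + jump (- s) s xs x * u 0 1.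
Proof.
rewrite /dot sum_ord3 /straight_wall /jump; case: ifP => _; rewrite !mxE /=; ring.
Qed.

Lemma wall_unit x : dot (wall x) (wall x) = 1.
Proof.
have := wall_sqr; rewrite dot_wall /straight_wall /jump; case: ifP => _; rewrite !mxE /= => h; nra.
Qed.

Lemma wall_comp_L2 k : L2 (mcomp wall k).
Proof.
rewrite (_ : mcomp _ k = jump (m_infty a (-1) 0 k) (m_infty a 1 0 k) xs); first exact: jump_L2.
by apply/funext => x; rewrite /mcomp /straight_wall /jump; case: ifP.
Qed.

Lemma dist_measurable (u : R * R -> 'rV[R]_3) : (forall k, L2 (mcomp u k)) ->
  measurable_fun omega (fun x => (enorm ((u \- wall) x) ^+ 2)%:E).
Proof.
move=> Lu; apply/measurable_EFinP.
rewrite (_ : (fun x => _) = fun x => \sum_k (mcomp u k x - mcomp wall k x) ^+ 2).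
  apply: measurable_sum => k; apply: measurable_funX; apply: L2_measurable.
  by apply: L2_B => //; exact: wall_comp_L2.
apply/funext => x; rewrite sqr_sqrtr ?dot_ge0//; apply: eq_bigr => k _.
by rewrite /mcomp !mxE expr2.
Qed.

(** The expansion of [|u - m*| ^ 2] with [|u| = |m*| = 1], integrated over [omega],
    whose area is 2. Only the components 0 and 1 of the wall are nonzero. *)
Lemma sq_wall (u : R * R -> 'rV[R]_3) : (forall k, L2 (mcomp u k)) ->
  {ae leb2, forall x, omega x -> dot (u x) (u x) = 1} ->
  sq (fun x => enorm ((u \- wall) x)) =
  (4 - 2 * (inner (jump a a xs) (mcomp u 0) + inner (jump (- s) s xs) (mcomp u 1)))%:E.
Proof.
move=> Lu u1.
pose f0 x := jump a a xs x * mcomp u 0 x; pose f1 x := jump (- s) s xs x * mcomp u 1 x.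
have i0 : iom f0 by apply: L2_M => //; exact: jump_L2.
have i1 : iom f1 by apply: L2_M => //; exact: jump_L2.
have i01 := iomD i0 i1.
have i2 : iom (fun x => 2 - 2 * (f0 x + f1 x)) by apply: iomB; [exact: iom_cst|exact: iomZ].
have -> : sq (fun x => enorm ((u \- wall) x)) = (\int[leb2]_(x in omega) (2 - 2 * (f0 x + f1 x))%:E)%E.
  apply: ae_eq_integral => //; [exact: measurable_omega|exact: dist_measurable|exact: (measurable_int _ i2)|].
  apply: filterS u1 => x ux ox; congr EFin.
  rewrite sqr_sqrtr ?dot_ge0// (dot_sub (u x)) ux// wall_unit dot_wall /f0 /f1 /mcomp; ring.
rewrite -[LHS]fineK; last exact: (integrable_fin_num (@measurable_omega R) i2).
congr EFin.
transitivity (\int[leb2]_(x in omega) (2 - 2 * (f0 x + f1 x))); first by [].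
rewrite RintegralB; [|exact: measurable_omega|exact: iom_cst|exact: (iomZ 2 i01)].
rewrite RintegralZl; [|exact: measurable_omega|exact: i01].
rewrite Rint_omega_cst RintegralD; [|exact: measurable_omega|exact: i0|exact: i1].
by congr (_ - _); ring.
Qed.

Lemma dist_ae_le (u w : R * R -> 'rV[R]_3) : (forall k, L2 (mcomp u k)) ->
  {ae leb2, forall x, omega x -> u x = w x} ->
  (sq (fun x => enorm ((u \- wall) x)) <= sq (fun x => enorm ((w \- wall) x)))%E.
Proof.
move=> Lu uw; apply: le_integral_lb; [exact: measurable_omega|exact: dist_measurable|].
by apply: (@filterS _ _ (ae_filter_ringOfSetsType leb2) _ _ _ uw) => x Hx ox; rewrite /= Hx.
Qed.

End WallPairing.

Section Conclusion.
Context {R : realType}.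
Local Notation leb := (@lebesgue_measure R).
Local Notation leb2 := (leb \x leb)%E.
Local Notation mR := (measurableTypeR R).
Local Notation RR := (mR * mR)%type.
Local Notation omega := (@omega R : set RR).

Local Opaque wderiv inv_lap_pow tderiv.

(** [amplitude_drift] for a weak solution. The smooth approximations of its components
    are those contained in the boundary condition. *)
Lemma solution_drift (delta eps alpha beta C t theta K : R)
    (v : R -> R * R -> 'rV[R]_2) (m0 : R * R -> 'rV[R]_3)
    (m : R -> R * R -> 'rV[R]_3) (chi : R^o -> R^o) i :
  0 < delta -> 0 < eps -> 0 < alpha -> 0 < beta -> 0 < theta -> 0 <= C -> 0 <= t ->
  (energy delta eps m0 <= C%:E)%E ->
  (Linf_norm_time v ^+ 2 <= (alpha * beta)%:E)%E ->
  weak_solution delta eps alpha beta v m ->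
  energy_inequality delta eps alpha beta v m0 m ->
  (forall s, 0 <= s -> forall k, exists g, is_trace (mcomp (m s) k) 1 g) ->
  cutoff chi -> (forall y, `|chi y| <= K) -> (forall y, `|'D_1 chi y| <= K) ->
  `|amplitude m chi i 0 - amplitude m chi i t| <=
  flux_bound delta eps alpha beta (C * expR (4 * (t + 1))) (t + 1) (Num.sqrt (alpha * beta))
    (2 * beta / alpha * (C * expR (4 * (t + 1)))) theta K.
Proof.
move=> d0 e0 a0 b0 th0 C0 t0 HC Hv [mS [w Hw] cm Hllg] HE Htr chic chiK dchiK.
have G s : 0 <= s -> _ := fun s0 => energy_growth d0 a0 b0 C0 s0 HC Hv HE.
have t10 : 0 <= t + 1 by rewrite addr_ge0.
apply: (@amplitude_drift R delta eps alpha beta _ _ _ theta K t v m chi i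
  d0 e0 a0 b0 th0 (sqrtr_ge0 _) t0 _ _ _ _ _ _ Hllg _ cm chic chiK dchiK).
- by move=> s s0 k; have [g []] := Htr s s0 k.
- by move=> s s0 k; have [g [_ _ [phi [h1 h2 _]]]] := Htr s s0 k; exists phi.
- by move=> s s0; exact: sphere_everywhere.
- move=> s /andP[s0 s1]; apply: le_trans (G s s0).1 _.
  by rewrite lee_fin ler_wpM2l// ler_expR ler_wpM2l.
- exact: (xgetI _ Hw).
- exact: (G _ t10).2.
- apply: velocity_ae; first exact: sqrtr_ge0.
  by rewrite sqr_sqrtr ?mulr_ge0 ?(ltW a0) ?(ltW b0).
Qed.

End Conclusion.

(** * Stability of the straight wall *)

Unset Implicit Arguments.
Set Strict Implicit.

Theorem corollary2 (R : realType) (m1inf : R) (m1inf_range : 0 <= m1inf < 1)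
  (m0 : R -> R * R -> 'rV[R]_3)
  (m0_H1 : forall delta : R, 0 < delta < 2^-1 -> H1S2 (m0 delta))
  (eps lambda : R -> R) (nu : R)
  (* A1 *)
  (m0_bdry : forall delta : R, 0 < delta < 2^-1 -> forall s, s = -1 \/ s = 1 ->
     forall i, is_trace (mcomp (m0 delta) i) s (fun=> m_infty m1inf s 0 i))
  (m0_energy :
     (ereal_sup [set (delta * `|ln delta|)%:E *
                     energy delta (eps delta) (m0 delta)
                | delta in `]0%R, 2^-1%R[] < +oo)%E)
  (* A2 *)
  (eps_gt0 : forall delta : R, 0 < delta < 2^-1 -> 0 < eps delta)
  (eps_cvg : eps delta @[delta --> 0^'+] --> 0)
  (eps_rate : (fun delta : R => ((delta * `|ln delta|)^-1)%R : R^o) =o_ (at_right (0 : R))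
              (fun delta : R => `|ln (eps delta)|%R : R^o))
  (nu_gt0 : 0 < nu)
  (lambda_gt0 : forall delta : R, 0 < delta < 2^-1 -> 0 < lambda delta)
  (lambda_rate : (lambda : R -> R^o) =o_ (at_right (0 : R))
                 (fun delta : R => (Num.sqrt (delta * `|ln delta|))%R : R^o))
  (alpha beta : R -> R)
  (alphaE : forall delta : R, 0 < delta < 2^-1 -> alpha delta = nu * eps delta)
  (betaE : forall delta : R, 0 < delta < 2^-1 ->
     beta delta = lambda delta * eps delta)
  (* A3 *)
  (v : R -> R -> R * R -> 'rV[R]_2)
  (v_meas : forall delta : R, 0 < delta < 2^-1 -> joint_measurable (v delta))
  (v_bound : forall delta : R, 0 < delta < 2^-1 ->
     (Linf_norm_time (v delta) ^+ 2 <= (alpha delta * beta delta)%:E)%E)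
  (m : R -> R -> R * R -> 'rV[R]_3)
  (m_sol : forall delta : R, 0 < delta < 2^-1 ->
     weak_solution delta (eps delta) (alpha delta) (beta delta)
                   (v delta) (m delta))
  (m_init : forall delta : R, 0 < delta < 2^-1 ->
     {ae (lebesgue_measure \x lebesgue_measure)%E,
        forall x, omega x -> m delta 0 x = m0 delta x})
  (m_bdry : forall delta : R, 0 < delta < 2^-1 -> forall t, 0 <= t ->
     forall s, s = -1 \/ s = 1 -> forall i, exists g,
       is_trace (mcomp (m delta t) i) s g /\ is_trace (mcomp (m0 delta) i) s g)
  (m_energy : forall delta : R, 0 < delta < 2^-1 ->
     energy_inequality delta (eps delta) (alpha delta) (beta delta)
                       (v delta) (m0 delta) (m delta))
  (well_prepared :
     (limf_esup (fun delta : R => (delta * `|ln delta|)%:E *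
                              energy delta (eps delta) (m0 delta)) (0%R^'+)
      <= (pi / 2 * (1 - m1inf) ^+ 2)%:E)%E)
  (deltan : nat -> R) (deltan_range : forall n, 0 < deltan n < 2^-1)
  (deltan_cvg : deltan n @[n --> \oo] --> 0)
  (xs : R) (xs_range : -1 <= xs <= 1)
  (m0_cvg : vL2norm (m0 (deltan n) \- straight_wall m1inf xs)
              @[n --> \oo] --> 0%E) :
  forall t, 0 <= t ->
    vL2norm (m (deltan n) t \- straight_wall m1inf xs) @[n --> \oo] --> 0%E.
Proof.
set x := (xlog : R -> R).
have [C C0 HC] : exists2 C : R, 0 <= C & forall delta : R, 0 < delta < 2^-1 ->
    (energy delta (eps delta) (m0 delta) <= (C / x delta)%:E)%E.
  move: m0_energy; set S := [set _ | _ in _] => supS.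
  exists `|fine (ereal_sup S)| => // delta dd; have x0 : 0 < x delta := xlog_gt0 dd.
  have [d0 _] := andP dd.
  have en0 : (0 <= energy delta (eps delta) (m0 delta))%E by exact: energy_nonneg.
  have ub : ((x delta)%:E * energy delta (eps delta) (m0 delta) <= ereal_sup S)%E.
    by apply: ereal_sup_ubound; exists delta => //=; rewrite in_itv.
  have sup0 : (0 <= ereal_sup S)%E by apply: le_trans ub; rewrite mule_ge0// lee_fin ltW.
  have supf : ereal_sup S \is a fin_num by rewrite ge0_fin_numE.
  rewrite mulrC EFinM lee_pdivlMl// (le_trans ub)// -[leLHS](fineK supf) lee_fin ler_norm//.
move=> t t0; apply/L2norm_cvg0P => e e0.
(* The final bound is [e1] for the initial distance, and twice [2 * e1 + e1] for each
   of the two nonzero components of the wall. *)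
pose e1 := e / 13; have e10 : 0 < e1 by rewrite divr_gt0.
set s := Num.sqrt (1 - m1inf ^+ 2).
have s1 : `|s| <= 1 := wall_le1 m1inf_range.
have a1 : `|m1inf| <= 1 by case/andP: m1inf_range => a0 /ltW al; rewrite ger0_norm.
have [chi0 [rho0 [cut0 irho0 rhoe0 H0]]] := step_approx a1 a1 xs_range e10.
have sN1 : `|- s| <= 1 by rewrite normrN.
have [chi1 [rho1 [cut1 irho1 rhoe1 H1]]] := step_approx sN1 s1 xs_range e10.
have [K0 [cK0 dK0]] := cutoff_bounded cut0.
have [K1 [cK1 dK1]] := cutoff_bounded cut1.
have K00 : 0 <= K0 := le_trans (normr_ge0 _) (cK0 0).
have K10 : 0 <= K1 := le_trans (normr_ge0 _) (cK1 0).
(* A common bound for both cutoffs, so that a single threshold on [delta] serves both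
   components. *)
set K := K0 + K1; have KK0 : K0 <= K by rewrite /K lerDl.
have KK1 : K1 <= K by rewrite /K lerDr.
pose C1 := C * expR (4 * (t + 1)).
have C10 : 0 <= C1 by rewrite mulr_ge0// expR_ge0.
have [r r0 Hr] := @flux_small R nu C1 (t + 1) K eps lambda e1 nu_gt0 C10
  (addr_ge0 t0 ler01) (addr_ge0 K00 K10) e10 eps_gt0 eps_cvg eps_rate lambda_gt0 lambda_rate.
have /L2norm_cvg0P/(_ e1 e10) init := m0_cvg.
have /cvgrPdist_lt/(_ r r0) dr := deltan_cvg.
near=> n.
have i0 : (sq (fun y => enorm ((m0 (deltan n) \- straight_wall m1inf xs) y)) <= e1%:E)%E.
  by near: n; exact: init.
have dist : `|0 - deltan n| < r by near: n; exact: dr.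
move: i0 dist; set delta := deltan n => i0 dist.
have dd : 0 < delta < 2^-1 by exact: deltan_range.
have [d0 _] := andP dd; have x0 : 0 < x delta := xlog_gt0 dd.
have dltr : delta < r.
  by move: dist; rewrite sub0r normrN gtr0_norm.
have [theta th0 flux] := Hr delta dd dltr.
have al0 : 0 < alpha delta by rewrite alphaE// mulr_gt0// eps_gt0.
have be0 : 0 < beta delta by rewrite betaE// mulr_gt0// ?eps_gt0// lambda_gt0.
have trace1 u : 0 <= u -> forall k, exists g, is_trace (mcomp (m delta u) k) 1 g.
  by move=> u0 k; have [g [h _]] := m_bdry delta dd u u0 1 (or_intror erefl) k; exists g.
have drift chi k : cutoff chi -> (forall y, `|chi y| <= K) -> (forall y, `|'D_1 chi y| <= K) ->
    `|inner (fun y => chi y.1) (mcomp (m delta 0) k) - inner (fun y => chi y.1) (mcomp (m delta t) k)| <= e1.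
  move=> cc cK dK; apply: le_trans flux.
  have := solution_drift k d0 (eps_gt0 _ dd) al0 be0 th0 (divr_ge0 C0 (ltW x0)) t0 (HC _ dd)
    (v_bound _ dd) (m_sol _ dd) (m_energy _ dd) trace1 cc cK dK.
  by rewrite (alphaE _ dd) (betaE _ dd) mulrAC.
have d_0 := drift chi0 0 cut0 (fun y => le_trans (cK0 y) KK0) (fun y => le_trans (dK0 y) KK0).
have d_1 := drift chi1 1 cut1 (fun y => le_trans (cK1 y) KK1) (fun y => le_trans (dK1 y) KK1).
have [mS _ cm _] := m_sol _ dd.
have sph u : 0 <= u -> _ := sphere_everywhere mS cm (t := u).
have Lm u k : 0 <= u -> L2 (mcomp (m delta u) k).
  by move=> u0; have [g [[]]] := trace1 u u0 k.
have comp1 u k : 0 <= u -> {ae (lebesgue_measure \x lebesgue_measure)%E, forall y, omega y -> `|m delta u y 0 k| <= 1}.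
  by move=> u0; apply: filterS (sph u u0) => y Hy oy; apply: unit_comp; exact: Hy.
have j0 := jump_pairing_le (Lm 0 0 (lexx 0)) (Lm t 0 t0) cut0 irho0 (comp1 0 0 (lexx 0)) (comp1 t 0 t0) rhoe0 H0.
have j1 := jump_pairing_le (Lm 0 1 (lexx 0)) (Lm t 1 t0) cut1 irho1 (comp1 0 1 (lexx 0)) (comp1 t 1 t0) rhoe1 H1.
have q0 := sq_wall xs m1inf_range (fun k => Lm 0 k (lexx 0)) (sph 0 (lexx 0)).
have qt := sq_wall xs m1inf_range (fun k => Lm t k t0) (sph t t0).
have q0e : (sq (fun y => enorm ((m delta 0%R \- straight_wall m1inf xs) y)) <= e1%:E)%E.
  exact: le_trans (dist_ae_le m1inf xs (fun k => Lm 0 k (lexx 0)) (m_init _ dd)) i0.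
move: q0e; rewrite q0 qt !lee_fin.
move: j0 j1 d_0 d_1; rewrite -/s.
move: (inner (jump _ _ _) _) (inner (jump _ _ _) _) (inner (jump _ _ _) _) (inner (jump _ _ _) _) => A0 A1 A2 A3.
by rewrite /e1; lra.
Unshelve. all: by end_near. Qed.
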